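(* Let $n\ge1$ be an integer and $1<q<\infty$. Then the system \[ \{1\}\cup\{\sqrt2\cos(2\pi\,\mathbf k\cdot x):\mathbf k\in\mathbb Z^n,\ \mathbf k \succ 0\}\cup\{\sqrt2\sin(2\pi\,\mathbf k\cdot x):\mathbf k\in\mathbb Z^n,\ \mathbf k\succ 0\} \] is a Schauder basis (in the Pringsheim sense) of the real Lebesgue space $L_q((0,1)^n)$.
   Context: For $\mathbf k\in\mathbb Z^n\setminus\{0\}$ we write $\mathbf k\succ 0$ if the first non-zero entry of $\mathbf k$ is positive; $\mathbf k\cdot x=k_1x_1+\dots+k_nx_n$. A system $\{1\}\cup\{u_{\mathbf k},v_{\mathbf k}:\mathbf k\in\mathbb Z^n,\ \mathbf k\succ0\}$ is a Schauder basis of $L_q((0,1)^n)$ in the Pringsheim sense if for every $f\in L_q((0,1)^n)$ there are unique real scalars $\alpha_0$ and $\alpha_{\mathbf k},\beta_{\mathbf k}$ ($\mathbf k\succ0$) such that the rectangular partial sums $\alpha_0+\sum_{\mathbf k\succ0,\ |k_1|\le m_1,\dots,|k_n|\le m_n}(\alpha_{\mathbf k}u_{\mathbf k}+\beta_{\mathbf k}v_{\mathbf k})$ converge to $f$ in $L_q((0,1)^n)$ as $\min\{m_1,\dots,m_n\}\to\infty$, $\mathbf m\in\mathbb N^n$. *)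

(* Defs.v *)
From HB Require Import structures.
From mathcomp Require Import all_boot all_order all_algebra.
From mathcomp Require Import all_classical all_reals all_analysis.
From mathcomp Require Import zify.
Set Implicit Arguments.
Unset Strict Implicit.
Unset Printing Implicit Defensive.
Import Order.TTheory GRing.Theory Num.Theory.
Import numFieldNormedType.Exports.
Local Open Scope classical_set_scope.
Local Open Scope ring_scope.

(* R^n, with the sigma-algebra generated by the coordinates, that is, the
   Borel sigma-algebra. *)
Notation Rn R n := (n.-tuple (measurableTypeR R)).

Section lebesgue_cons.
Context (R : realType) (n : nat).
Variable mu : {sigma_finite_measure set (Rn R n) -> \bar R}.
Local Open Scope ereal_scope.

Definition cons_pair (p : measurableTypeR R * Rn R n) : Rn R n.+1 :=
  [tuple of p.1 :: p.2].

Lemma measurable_cons_pair : measurable_fun [set: _] cons_pair.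
Proof. exact: measurable_cons measurable_fst measurable_snd. Qed.

Definition uncons_pair (x : Rn R n.+1) : measurableTypeR R * Rn R n :=
  (thead x, [tuple of behead x]).

Lemma measurable_uncons_pair : measurable_fun [set: _] uncons_pair.
Proof.
by apply/measurable_fun_pair; [exact: measurable_tnth|exact: measurable_behead].
Qed.

Lemma cons_pairK : cancel cons_pair uncons_pair.
Proof. by case=> a b; congr pair; exact/val_inj. Qed.

Lemma uncons_pairK : cancel uncons_pair cons_pair.
Proof. by move=> x; rewrite [RHS]tuple_eta. Qed.

Definition lebesgue_cons : set (Rn R n.+1) -> \bar R :=
  pushforward (@lebesgue_measure R \x mu) cons_pair.

Let lebesgue_cons0 : lebesgue_cons set0 = 0.
Proof. by rewrite /lebesgue_cons /pushforward preimage_set0 measure0. Qed.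

Let lebesgue_cons_ge0 A : 0 <= lebesgue_cons A.
Proof. by rewrite /lebesgue_cons /pushforward measure_ge0. Qed.

Let lebesgue_cons_sigma_additive : semi_sigma_additive lebesgue_cons.
Proof.
move=> F mF tF mUF; rewrite /lebesgue_cons /pushforward preimage_bigcup.
apply: measure_semi_sigma_additive.
- by move=> k; rewrite -[X in measurable X]setTI; exact: measurable_cons_pair.
- apply/trivIsetP => /= i j _ _ ij; rewrite -preimage_setI.
  by move/trivIsetP : tF => /(_ _ _ _ _ ij) ->//; rewrite preimage_set0.
- rewrite -preimage_bigcup -[X in measurable X]setTI.
  exact: measurable_cons_pair.
Qed.

HB.instance Definition _ := isMeasure.Build _ _ _ lebesgue_cons
  lebesgue_cons0 lebesgue_cons_ge0 lebesgue_cons_sigma_additive.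

Let lebesgue_cons_sigma_finite : sigma_finite setT lebesgue_cons.
Proof.
have /sigma_finiteP[F [TF ndF Foo]] := sigma_finiteT (@lebesgue_measure R).
have /sigma_finiteP[G [TG ndG Goo]] := sigma_finiteT mu.
exists (fun k => uncons_pair @^-1` (F k `*` G k)).
  rewrite -preimage_bigcup (_ : \bigcup_k (F k `*` G k) = setT) ?preimage_setT//.
  rewrite -subTset => -[x y] _.
  have : setT x by [].
  rewrite TF => -[i _ Fx].
  have : setT y by [].
  rewrite TG => -[j _ Gy].
  exists (maxn i j) => //; split.
    by move: x Fx; exact/subsetPset/ndF/leq_maxl.
  by move: y Gy; exact/subsetPset/ndG/leq_maxr.
move=> k; have [mF Fk] := Foo k; have [mG Gk] := Goo k; split.
  rewrite -[X in measurable X]setTI; apply: measurable_uncons_pair => //.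
  exact: measurableX.
rewrite /lebesgue_cons /pushforward -comp_preimage.
rewrite (_ : _ @^-1` _ = F k `*` G k).
  by rewrite product_measure1E// lte_mul_pinfty// ge0_fin_numE.
by apply/seteqP; split => p; rewrite /preimage /mkset /comp cons_pairK.
Qed.

HB.instance Definition _ := Measure_isSigmaFinite.Build _ _ _ lebesgue_cons
  lebesgue_cons_sigma_finite.

End lebesgue_cons.

(* Lebesgue measure on (the Borel sets of) R^n: the n-fold product of the
   one-dimensional Lebesgue measure, see lebesgue_tuple_box. *)
Fixpoint lebesgue_tuple (R : realType) (n : nat) :
    {sigma_finite_measure set (Rn R n) -> \bar R} :=
  match n with
  | 0 => \d_[tuple]
  | m.+1 => lebesgue_cons (lebesgue_tuple R m)
  end.

Lemma lebesgue_tuple_box (R : realType) (n : nat)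
    (A : 'I_n -> set (measurableTypeR R)) : (forall i, measurable (A i)) ->
  lebesgue_tuple R n [set x | forall i, A i (tnth x i)] =
  (\prod_(i < n) lebesgue_measure (A i))%E.
Proof.
elim: n A => [A _|n ih A mA].
  rewrite big_ord0 /= diracE (_ : _ \in _ = true)//.
  by apply/mem_set => /= -[].
rewrite big_ord_recl /= -ih//.
rewrite /lebesgue_cons /pushforward -product_measure1E//; last first.
  rewrite (_ : [set x | _] = \bigcap_(i in [set: 'I_n])
      ((@tnth _ (measurableTypeR R))^~ i @^-1` A (lift ord0 i))).
    apply: fin_bigcap_measurable => // i _.
    by rewrite -[X in measurable X]setTI; exact: measurable_tnth.
  by apply/seteqP; split => x /= + i => /(_ i)//; exact.
congr product_measure1; apply/seteqP; split => -[a b] /=.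
  move=> H; split; first exact: (H ord0).
  by move=> i; have := H (lift ord0 i); rewrite tnthS.
move=> [Aa Ab] i; case: (unliftP ord0 i) => [j ->|->//].
by rewrite tnthS.
Qed.

Definition unit_cube (R : realType) (n : nat) : set (Rn R n) :=
  [set x | forall i, 0 < (tnth x i : R) < 1].

Lemma measurable_unit_cube (R : realType) (n : nat) :
  measurable (@unit_cube R n).
Proof.
rewrite (_ : @unit_cube R n = \bigcap_(i in [set: 'I_n])
    ((@tnth _ (measurableTypeR R))^~ i @^-1` `]0, 1[%classic)).
  apply: fin_bigcap_measurable => // i _.
  by rewrite -[X in measurable X]setTI; exact: measurable_tnth.
apply/seteqP; split => x /= H i; first by move=> _; rewrite /= in_itv/=.
by have := H i Logic.I; rewrite /= in_itv.
Qed.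

(* Lebesgue measure on (0,1)^n, as a measure on R^n carried by the cube.  Every
   class of Lebesgue-measurable functions on the cube has a Borel representative
   defined on R^n, so this measure gives the usual space L_q((0,1)^n). *)
Definition cube_measure (R : realType) (n : nat) :
    {measure set (Rn R n) -> \bar R} :=
  mrestr (lebesgue_tuple R n) (@measurable_unit_cube R n).

Section frequencies.
Variable n : nat.

Definition lex_positive (k : n.-tuple int) : bool :=
  [exists i, (0 < tnth k i) && [forall j : 'I_n, (j < i)%N ==> (tnth k j == 0)]].

Definition pos_freq : Type := {k : n.-tuple int | lex_positive k}.

Definition freq_rect (m : n.-tuple nat) : set pos_freq :=
  [set k | forall i, (`|tnth (val k) i| <= tnth m i)%N].

(* Hence the sums \sum_(k \in freq_rect m) _ below are genuine finite sums. *)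
Lemma finite_freq_rect (m : n.-tuple nat) : finite_set (freq_rect m).
Proof.
pose B : set (n.-tuple int) :=
  [set k | forall i, (`|tnth k i| <= tnth m i)%N].
suff finB : finite_set B.
  apply: (@finite_preimage _ _ B (fun k : pos_freq => val k)) finB.
  by move=> x y _ _; exact: val_inj.
pose M := \max_(i < n) tnth m i.
pose g (t : n.-tuple 'I_(M + M).+1) : n.-tuple int :=
  [tuple (tnth t i)%:Z - M%:Z | i < n].
apply: (@sub_finite_set _ _ (g @` setT)); last first.
  exact/finite_image/finite_finset.
move=> k /= Bk; exists [tuple inord `|(tnth k i + M%:Z)%R|%N | i < n] => //.
apply: eq_from_tnth => i; rewrite !tnth_mktuple.
have kM : (`|tnth k i| <= M)%N.
  by rewrite (leq_trans (Bk i))// /M (leq_bigmax i).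
rewrite inordK; last by lia.
by lia.
Qed.

(* min(m_1, ..., m_n) tends to infinity *)
Definition pringsheim : set_system (n.-tuple nat) :=
  filter_from [set: nat] (fun N => [set m | forall i, (N <= tnth m i)%N]).

Global Instance pringsheim_filter : ProperFilter pringsheim.
Proof.
apply: filter_from_proper => [|N _].
  apply: filter_from_filter => [|i j _ _]; first by exists 0%N.
  exists (maxn i j) => // m /= H.
  by split => k; rewrite (leq_trans _ (H k))// ?leq_maxl ?leq_maxr.
by exists [tuple N | _ < n] => i; rewrite tnth_mktuple.
Qed.

End frequencies.

Section pringsheim_basis.
Context d (T : measurableType d) (R : realType) (n : nat).
Variables (mu : {measure set T -> \bar R}) (q : \bar R).
Variables u v : pos_freq n -> T -> R.

Definition rect_sum (a0 : R) (a b : pos_freq n -> R) (m : n.-tuple nat)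
    (x : T) : R :=
  a0 + \sum_(k \in freq_rect m) (a k * u k x + b k * v k x).

Definition pringsheim_expansion (f : T -> R) (a0 : R) (a b : pos_freq n -> R) :=
  'N[mu]_q [EFin \o (f \- rect_sum a0 a b m)%R]%E @[m --> @pringsheim n] --> 0%E.

(* The elements of L_q are handled through representatives: Lfun mu q is the
   set of measurable functions of finite L_q-norm, and the expansion property
   only depends on the class of f modulo mu-a.e. equality. *)
Definition pringsheim_basis :=
  [/\ cst 1 \in Lfun mu q,
      forall k, u k \in Lfun mu q,
      forall k, v k \in Lfun mu q &
      forall f : T -> R, f \in Lfun mu q ->
        exists! c : R * (pos_freq n -> R) * (pos_freq n -> R),
          pringsheim_expansion f c.1.1 c.1.2 c.2].

End pringsheim_basis.

Section trigonometric_system.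
Context (R : realType) (n : nat).

Definition dot (k : n.-tuple int) (x : Rn R n) : R :=
  \sum_(i < n) (tnth k i)%:~R * (tnth x i : R).

Definition trig_cos (k : pos_freq n) (x : Rn R n) : R :=
  Num.sqrt 2 * cos (2 * pi * dot (val k) x).

Definition trig_sin (k : pos_freq n) (x : Rn R n) : R :=
  Num.sqrt 2 * sin (2 * pi * dot (val k) x).

End trigonometric_system.

(* Main.v *)
Require Import Defs.
From HB Require Import structures.
From mathcomp Require Import all_boot all_order all_algebra.
From mathcomp Require Import all_classical all_reals all_analysis.
From mathcomp Require Import measurable_realfun.
From mathcomp Require Import complex.
From mathcomp Require Import ring lra zify.

(* The rectangular partial sum of f with coefficients given by the integrals of f
   against the system is the convolution of f with the product of the Dirichlet
   kernels D_(m_1)(t_1) ... D_(m_n)(t_n), since the sum of cos (2 pi k.t) over the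
   box |k_i| <= m_i factorizes.  By Fubini, its convergence to f in L_q reduces to
   dimension one, where it follows from the density of trigonometric polynomials
   (Fejer) and from a bound on L_q(0,1) uniform in m.  For q = 2k with k odd this
   bound is M. Riesz' inequality (Im z)^(2k) <= - 2 Re (z^(2k)) + C (Re z)^(2k)
   integrated along a polynomial z = p(e^(2 pi i x)); Marcinkiewicz interpolation
   between 2 and 2k gives q > 2, and duality gives q < 2.  Uniqueness of the
   coefficients is orthogonality, as convergence in L_q implies convergence of the
   integrals against bounded functions. *)

Set Implicit Arguments.
Unset Strict Implicit.
Unset Printing Implicit Defensive.
Import Order.TTheory GRing.Theory Num.Theory.
Import numFieldNormedType.Exports.
Local Open Scope classical_set_scope.
Local Open Scope ring_scope.

(** Real trigonometric polynomials are handled as real parts of algebraic polynomials p(z) on the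
    circle |z| = 1, where frequency is degree: the Dirichlet operator becomes truncation of p, and
    the conjugate function is Im p. The truncation bound applies the conjugate bound to two
    polynomials whose real parts are Re p times a cosine and Re p times a sine. Odd k gives
    (iv)^(2k) = - v^(2k), the sign behind Riesz' inequality; k = 1 supplies the lower end 2 of the
    interpolation, and 2k can exceed any q. Bounds are stated for the integral of |f|^q, which
    Tonelli splits over the coordinates, so constants multiply with the dimension and stay
    independent of m. Every kernel is bounded, by a number depending on m: this gives finiteness a
    priori (for Fubini, for a finite layer-cake sum, for the absorption in the duality step) without
    entering the constants. The m_i grow independently; sequences of rectangles suffice because the
    Pringsheim filter has a countable base, and f - K_1 K_2 f = (f - K_1 f) + K_1 (f - K_2 f) adds
    one dimension at a time. *)

Section measure_generic.
Context d (T : measurableType d) (R : realType).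
Implicit Types (f g : T -> R) (q C M : R).

Lemma measurable_normr_powR (f : T -> R) q : measurable_fun setT f ->
  measurable_fun setT (fun x => `|f x| `^ q).
Proof.
move=> mf; apply: (@measurableT_comp _ _ _ _ _ _ (fun x : R => x `^ q)) => //.
exact: measurableT_comp.
Qed.

Lemma measurable_EFin_normr_powR (f : T -> R) q : measurable_fun setT f ->
  measurable_fun setT (fun x => (`|f x| `^ q)%:E).
Proof. by move=> mf; apply/measurable_EFinP; exact: measurable_normr_powR. Qed.

Lemma powRD_le (q a b : R) : 0 <= q -> 0 <= a -> 0 <= b ->
  (a + b) `^ q <= 2 `^ q * (a `^ q + b `^ q).
Proof.
move=> q0 a0 b0.
wlog ab : a b a0 b0 / a <= b.
  move=> H; have [/H|/ltW/H] := leP a b; first exact.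
  by rewrite addrC [in X in _ -> X](addrC (a `^ q)); exact.
rewrite mulrDr (@le_trans _ _ (2 `^ q * b `^ q))//; last first.
  by rewrite lerDr mulr_ge0// powR_ge0.
rewrite -powRM//; apply: ge0_ler_powR; rewrite ?nnegrE ?addr_ge0 ?mulr_ge0//.
by rewrite mulr2n mulrDl !mul1r lerD2r.
Qed.

Variable mu : {measure set T -> \bar R}.

(** The q-th power of the L_q norm. Being an integral, it lets Tonelli act coordinate by coordinate;
    the value may be infinite. *)
Definition energy q f : \bar R := (\int[mu]_x (`|f x| `^ q)%:E)%E.

Lemma energy_ge0 q f : (0 <= energy q f)%E.
Proof. by apply: integral_ge0 => x _; rewrite lee_fin powR_ge0. Qed.

Lemma le_energy q f g : measurable_fun setT f -> measurable_fun setT g ->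
  0 <= q -> (forall x, `|f x| <= `|g x|) -> (energy q f <= energy q g)%E.
Proof.
move=> mf mg q0 fg; apply: ge0_le_integral => //.
- exact: measurable_EFin_normr_powR.
- exact: measurable_EFin_normr_powR.
- by move=> x _; rewrite lee_fin ge0_ler_powR// nnegrE.
Qed.

Lemma energyD q f g : 0 <= q -> measurable_fun setT f -> measurable_fun setT g ->
  (energy q (f \+ g)%R <= (2 `^ q)%:E * (energy q f + energy q g))%E.
Proof.
move=> q0 mf mg; rewrite /energy -ge0_integralD//; last 2 first.
- exact: measurable_EFin_normr_powR.
- exact: measurable_EFin_normr_powR.
rewrite -ge0_integralZl//; last 2 first.
- by apply: emeasurable_funD; exact: measurable_EFin_normr_powR.
- by move=> x _; rewrite -EFinD lee_fin addr_ge0// powR_ge0.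
apply: ge0_le_integral => //.
- by apply: measurable_EFin_normr_powR; exact: measurable_funD.
- apply: emeasurable_funM => //.
  by apply: emeasurable_funD; exact: measurable_EFin_normr_powR.
- move=> x _; rewrite -EFinD -EFinM lee_fin.
  apply: le_trans (powRD_le _ _ _) => //.
  by apply: ge0_ler_powR => //; rewrite ?nnegrE ?addr_ge0// ler_normD.
Qed.

Lemma energy_le_add3 q f g h k : 0 <= q -> measurable_fun setT f ->
  measurable_fun setT g -> measurable_fun setT h -> measurable_fun setT k ->
  (forall x, `|f x| <= `|g x + h x + k x|) ->
  (energy q f <=
   (2 `^ q)%:E * ((2 `^ q)%:E * (energy q g + energy q h) + energy q k))%E.
Proof.
move=> q0 mf mg mh mk fghk; have mgh : measurable_fun setT (g \+ h)%R by exact: measurable_funD.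
apply: (@le_trans _ _ (energy q ((g \+ h) \+ k)%R)).
  by apply: le_energy => //; exact: measurable_funD.
apply: (le_trans (energyD q0 mgh mk)); apply: lee_wpmul2l; first by rewrite lee_fin powR_ge0.
by apply: leeD2r; exact: energyD.
Qed.

Lemma energyN q f : energy q (\- f)%R = energy q f.
Proof. by apply: eq_integral => x _; rewrite normrN. Qed.

Lemma energyB q f g : 0 <= q -> measurable_fun setT f -> measurable_fun setT g ->
  (energy q (f \- g)%R <= (2 `^ q)%:E * (energy q f + energy q g))%E.
Proof.
move=> q0 mf mg; rewrite -(energyN q g); apply: energyD => //.
exact: measurableT_comp.
Qed.

Lemma energyE q f : q != 0 -> energy q f = ('N[mu]_q%:E[EFin \o f] `^ q)%E.
Proof. by move=> q0; rewrite poweR_Lnorm//; apply: eq_integral => x _ /=. Qed.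

Lemma LnormE_energy q f : q != 0 -> ('N[mu]_q%:E[EFin \o f] = energy q f `^ q^-1)%E.
Proof.
by move=> q0; rewrite energyE// -poweRrM divff// poweRe1// Lnorm_ge0.
Qed.

Lemma integrable_bounded (g f : T -> R) M : measurable_fun setT g ->
  (forall x, `|g x| <= M) -> mu.-integrable setT (EFin \o f) ->
  mu.-integrable setT (fun x => (g x * f x)%:E).
Proof.
move=> mg gM intf.
have mf : measurable_fun setT f by apply/measurable_EFinP; case/integrableP : intf.
apply: (@le_integrable _ _ _ _ _ _ _ (fun x => (M * f x)%:E)) => //.
- by apply/measurable_EFinP; exact: measurable_funM.
- move=> x _; rewrite lee_fin !normrM ler_wpM2r//.
  by rewrite (le_trans (gM x))// ler_norm.
- have -> : (fun x => (M * f x)%:E) = (fun x => M%:E * (EFin \o f) x)%E by [].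
  exact: integrableZl.
Qed.

End measure_generic.

(** * Energies over a probability measure *)

Section probability_generic.
Context d (T : measurableType d) (R : realType).
Variable P : probability T R.
Implicit Types (f g : T -> R) (q C M : R).

Lemma integrable_bounded_cst f M : measurable_fun setT f ->
  (forall x, `|f x| <= M) -> P.-integrable setT (EFin \o f).
Proof.
move=> mf fM; have := @integrable_bounded _ _ _ P f (cst 1) M mf fM.
rewrite (_ : (fun x => _) = EFin \o f); last first.
  by apply/funext => x /=; rewrite mulr1.
apply; exact: finite_measure_integrable_cst.
Qed.

(** Hölder against the constant 1, whose norm is 1 because [P] has mass one. *)
Lemma LnormS1 q f : 1 <= q -> measurable_fun setT f ->
  ('N[P]_1[EFin \o f] <= 'N[P]_q%:E[EFin \o f])%E.
Proof.
rewrite le_eqVlt => /predU1P[<-//|q1] mf.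
have q0 : 0 < q by rewrite (lt_trans _ q1).
have := @hoelder _ _ _ P f (cst 1) q (1 - q^-1)^-1 mf (measurable_cst _) q0.
rewrite invrK subrKC => /(_ _ erefl); rewrite invr_gt0 subr_gt0 invf_lt1// => /(_ q1).
rewrite (_ : (f \* cst 1)%R = f); last by apply/funext => x /=; rewrite mulr1.
rewrite (_ : EFin \o cst 1 = cst 1%E)// Lnorm_cst1.
move=> H; apply: (le_trans H).
by rewrite [X in (X `^ _)%E](_ : _ = 1%E) ?poweR1r ?mule1//; exact: probability_setT.
Qed.

Lemma energy_le1 q f : 1 <= q -> measurable_fun setT f ->
  ((\int[P]_x `|(f x)%:E|) `^ q <= energy P q f)%E.
Proof.
move=> q1 mf; have q0 : 0 < q by exact: lt_le_trans q1.
rewrite energyE ?gt_eqF//; apply: gt0_ler_poweR; rewrite ?in_itv/= ?leey ?andbT//.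
- exact: ltW.
- exact: integral_ge0.
- exact: Lnorm_ge0.
- by rewrite -(Lnorm1 P (EFin \o f)); exact: LnormS1.
Qed.

Lemma energy_integrable q f : 1 <= q -> measurable_fun setT f ->
  (energy P q f < +oo)%E -> P.-integrable setT (EFin \o f).
Proof.
move=> q1 mf foo; have q0 : 0 < q by exact: lt_le_trans q1.
apply/integrableP; split; first exact/measurable_EFinP.
rewrite ltey; apply/eqP => E; move: (energy_le1 q1 mf); rewrite E poweRyr ?gt_eqF//.
by rewrite leye_eq => /eqP h; rewrite h in foo.
Qed.

Lemma jensen_energy q f : 1 <= q -> measurable_fun setT f ->
  ((`|\int[P]_x f x| `^ q)%:E <= energy P q f)%E.
Proof.
move=> q1 mf; have q0 : 0 < q by exact: lt_le_trans q1.
have [foo|] := ltP (energy P q f) +oo%E; last by rewrite leye_eq => /eqP ->; rewrite leey.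
have intf := energy_integrable q1 mf foo.
apply: le_trans (energy_le1 q1 mf); rewrite -poweR_EFin.
apply: gt0_ler_poweR; rewrite ?in_itv/= ?leey ?andbT ?lee_fin//.
- exact: ltW.
- exact: integral_ge0.
- rewrite EFin_normr_Rintegral//; apply: le_abse_integral => //; exact/measurable_EFinP.
Qed.

Lemma energy_cst q (c : R) : energy P q (fun=> c) = (`|c| `^ q)%:E.
Proof.
rewrite /energy integral_cst// (_ : _ setT = 1%E) ?mule1//.
exact: probability_setT.
Qed.

End probability_generic.

Section Rintegral_parameter.
Context d1 d2 (T1 : measurableType d1) (T2 : measurableType d2) (R : realType).
Variable P2 : {sigma_finite_measure set T2 -> \bar R}.

(** Positive and negative parts are integrated separately, each measurably by Tonelli, so sections
    of [h] without a finite integral are allowed. *)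
Lemma measurable_Rintegral_snd (h : T1 * T2 -> R) : measurable_fun setT h ->
  measurable_fun setT (fun x => \int[P2]_y h (x, y)).
Proof.
move=> mh; have mh' : measurable_fun setT (EFin \o h) by exact/measurable_EFinP.
rewrite /Rintegral.
apply: (@measurableT_comp _ _ _ _ _ _ (@fine R)) => //.
under eq_fun do (rewrite integralE; under eq_integral do rewrite funeposE;
  under [X in (_ - X)%E]eq_integral do rewrite funenegE).
apply: emeasurable_funB.
  apply: (@measurable_fun_fubini_tonelli_F _ _ _ _ _ P2
    (fun z => maxe (h z)%:E 0)) => //.
    exact: measurable_maxe.
  by move=> z; rewrite le_max lexx orbT.
apply: (@measurable_fun_fubini_tonelli_F _ _ _ _ _ P2
  (fun z => maxe (- (h z)%:E)%E 0)) => //.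
  by apply: measurable_maxe => //; exact: measurableT_comp.
by move=> z; rewrite le_max lexx orbT.
Qed.

End Rintegral_parameter.

(** * Kernel operators and their tensor products *)

Section kernel_operator.
Context d (T : measurableType d) (R : realType).
Variable P : probability T R.
Implicit Types (K : T -> T -> R) (f g : T -> R) (q C : R).

Definition kernel_op K f (x : T) : R := \int[P]_y (K x y * f y).

(** Boundedness makes [kernel_op K f] meaningful at every point for every integrable [f]. The bound
    itself depends on the kernel and stays out of the final constants. *)
Definition bounded_kernel K := measurable_fun setT (fun z : T * T => K z.1 z.2) /\
  exists M, forall x y, `|K x y| <= M.

(** [C] bounds q-th powers of norms, so it is the q-th power of an operator norm bound; constants of
    composed operators multiply. *)
Definition op_bounded q C K := forall f, measurable_fun setT f ->
  (energy P q (kernel_op K f) <= C%:E * energy P q f)%E.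

Definition op_cvg q (K : nat -> T -> T -> R) := forall f, measurable_fun setT f ->
  (energy P q f < +oo)%E ->
  energy P q (f \- kernel_op (K j) f)%R @[j --> \oo] --> 0%E.

Lemma measurable_kernel_op K f : bounded_kernel K -> measurable_fun setT f ->
  measurable_fun setT (kernel_op K f).
Proof.
move=> [mK _] mf.
have mh : measurable_fun setT (fun z : T * T => K z.1 z.2 * f z.2).
  by apply: measurable_funM => //; exact: measurableT_comp.
exact: (measurable_Rintegral_snd P mh).
Qed.

Lemma measurable_kernel_section K x : bounded_kernel K ->
  measurable_fun setT (K x).
Proof. by move=> [mK _]; exact: (@measurable_fun_pair2 _ _ _ _ _ _ (fun z => K z.1 z.2) x). Qed.

Lemma integrable_kernel_mul K f x : bounded_kernel K ->
  P.-integrable setT (EFin \o f) ->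
  P.-integrable setT (fun y => (K x y * f y)%:E).
Proof.
move=> bK intf; have [_ [M KM]] := bK.
exact: (integrable_bounded (measurable_kernel_section x bK) (KM x)).
Qed.

Lemma kernel_opB K f g x : bounded_kernel K ->
  P.-integrable setT (EFin \o f) -> P.-integrable setT (EFin \o g) ->
  kernel_op K (f \- g) x = kernel_op K f x - kernel_op K g x.
Proof.
move=> bK intf intg; rewrite /kernel_op -RintegralB//; last 2 first.
  exact: integrable_kernel_mul.
  exact: integrable_kernel_mul.
by apply: eq_Rintegral => y _; rewrite mulrBr.
Qed.

End kernel_operator.
Arguments op_bounded {d T R} P q C K.
Arguments op_cvg {d T R} P q K.

Section tensor.
Context d1 d2 (T1 : measurableType d1) (T2 : measurableType d2) (R : realType).
Variables (P1 : probability T1 R) (P2 : probability T2 R).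
Local Notation P := (P1 \x P2)%E.
Implicit Types (f : T1 * T2 -> R).
Variable q : R.
Hypothesis q1 : 1 <= q.
Let q0 : 0 <= q. Proof. exact: le_trans q1. Qed.

Definition tensor_kernel (K1 : T1 -> T1 -> R) (K2 : T2 -> T2 -> R)
    (x y : T1 * T2) : R :=
  K1 x.1 y.1 * K2 x.2 y.2.

Definition op_fst K1 f (z : T1 * T2) : R :=
  kernel_op P1 K1 (fun x => f (x, z.2)) z.1.

Definition op_snd K2 f (z : T1 * T2) : R :=
  kernel_op P2 K2 (fun y => f (z.1, y)) z.2.

Lemma measurable_op_fst K1 f : bounded_kernel K1 -> measurable_fun setT f ->
  measurable_fun setT (op_fst K1 f).
Proof.
move=> [mK _] mf.
have mh : measurable_fun setT
    (fun w : (T1 * T2) * T1 => K1 w.1.1 w.2 * f (w.2, w.1.2)).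
  apply: measurable_funM.
    apply: (@measurableT_comp _ _ _ _ _ _ (fun z : T1 * T1 => K1 z.1 z.2) _
      (fun w => (w.1.1, w.2))) => //.
    by apply: measurable_fun_pair => //; exact: measurableT_comp.
  apply: (@measurableT_comp _ _ _ _ _ _ f) => //.
  by apply: measurable_fun_pair => //; exact: measurableT_comp.
exact: (measurable_Rintegral_snd P1 mh).
Qed.

Lemma measurable_op_snd K2 f : bounded_kernel K2 -> measurable_fun setT f ->
  measurable_fun setT (op_snd K2 f).
Proof.
move=> [mK _] mf.
have mh : measurable_fun setT
    (fun w : (T1 * T2) * T2 => K2 w.1.2 w.2 * f (w.1.1, w.2)).
  apply: measurable_funM.
    apply: (@measurableT_comp _ _ _ _ _ _ (fun z : T2 * T2 => K2 z.1 z.2) _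
      (fun w => (w.1.2, w.2))) => //.
    by apply: measurable_fun_pair => //; exact: measurableT_comp.
  apply: (@measurableT_comp _ _ _ _ _ _ f) => //.
  by apply: measurable_fun_pair => //; exact: measurableT_comp.
exact: (measurable_Rintegral_snd P2 mh).
Qed.

Lemma energy_prod1 (f : T1 * T2 -> R) : measurable_fun setT f ->
  energy P q f = (\int[P1]_x energy P2 q (fun y => f (x, y)))%E.
Proof.
move=> mf; rewrite /energy (@fubini_tonelli1 _ _ _ _ _ P1 P2 (fun z => (`|f z| `^ q)%:E))//.
exact: measurable_EFin_normr_powR.
Qed.

Lemma energy_prod2 (f : T1 * T2 -> R) : measurable_fun setT f ->
  energy P q f = (\int[P2]_y energy P1 q (fun x => f (x, y)))%E.
Proof.
move=> mf; rewrite /energy (@fubini_tonelli2 _ _ _ _ _ P1 P2 (fun z => (`|f z| `^ q)%:E))//.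
exact: measurable_EFin_normr_powR.
Qed.

Lemma measurable_energy_snd (f : T1 * T2 -> R) : measurable_fun setT f ->
  measurable_fun setT (fun x => energy P2 q (fun y => f (x, y))).
Proof.
move=> mf.
apply: (@measurable_fun_fubini_tonelli_F _ _ _ _ _ P2 (fun z => (`|f z| `^ q)%:E)) => //.
exact: measurable_EFin_normr_powR.
Qed.

Lemma measurable_energy_fst (f : T1 * T2 -> R) : measurable_fun setT f ->
  measurable_fun setT (fun y => energy P1 q (fun x => f (x, y))).
Proof.
move=> mf.
apply: (@measurable_fun_fubini_tonelli_G _ _ _ _ _ P1 (fun z => (`|f z| `^ q)%:E)) => //.
exact: measurable_EFin_normr_powR.
Qed.

(** The one-variable bound holds on every section with the second variable frozen; Tonelli
    integrates it over that variable. *)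
Lemma op_fst_bounded K1 C f : bounded_kernel K1 -> 0 <= C ->
  op_bounded P1 q C K1 ->
  measurable_fun setT f -> (energy P q (op_fst K1 f) <= C%:E * energy P q f)%E.
Proof.
move=> bK C0 bC mf; have mop := measurable_op_fst bK mf.
rewrite !energy_prod2// -ge0_integralZl//; last 2 first.
- exact: measurable_energy_fst.
- by move=> y _; exact: energy_ge0.
apply: ge0_le_integral => //.
- by move=> y _; exact: energy_ge0.
- exact: measurable_energy_fst.
- by apply: emeasurable_funM => //; exact: measurable_energy_fst.
- by move=> y _; exact: (bC (fun x => f (x, y)) (measurable_fun_pair1 y mf)).
Qed.

Lemma op_snd_bounded K2 C f : bounded_kernel K2 -> 0 <= C ->
  op_bounded P2 q C K2 ->
  measurable_fun setT f -> (energy P q (op_snd K2 f) <= C%:E * energy P q f)%E.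
Proof.
move=> bK C0 bC mf; have mop := measurable_op_snd bK mf.
rewrite !energy_prod1// -ge0_integralZl//; last 2 first.
- exact: measurable_energy_snd.
- by move=> y _; exact: energy_ge0.
apply: ge0_le_integral => //.
- by move=> y _; exact: energy_ge0.
- exact: measurable_energy_snd.
- by apply: emeasurable_funM => //; exact: measurable_energy_snd.
- by move=> x _; exact: (bC (fun y => f (x, y)) (measurable_fun_pair2 x mf)).
Qed.

Lemma bounded_tensor_kernel K1 K2 : bounded_kernel K1 -> bounded_kernel K2 ->
  bounded_kernel (tensor_kernel K1 K2).
Proof.
move=> [m1 [M1 b1]] [m2 [M2 b2]]; split.
  apply: measurable_funM.
    apply: (@measurableT_comp _ _ _ _ _ _ (fun z : T1 * T1 => K1 z.1 z.2) _
      (fun w => (w.1.1, w.2.1))) => //.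
    apply: measurable_fun_pair => //; exact: measurableT_comp.
  apply: (@measurableT_comp _ _ _ _ _ _ (fun z : T2 * T2 => K2 z.1 z.2) _
    (fun w => (w.1.2, w.2.2))) => //.
  apply: measurable_fun_pair => //; exact: measurableT_comp.
by exists (M1 * M2) => x y; rewrite normrM ler_pM.
Qed.

Lemma tensor_opE K1 K2 f : bounded_kernel K1 -> bounded_kernel K2 ->
  P.-integrable setT (EFin \o f) ->
  kernel_op P (tensor_kernel K1 K2) f = op_fst K1 (op_snd K2 f).
Proof.
move=> b1 b2 intf; apply/funext => -[x1 x2].
have mf : measurable_fun setT f by apply/measurable_EFinP; case/integrableP : intf.
have intKf := integrable_kernel_mul (x1, x2) (bounded_tensor_kernel b1 b2) intf.
rewrite /kernel_op /op_fst /Rintegral -(integral12_prod_meas1 intKf); congr fine.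
apply: ae_eq_integral => //.
- by apply: (measurable_fubini_F intKf).
- apply/measurable_EFinP; apply: measurable_funM.
    exact: measurable_kernel_section.
  apply: (@measurableT_comp _ _ _ _ _ _ (op_snd K2 f)) => //.
  exact: measurable_op_snd.
(* Only almost every section of [f] is integrable, so the factor [K1 x1 y1] leaves the inner
   integral only for almost every y1. *)
have := ae_integrable1 intf; apply: filterS => y1 inty1 _.
rewrite /fubini_F /op_snd /kernel_op /tensor_kernel /=.
under eq_integral do rewrite -mulrA EFinM.
rewrite integralZl//; last exact: integrable_kernel_mul.
rewrite EFinM /Rintegral fineK//.
apply: integrable_fin_num => //; exact: integrable_kernel_mul.
Qed.

Lemma tensor_op_bounded K1 K2 C1 C2 : bounded_kernel K1 -> bounded_kernel K2 ->
  0 < C1 -> 0 < C2 -> op_bounded P1 q C1 K1 -> op_bounded P2 q C2 K2 ->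
  op_bounded P q (C1 * C2) (tensor_kernel K1 K2).
Proof.
move=> b1 b2 C10 C20 B1 B2 f mf.
have [foo|] := ltP (energy P q f) +oo%E; last first.
  by rewrite leye_eq => /eqP ->; rewrite gt0_muley ?leey// lte_fin mulr_gt0.
rewrite tensor_opE//; last exact: energy_integrable q1 mf foo.
apply: le_trans (op_fst_bounded b1 (ltW C10) B1 _) _.
  exact: measurable_op_snd.
rewrite EFinM -muleA lee_pmul2l//.
exact: op_snd_bounded (ltW C20) B2 mf.
Qed.

Lemma op_fst_cvg (K1 : nat -> T1 -> T1 -> R) C f :
  (forall j, bounded_kernel (K1 j)) ->
  0 < C -> (forall j, op_bounded P1 q C (K1 j)) -> op_cvg P1 q K1 ->
  measurable_fun setT f -> (energy P q f < +oo)%E ->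
  energy P q (f \- op_fst (K1 j) f)%R @[j --> \oo] --> 0%E.
Proof.
move=> bK C0 bC cK mf foo.
have mfop j : measurable_fun setT (f \- op_fst (K1 j) f).
  by apply: measurable_funB => //; exact: measurable_op_fst.
rewrite (_ : (fun j => _) = fun j =>
    (\int[P2]_y energy P1 q (fun x => (f \- op_fst (K1 j) f)%R (x, y)))%E); last first.
  by apply/funext => j; rewrite energy_prod2.
rewrite (_ : 0%E = (\int[P2]_y (cst 0 y))%E); last by rewrite integral0.
pose h y := ((2 `^ q * (1 + C))%:E * energy P1 q (fun x => f (x, y)))%E.
have inth : P2.-integrable setT (fun y => energy P1 q (fun x => f (x, y))).
  apply/integrableP; split; first exact: measurable_energy_fst.
  under eq_integral do rewrite gee0_abs ?energy_ge0//.
  by rewrite -energy_prod2.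
have [] // := @dominated_convergence _ _ _ P2 setT measurableT
  (fun j y => energy P1 q (fun x => (f \- op_fst (K1 j) f) (x, y))) (cst 0%E) h.
- by move=> j; exact: measurable_energy_fst.
- have := integrable_ae measurableT inth; apply: filterS => y yfin _.
  have fyoo : (energy P1 q (fun x => f (x, y)) < +oo)%E.
    by move: (yfin Logic.I); rewrite fin_numE => /andP[_]; rewrite ltey.
  exact: (cK (fun x => f (x, y))  (measurable_fun_pair1 _ mf) fyoo).
- exact: integrableZl.
- apply: aeW => y j _; rewrite gee0_abs ?energy_ge0//.
  have mfy : measurable_fun setT (fun x => f (x, y)) by exact: measurable_fun_pair1.
  apply: (le_trans (energyB P1 q0 mfy (measurable_kernel_op P1 (bK j) mfy))).
  rewrite /h EFinM -muleA lee_pmul2l ?lte_fin ?powR_gt0// EFinD ge0_muleDl ?lee_fin ?(ltW C0)//.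
  by rewrite mul1e; apply: leeD2l; exact: bC.
Qed.

Lemma op_snd_cvg (K2 : nat -> T2 -> T2 -> R) C f :
  (forall j, bounded_kernel (K2 j)) ->
  0 < C -> (forall j, op_bounded P2 q C (K2 j)) -> op_cvg P2 q K2 ->
  measurable_fun setT f -> (energy P q f < +oo)%E ->
  energy P q (f \- op_snd (K2 j) f)%R @[j --> \oo] --> 0%E.
Proof.
move=> bK C0 bC cK mf foo.
have mfop j : measurable_fun setT (f \- op_snd (K2 j) f).
  by apply: measurable_funB => //; exact: measurable_op_snd.
rewrite (_ : (fun j => _) = fun j =>
    (\int[P1]_x energy P2 q (fun y => (f \- op_snd (K2 j) f)%R (x, y)))%E); last first.
  by apply/funext => j; rewrite energy_prod1.
rewrite (_ : 0%E = (\int[P1]_x (cst 0 x))%E); last by rewrite integral0.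
pose h x := ((2 `^ q * (1 + C))%:E * energy P2 q (fun y => f (x, y)))%E.
have inth : P1.-integrable setT (fun x => energy P2 q (fun y => f (x, y))).
  apply/integrableP; split; first exact: measurable_energy_snd.
  under eq_integral do rewrite gee0_abs ?energy_ge0//.
  by rewrite -energy_prod1.
have [] // := @dominated_convergence _ _ _ P1 setT measurableT
  (fun j x => energy P2 q (fun y => (f \- op_snd (K2 j) f) (x, y))) (cst 0%E) h.
- by move=> j; exact: measurable_energy_snd.
- have := integrable_ae measurableT inth; apply: filterS => x xfin _.
  have fyoo : (energy P2 q (fun y => f (x, y)) < +oo)%E.
    by move: (xfin Logic.I); rewrite fin_numE => /andP[_]; rewrite ltey.
  exact: (cK (fun y => f (x, y))  (measurable_fun_pair2 _ mf) fyoo).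
- exact: integrableZl.
- apply: aeW => x j _; rewrite gee0_abs ?energy_ge0//.
  have mfy : measurable_fun setT (fun y => f (x, y)) by exact: measurable_fun_pair2.
  apply: (le_trans (energyB P2 q0 mfy (measurable_kernel_op P2 (bK j) mfy))).
  rewrite /h EFinM -muleA lee_pmul2l ?lte_fin ?powR_gt0// EFinD ge0_muleDl ?lee_fin ?(ltW C0)//.
  by rewrite mul1e; apply: leeD2l; exact: bC.
Qed.

(** With K1, K2 acting on the two variables, f - K1 K2 f = (f - K1 f) + K1 (f - K2 f); the second
    term is controlled by the bound of K1, uniform in j. *)
Lemma tensor_op_cvg (K1 : nat -> T1 -> T1 -> R)
    (K2 : nat -> T2 -> T2 -> R) C1 C2 :
  (forall j, bounded_kernel (K1 j)) -> (forall j, bounded_kernel (K2 j)) ->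
  0 < C1 -> 0 < C2 ->
  (forall j, op_bounded P1 q C1 (K1 j)) -> (forall j, op_bounded P2 q C2 (K2 j)) ->
  op_cvg P1 q K1 -> op_cvg P2 q K2 ->
  op_cvg P q (fun j => tensor_kernel (K1 j) (K2 j)).
Proof.
move=> b1 b2 C10 C20 B1 B2 c1 c2 f mf foo.
have intf : P.-integrable setT (EFin \o f) by exact: energy_integrable q1 mf foo.
have E j : (energy P q (op_fst (K1 j) f \- op_fst (K1 j) (op_snd (K2 j) f))%R <=
    C1%:E * energy P q (f \- op_snd (K2 j) f)%R)%E.
  apply: (@le_trans _ _ (energy P q (op_fst (K1 j) (f \- op_snd (K2 j) f)%R))); last first.
    apply: op_fst_bounded => //; first exact: ltW.
    by apply: measurable_funB => //; exact: measurable_op_snd.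
  have ms := measurable_op_snd (b2 j) mf.
  have ints : P.-integrable setT (EFin \o op_snd (K2 j) f).
    apply: (energy_integrable q1 ms).
    apply: le_lt_trans (op_snd_bounded (b2 j) (ltW C20) (B2 j) mf) _.
    by rewrite lte_mul_pinfty// lee_fin ltW.
  have mB : measurable_fun setT (op_fst (K1 j) f \- op_fst (K1 j) (op_snd (K2 j) f)).
    by apply: measurable_funB; exact: measurable_op_fst.
  have mO : measurable_fun setT (op_fst (K1 j) (f \- op_snd (K2 j) f)).
    by apply: measurable_op_fst => //; exact: measurable_funB.
  (* [op_fst] is additive only on integrable sections, hence for almost every y; so the energies are
     compared, not the functions. *)
  rewrite (energy_prod2 mB) (energy_prod2 mO) le_eqVlt; apply/orP; left.
  apply/eqP/ae_eq_integral => //.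
  - exact: measurable_energy_fst mB.
  - exact: measurable_energy_fst mO.
  have := ae_integrable2 intf; have := ae_integrable2 ints.
  apply: filterS2 => y inty2 inty1 _; apply: eq_integral => x _; congr (`|_| `^ q)%:E.
  by rewrite /= /op_fst kernel_opB.
apply: (@squeeze_cvge _ _ _ _ (cst 0%E) _ (fun j => (2 `^ q)%:E *
  (energy P q (f \- op_fst (K1 j) f)%R + C1%:E * energy P q (f \- op_snd (K2 j) f)%R))%E).
- near=> j; rewrite energy_ge0/= tensor_opE//.
  rewrite (_ : f \- _ = (f \- op_fst (K1 j) f) \+
    (op_fst (K1 j) f \- op_fst (K1 j) (op_snd (K2 j) f))); last first.
    by apply/funext => z /=; rewrite addrA subrK.
  apply: le_trans (energyD _ _ _ _) _ => //.
  + by apply: measurable_funB => //; exact: measurable_op_fst.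
  + apply: measurable_funB => //; apply: measurable_op_fst => //; exact: measurable_op_snd.
  + by rewrite lee_pmul2l ?lte_fin ?powR_gt0// leeD2l.
- exact: cvg_cst.
- rewrite [X in _ --> X](_ : _ = (2 `^ q)%:E * (0 + C1%:E * 0))%E; last first.
    by rewrite mule0 adde0 mule0.
  apply: cvgeZl => //; apply: cvgeD => //; first exact: op_fst_cvg C10 _ _ _ _.
  apply: cvgeZl => //; exact: op_snd_cvg C20 _ _ _ _.
Unshelve. all: by end_near. Qed.

End tensor.

(** * The conjugate function inequality *)

Local Open Scope complex_scope.

Section complex_inequality.
Context (R : realType).
Local Notation Re := (@complex.Re R).
Local Notation Im := (@complex.Im R).
Implicit Types (z w : R[i]) (u v : R).

Lemma cReD z w : Re (z + w) = Re z + Re w. Proof. by case: z; case: w. Qed.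
Lemma cImD z w : Im (z + w) = Im z + Im w. Proof. by case: z; case: w. Qed.
Lemma cReM z w : Re (z * w) = Re z * Re w - Im z * Im w.
Proof. by case: z; case: w. Qed.
Lemma cImM z w : Im (z * w) = Re z * Im w + Im z * Re w.
Proof. by case: z; case: w. Qed.
Lemma cReN z : Re (- z) = - Re z. Proof. by case: z. Qed.
Lemma cImN z : Im (- z) = - Im z. Proof. by case: z. Qed.
Lemma cRe_sum (I : Type) (s : seq I) (F : I -> R[i]) :
  Re (\sum_(i <- s) F i) = \sum_(i <- s) Re (F i).
Proof. exact: (big_morph Re cReD). Qed.
Lemma cIm_sum (I : Type) (s : seq I) (F : I -> R[i]) :
  Im (\sum_(i <- s) F i) = \sum_(i <- s) Im (F i).
Proof. exact: (big_morph Im cImD). Qed.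

(** A submultiplicative substitute for the modulus, free of square roots. *)
Definition norm1 z : R := `|Re z| + `|Im z|.

Lemma norm1_ge0 z : 0 <= norm1 z. Proof. exact: addr_ge0. Qed.

Lemma norm1D z w : norm1 (z + w) <= norm1 z + norm1 w.
Proof.
rewrite /norm1 cReD cImD addrACA.
by rewrite lerD// ler_normD.
Qed.

Lemma norm1M z w : norm1 (z * w) <= norm1 z * norm1 w.
Proof.
rewrite /norm1 cReM cImM.
apply: (@le_trans _ _ ((`|Re z * Re w| + `|Im z * Im w|) +
  (`|Re z * Im w| + `|Im z * Re w|))).
  by rewrite lerD// ?ler_normD// ler_normB.
by rewrite !normrM; set a := `|_|; set b := `|_|; set c := `|_|; set d := `|_|; lra.
Qed.

(** The difference z - i Im z is Re z, so each step of the telescoping gains one factor [|Re z|]. *)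
Lemma norm1_powB z m :
  norm1 (z ^+ m.+1 - (0 +i* Im z) ^+ m.+1) <= m.+1%:R * `|Re z| * norm1 z ^+ m.
Proof.
elim: m => [|m ih].
  rewrite !expr1 expr0 mulr1 mul1r /norm1 cReD cImD cReN cImN /=.
  by rewrite subr0 subrr normr0 addr0.
set w := 0 +i* Im z.
have -> : z ^+ m.+2 - w ^+ m.+2 =
    z * (z ^+ m.+1 - w ^+ m.+1) + ((Re z)%:C) * w ^+ m.+1.
  have -> : (Re z)%:C = z - w.
    by rewrite /w; case: z {ih w} => a b; apply/eqP; rewrite eq_complex /= subr0 subrr !eqxx.
  by rewrite !(exprS _ m.+1); ring.
apply: (le_trans (norm1D _ _)).
have wr n : norm1 (w ^+ n) <= norm1 z ^+ n.
  elim: n => [|n ihn]; first by rewrite !expr0 /norm1 /= normr1 normr0 addr0.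
  rewrite !exprS (le_trans (norm1M _ _))// ler_pM ?norm1_ge0//.
  by rewrite /norm1 /w /= normr0 lerD2r.
rewrite [X in _ <= X](_ : _ = norm1 z * (m.+1%:R * `|Re z| * norm1 z ^+ m) +
   `|Re z| * norm1 z ^+ m.+1); last by rewrite -[in LHS]natr1 exprS; ring.
apply: lerD.
  by rewrite (le_trans (norm1M _ _))// ler_wpM2l// norm1_ge0.
rewrite (le_trans (norm1M _ _))// ler_pM ?norm1_ge0//.
by rewrite /norm1 /= normr0 addr0.
Qed.

(** (iv)^(2k) = (-1)^k v^(2k); the parity of k fixes the sign that Riesz' inequality depends on. *)
Lemma Re_pure_pow k v : odd k -> Re ((0 +i* v) ^+ k.*2) = - v ^+ k.*2.
Proof.
move=> ok; rewrite -mul2n exprM.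
have -> : (0 +i* v) ^+ 2 = (- v ^+ 2)%:C.
  by apply/eqP; rewrite eq_complex /= !mul0r !mulr0 sub0r addr0 expr2 !eqxx.
by rewrite -rmorphXn /= exprNn -signr_odd ok expr1 mulN1r -exprM.
Qed.

Lemma young_pow m : exists2 C : R, 0 <= C & forall a b : R, 0 <= a -> 0 <= b ->
  m.+1%:R * a * (a + b) ^+ m <= 2^-1 * b ^+ m.+1 + C * a ^+ m.+1.
Proof.
(* With this [e], the region a <= e b gives (m+1) a (a + b)^m <= (m+1) e b (2b)^m = b^(m+1) / 2. In
   the other region b <= a / e, and everything is a multiple of a^(m+1). *)
pose e : R := (m.+1%:R * 2 ^+ m.+1)^-1.
have e0 : 0 < e by rewrite invr_gt0 mulr_gt0// exprn_gt0.
have e1 : e <= 1.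
  rewrite invf_le1 ?mulr_gt0 ?exprn_gt0//.
  by rewrite -[leLHS]mulr1 ler_pM// ?ler1n// exprn_ege1// ler1n.
exists (m.+1%:R * (1 + e^-1) ^+ m).
  by rewrite mulr_ge0// exprn_ge0// addr_ge0// invr_ge0 ltW.
move=> a b a0 b0.
have [ab|/ltW ab] := leP a (e * b).
  apply: (@le_trans _ _ (2^-1 * b ^+ m.+1)); last first.
    rewrite lerDl !mulr_ge0 ?exprn_ge0//.
    by rewrite addr_ge0// invr_ge0 ltW.
  have ab2 : a + b <= 2 * b.
    by rewrite mulr2n mulrDl mul1r lerD2r (le_trans ab)// ler_piMl.
  apply: (@le_trans _ _ (m.+1%:R * (e * b) * (2 * b) ^+ m)).
    rewrite ler_pM ?mulr_ge0 ?exprn_ge0 ?addr_ge0//; first by rewrite ler_wpM2l.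
    by rewrite lerXn2r ?nnegrE ?addr_ge0 ?mulr_ge0.
  rewrite exprMn [leLHS](_ : _ = (m.+1%:R * 2 ^+ m * e) * b ^+ m.+1); last by rewrite exprS; ring.
  rewrite ler_wpM2r ?exprn_ge0// /e exprS invfM invfM.
  rewrite [leLHS](_ : _ = 2^-1 * ((m.+1%:R * m.+1%:R^-1) * (2 ^+ m * (2 ^+ m)^-1))); last by ring.
  by rewrite !divff ?mulr1// ?pnatr_eq0// expf_neq0// pnatr_eq0.
have {}ab : b <= e^-1 * a by rewrite ler_pdivlMl.
rewrite (@le_trans _ _ (m.+1%:R * (1 + e^-1) ^+ m * a ^+ m.+1))//; last first.
  by rewrite lerDr mulr_ge0 ?exprn_ge0.
rewrite [leRHS](_ : _ = m.+1%:R * a * ((1 + e^-1) * a) ^+ m); last by rewrite exprMn exprS; ring.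
rewrite ler_wpM2l ?mulr_ge0// lerXn2r ?nnegrE ?addr_ge0 ?mulr_ge0 ?addr_ge0 ?invr_ge0//.
by rewrite mulrDl mul1r lerD2l.
Qed.

(** By [norm1_powB], Re (z^(2k)) + (Im z)^(2k) is at most 2k |Re z| (|Re z| + |Im z|)^(2k-1), and
    [young_pow] turns this into half of (Im z)^(2k) plus a multiple of (Re z)^(2k). Absorbing that
    half explains the factors 2. *)
Lemma Im_pow_le k : odd k -> exists2 C : R, 0 <= C & forall z,
  Im z ^+ k.*2 <= - (2 * Re (z ^+ k.*2)) + C * Re z ^+ k.*2.
Proof.
move=> ok; have k0 : (0 < k)%N by case: k ok.
have [m mE] : exists m, k.*2 = m.+1 by exists k.*2.-1; rewrite prednK// double_gt0.
have ev a : `|a| ^+ k.*2 = a ^+ k.*2 :> R.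
  by rewrite -normrX ger0_norm// exprn_even_ge0// odd_double.
have [C C0 HC] := young_pow m.
exists (2 * C); first by rewrite mulr_ge0.
move=> z; have := norm1_powB z m; rewrite -mE => H.
have {}H : `|Re (z ^+ k.*2) + Im z ^+ k.*2| <= k.*2%:R * `|Re z| * norm1 z ^+ m.
  apply: le_trans H; rewrite /norm1 cReD cReN Re_pure_pow// opprK.
  by rewrite lerDl.
have := HC _ _ (normr_ge0 (Re z)) (normr_ge0 (Im z)).
rewrite -mE => /(le_trans H); rewrite !ev ler_norml => /andP[_]; lra.
Qed.

End complex_inequality.

(** * The unit interval and trigonometric integrals *)

Section unit_interval_measure.
Context (R : realType).

(** A measure on the whole line carried by (0,1), so that functions keep the domain [R] and the
    total mass is one. *)
Definition unit_measure : set (measurableTypeR R) -> \bar R :=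
  mrestr (@lebesgue_measure R) (@measurable_itv R `]0, 1[).

HB.instance Definition _ := Measure.on unit_measure.

Let unit_measureT : unit_measure setT = 1%E.
Proof.
rewrite /unit_measure /mrestr setTI lebesgue_measure_itv/= lte_fin ltr01.
by rewrite sube0.
Qed.

HB.instance Definition _ := Measure_isProbability.Build _ _ _ unit_measure unit_measureT.

Lemma integral_unit_measure (f : R -> \bar R) : measurable_fun setT f ->
  (forall x, 0 <= f x)%E ->
  (\int[unit_measure]_x f x = \int[@lebesgue_measure R]_(x in `]0%R, 1%R[) f x)%E.
Proof.
move=> mf f0.
pose D : set (measurableTypeR R) := `]0%R, 1%R[%classic.
have mD : measurable (~` D) by apply: measurableC; exact: measurable_itv.
rewrite (@ge0_negligible_integral _ _ _ _ setT (~` D))//; last first.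
  by rewrite /= /unit_measure /mrestr setICl measure0.
rewrite setTD setCK; apply: eq_measure_integral => A mA AD.
by rewrite /= /unit_measure /mrestr (setIidl AD).
Qed.

Lemma integral_unit_measure_cvg (f : R -> \bar R) :
  (\int[unit_measure]_(x in `]0%R, 1%R[) f x = \int[@lebesgue_measure R]_(x in `]0%R, 1%R[) f x)%E.
Proof.
apply: eq_measure_integral => A mA AD.
by rewrite /= /unit_measure /mrestr (setIidl AD).
Qed.

Lemma integral_unit_measureE (f : R -> \bar R) :
  unit_measure.-integrable setT f ->
  (\int[unit_measure]_x f x = \int[@lebesgue_measure R]_(x in `]0%R, 1%R[) f x)%E.
Proof.
move=> intf.
pose D : set (measurableTypeR R) := `]0%R, 1%R[%classic.
have mD : measurable (~` D) by apply: measurableC; exact: measurable_itv.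
rewrite (@negligible_integral _ _ _ _ setT (~` D))//; last first.
  by rewrite /= /unit_measure /mrestr setICl measure0.
rewrite setTD setCK; exact: integral_unit_measure_cvg.
Qed.

End unit_interval_measure.

Section trig_integral.
Context (R : realType).
Local Notation U := (@unit_measure R : probability (measurableTypeR R) R).

Lemma measurable_cos_comp d (T : measurableType d) (f : T -> R) :
  measurable_fun setT f -> measurable_fun setT (fun x => cos (f x)).
Proof.
move=> mf; apply: (@measurableT_comp _ _ _ _ _ _ (@cos R)) => //.
by apply: continuous_measurable_fun; exact: continuous_cos.
Qed.

Lemma measurable_sin_comp d (T : measurableType d) (f : T -> R) :
  measurable_fun setT f -> measurable_fun setT (fun x => sin (f x)).
Proof.
move=> mf; apply: (@measurableT_comp _ _ _ _ _ _ (@sin R)) => //.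
by apply: continuous_measurable_fun; exact: continuous_sin.
Qed.

Lemma cosD2piz (x : R) (k : int) : cos (x + 2 * pi * k%:~R) = cos x.
Proof.
have E n y : cos (y + 2 * pi * n%:R) = cos y :> R.
  have -> : 2 * pi * n%:R = pi *+ 2 *+ n :> R
    by rewrite -[RHS]mulr_natr -(mulr_natr pi 2) (mulrC 2).
  exact: (periodicn (@cosD2pi R) n y).
case: k => n; first exact: E.
by rewrite -[in RHS](subrK (2 * pi * n.+1%:R) x) NegzE mulrNz mulrN E.
Qed.

Lemma sinD2piz (x : R) (k : int) : sin (x + 2 * pi * k%:~R) = sin x.
Proof. by rewrite -2!cosBpihalf addrAC cosD2piz. Qed.

Lemma integrable_cos_affine (a b : R) :
  U.-integrable setT (EFin \o (fun x => cos (a + b * x))).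
Proof.
apply: (@integrable_bounded_cst _ _ _ _ _ 1).
  by apply: measurable_cos_comp; apply: measurable_funD => //; exact: measurable_funM.
by move=> x; rewrite ler_norml cos_geN1 cos_le1.
Qed.

(** For k nonzero the primitive sin (a + 2 pi k x) / (2 pi k) takes equal values at 0 and 1. The
    phase [a] covers the sine as well, with a = - pi / 2. *)
Lemma Rintegral_cos_affine (a : R) (k : int) :
  \int[U]_x cos (a + 2 * pi * k%:~R * x) = if k == 0 then cos a else 0.
Proof.
case: eqP => [->|/eqP k0].
  under eq_Rintegral do rewrite mulr0 mul0r addr0.
  by rewrite Rintegral_cst// (_ : _ setT = 1%E) ?mulr1//; exact: probability_setT.
have b0 : 2 * pi * k%:~R != 0 :> R.
  by rewrite !mulf_neq0// ?intr_eq0// gt_eqF// pi_gt0.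
set b := 2 * pi * k%:~R in b0 *.
rewrite /Rintegral integral_unit_measureE; last exact: integrable_cos_affine.
rewrite -(@integral_itv_bndoo _ 0 1 _ true false); last first.
  apply/measurable_EFinP; apply: measurable_funTS.
  by apply: measurable_cos_comp; apply: measurable_funD => //; exact: measurable_funM.
pose F x := b^-1 * sin (a + b * x).
have dF (x : R) : is_derive x (1 : R) (F : R -> R^o) (cos (a + b * x)).
  rewrite /F; apply: is_derive_eq.
  by rewrite /GRing.scale /= add0r mul1r mulr1 mulrCA mulVf// mulr1.
rewrite (@continuous_FTC2 _ _ F)//.
- rewrite /F mulr0 addr0 mulr1 /b sinD2piz subee//.
- apply: continuous_subspaceT => x.
  apply: continuous_comp; last exact: continuous_cos.
  apply: cvgD; first exact: cvg_cst.
  by apply: cvgM; [exact: cvg_cst|exact: cvg_id].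
- split.
  + by move=> x _; exact: ex_derive.
  + apply: cvg_at_right_filter; apply: differentiable_continuous.
    by apply/derivable1_diffP; exact: ex_derive.
  + apply: cvg_at_left_filter; apply: differentiable_continuous.
    by apply/derivable1_diffP; exact: ex_derive.
- by move=> x _; rewrite derive1E derive_val.
Qed.

End trig_integral.

Lemma integrable_sumr d (T : measurableType d) (R : realType)
    (mu : {measure set T -> \bar R}) (I : Type) (s : seq I) (F : I -> T -> R) :
  (forall i, mu.-integrable setT (EFin \o F i)) ->
  mu.-integrable setT (EFin \o (fun x => \sum_(i <- s) F i x)).
Proof.
move=> intF; rewrite (_ : _ \o _ = (fun x => \sum_(i <- s) (EFin \o F i) x)%E).
  by apply: integrable_sum.
by apply/funext => x /=; rewrite sumEFin.
Qed.

Lemma Rintegral_sum d (T : measurableType d) (R : realType)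
    (mu : {measure set T -> \bar R}) (I : Type) (s : seq I) (F : I -> T -> R) :
  (forall i, mu.-integrable setT (EFin \o F i)) ->
  \int[mu]_x (\sum_(i <- s) F i x) = \sum_(i <- s) \int[mu]_x F i x.
Proof.
move=> intF; elim: s => [|i s ih].
  under eq_Rintegral do rewrite big_nil.
  by rewrite big_nil /Rintegral integral0.
under eq_Rintegral do rewrite big_cons.
rewrite big_cons -ih RintegralD//.
exact: integrable_sumr.
Qed.

(** * Trigonometric polynomials and conjugate functions *)

Section trig_poly.
Context (R : realType).
Local Notation Re := (@complex.Re R).
Local Notation Im := (@complex.Im R).
Local Notation U := (@unit_measure R : probability (measurableTypeR R) R).
Implicit Types (p : {poly R[i]}) (x : R).

Definition expi x : R[i] := cos (2 * pi * x) +i* sin (2 * pi * x).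

Lemma expiX x j :
  expi x ^+ j = cos (2 * pi * j%:R * x) +i* sin (2 * pi * j%:R * x).
Proof.
elim: j => [|j ih]; first by rewrite expr0 mulr0 mul0r cos0 sin0.
rewrite exprS ih.
have -> : 2 * pi * j.+1%:R * x = 2 * pi * x + 2 * pi * j%:R * x.
  by rewrite -(natr1 j); ring.
by rewrite cosD sinD; apply/eqP; rewrite eq_complex /= addrC eqxx [_ + cos _ * _]addrC eqxx.
Qed.

Lemma expi_circle x j : Re (expi x ^+ j) ^+ 2 + Im (expi x ^+ j) ^+ 2 = 1.
Proof. by rewrite expiX /= cos2Dsin2. Qed.

(** Coefficient a - ib at z^j contributes a cos (2 pi j x) + b sin (2 pi j x), so these are all the
    real trigonometric polynomials, and degree in z is frequency. *)
Definition trig_poly p x : R := Re p.[expi x].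

Lemma trig_polyE p x : trig_poly p x = \sum_(i < size p)
  (Re p`_i * cos (2 * pi * i%:R * x) - Im p`_i * sin (2 * pi * i%:R * x)).
Proof.
rewrite /trig_poly horner_coef cRe_sum; apply: eq_bigr => i _.
by rewrite cReM expiX.
Qed.

Lemma trig_polyE_wide n p x : (size p <= n)%N -> trig_poly p x = \sum_(i < n)
  (Re p`_i * cos (2 * pi * i%:R * x) - Im p`_i * sin (2 * pi * i%:R * x)).
Proof.
move=> pn; rewrite /trig_poly (horner_coef_wide _ pn) cRe_sum; apply: eq_bigr => i _.
by rewrite cReM expiX.
Qed.

Lemma measurable_trig_poly p :
  measurable_fun [set: measurableTypeR R] (trig_poly p).
Proof.
rewrite (_ : trig_poly p = fun x => \sum_(i < size p)
  (Re p`_i * cos (2 * pi * i%:R * x) - Im p`_i * sin (2 * pi * i%:R * x))); last first.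
  by apply/funext => x; rewrite trig_polyE.
apply: measurable_sum => i; apply: measurable_funB; apply: measurable_funM => //.
  by apply: measurable_cos_comp; exact: measurable_funM.
by apply: measurable_sin_comp; exact: measurable_funM.
Qed.

Lemma trig_poly_bounded p : exists M : R, forall x, `|trig_poly p x| <= M.
Proof.
exists (\sum_(i < size p) norm1 p`_i) => x; rewrite trig_polyE.
apply: (le_trans (ler_norm_sum _ _ _)); apply: ler_sum => i _.
rewrite (le_trans (ler_normB _ _))// !normrM lerD// ler_piMr//.
  by rewrite ler_norml cos_geN1 cos_le1.
by rewrite ler_norml sin_geN1 sin_le1.
Qed.

Lemma integrable_trig_poly p : U.-integrable setT (EFin \o trig_poly p).
Proof.
have [M HM] := trig_poly_bounded p.
apply: (@integrable_bounded_cst _ _ _ U (trig_poly p) M) => //.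
exact: measurable_trig_poly.
Qed.

Lemma Rintegral_cos0 (k : int) :
  \int[U]_x cos (2 * pi * k%:~R * x) = if k == 0 then 1 else 0.
Proof.
rewrite -[X in if _ then X else _](@cos0 R) -Rintegral_cos_affine.
by apply: eq_Rintegral => x _; rewrite add0r.
Qed.

Lemma Rintegral_sin0 (k : int) : \int[U]_x sin (2 * pi * k%:~R * x) = 0.
Proof.
transitivity (\int[U]_x cos (- (pi / 2) + 2 * pi * k%:~R * x)).
  by apply: eq_Rintegral => x _; rewrite addrC cosBpihalf.
by rewrite Rintegral_cos_affine cosN cos_pihalf; case: ifP.
Qed.

Lemma integrable_cosM (b : R) : U.-integrable setT (EFin \o (fun x => cos (b * x))).
Proof.
apply: (@integrable_bounded_cst _ _ _ _ _ 1).
  by apply: measurable_cos_comp; exact: measurable_funM.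
by move=> x; rewrite ler_norml cos_geN1 cos_le1.
Qed.

Lemma integrable_sinM (b : R) : U.-integrable setT (EFin \o (fun x => sin (b * x))).
Proof.
apply: (@integrable_bounded_cst _ _ _ _ _ 1).
  by apply: measurable_sin_comp; exact: measurable_funM.
by move=> x; rewrite ler_norml sin_geN1 sin_le1.
Qed.

Lemma Rintegral_trig_poly p : \int[U]_x trig_poly p x = Re p`_0.
Proof.
pose F (i : nat) x :=
  Re p`_i * cos (2 * pi * i%:R * x) - Im p`_i * sin (2 * pi * i%:R * x).
have intF i : U.-integrable setT (EFin \o F i).
  have := integrableB measurableT
    (integrableZl measurableT (Re p`_i) (integrable_cosM (2 * pi * i%:R)))
    (integrableZl measurableT (Im p`_i) (integrable_sinM (2 * pi * i%:R))).
  exact.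
have IF i : \int[U]_x F i x = if i == 0%N then Re p`_0 else 0.
  rewrite /F RintegralB//; last 2 first.
    exact: (integrableZl measurableT (Re p`_i) (integrable_cosM (2 * pi * i%:R))).
    exact: (integrableZl measurableT (Im p`_i) (integrable_sinM (2 * pi * i%:R))).
  rewrite !RintegralZl//; last 2 first.
    exact: integrable_sinM.
    exact: integrable_cosM.
  rewrite (Rintegral_sin0 i) (Rintegral_cos0 i) mulr0 subr0.
  by case: i => [|i] /=; rewrite ?mulr1// mulr0.
transitivity (\int[U]_x \sum_(i <- iota 0 (size p)) F i x).
  apply: eq_Rintegral => x _; rewrite trig_polyE.
  by rewrite -[in RHS](subn0 (size p)) big_mkord.
rewrite Rintegral_sum//; under eq_bigr do rewrite IF.
case E : (size p) => [|n].
  by move/eqP: E; rewrite size_poly_eq0 => /eqP ->; rewrite big_nil coef0.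
rewrite /= big_cons /= big1_seq ?addr0// => i /andP[_].
by rewrite mem_iota; case: i.
Qed.

Lemma energy_even k (f : R -> R) :
  energy U k.*2%:R f = (\int[U]_x (f x ^+ k.*2)%:E)%E.
Proof.
apply: eq_integral => x _; rewrite powR_mulrn//.
by rewrite -normrX ger0_norm// exprn_even_ge0// odd_double.
Qed.

Lemma integrable_trig_polyX p n :
  U.-integrable setT (EFin \o (fun x => trig_poly p x ^+ n)).
Proof.
have [M HM] := trig_poly_bounded p.
apply: (@integrable_bounded_cst _ _ _ _ _ (M ^+ n)).
  by apply: measurable_funX; exact: measurable_trig_poly.
move=> x; rewrite normrX lerXn2r// ?nnegrE// (le_trans _ (HM x))//.
Qed.

(** Im w = Re (- i w): the conjugate function is again a trigonometric polynomial. *)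
Lemma Im_trig_poly p x : Im p.[expi x] = trig_poly ((0 -i* 1) *: p) x.
Proof. by rewrite /trig_poly hornerZ cReM /= mul0r sub0r mulN1r opprK. Qed.

(* M. Riesz' argument: F = u + iv is a polynomial in e^(2 pi i x), hence
   F^(2k) has mean F(0)^(2k). *)
Lemma conjugate_energy_le0 k : odd k -> exists2 C : R, 0 <= C &
  forall p, Im p`_0 = 0 ->
  (energy U k.*2%:R (fun x => Im p.[expi x]) <= C%:E * energy U k.*2%:R (trig_poly p))%E.
Proof.
move=> ok; have [C C0 HC] := Im_pow_le R ok.
exists C => // p p0; rewrite !energy_even.
have E : (fun x => Im p.[expi x]) = trig_poly ((0 -i* 1) *: p).
  by apply/funext => x; rewrite Im_trig_poly.
under eq_integral do rewrite Im_trig_poly.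
have i1 := integrable_trig_polyX ((0 -i* 1) *: p) k.*2.
have i2 := integrable_trig_polyX p k.*2.
rewrite -[leLHS]fineK; last exact: integrable_fin_num i1.
rewrite -[in leRHS](fineK (integrable_fin_num measurableT i2)) -EFinM lee_fin.
have i3 := integrable_trig_poly (p ^+ k.*2).
have i4 : U.-integrable setT (EFin \o (fun x => 2 * trig_poly (p ^+ k.*2) x)).
  exact: (integrableZl measurableT 2 i3).
have i5 : U.-integrable setT (EFin \o (fun x => C * trig_poly p x ^+ k.*2)).
  exact: (integrableZl measurableT C i2).
apply: (@le_trans _ _ (\int[U]_x (C * trig_poly p x ^+ k.*2 - 2 * trig_poly (p ^+ k.*2) x))).
  apply: le_Rintegral => //; first exact: (integrableB measurableT i5 i4).
  move=> x _; rewrite -Im_trig_poly addrC /trig_poly horner_exp.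
  exact: HC.
rewrite RintegralB// !RintegralZl// Rintegral_trig_poly gerBl mulr_ge0//.
rewrite -horner_coef0 horner_exp horner_coef0; case: (p`_0) p0 => a b /= ->.
rewrite (_ : a +i* 0 = a%:C)// -rmorphXn /=.
by rewrite exprn_even_ge0// odd_double.
Qed.

End trig_poly.

(** * Truncation bounded through conjugate functions *)

Section truncation.
Context (R : realType).
Local Notation Re := (@complex.Re R).
Local Notation Im := (@complex.Im R).
Local Notation U := (@unit_measure R : probability (measurableTypeR R) R).
Implicit Types (p : {poly R[i]}) (x : R).

Lemma measurable_Im_trig_poly p :
  measurable_fun [set: measurableTypeR R] (fun x : R => Im p.[expi x]).
Proof.
rewrite (_ : (fun x => _) = trig_poly ((0 -i* 1) *: p)).
  exact: measurable_trig_poly.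
by apply/funext => x; rewrite Im_trig_poly.
Qed.

(** Subtracting i Im p_0 makes the constant coefficient real, leaves Re p unchanged and moves Im p
    by a constant. *)
Lemma conjugate_energy_le k : odd k -> exists2 C : R, 0 <= C &
  forall p,
  (energy U k.*2%:R (fun x => Im p.[expi x]) <=
   C%:E * (energy U k.*2%:R (trig_poly p) + (Im p`_0 ^+ k.*2)%:E))%E.
Proof.
move=> ok; have [C C0 HC] := conjugate_energy_le0 R ok.
pose c : R := 2 `^ k.*2%:R; have c0 : 0 <= c by exact: powR_ge0.
exists (c * (C + 1)); first by rewrite mulr_ge0// addr_ge0.
move=> p; pose p' := p - (0 +i* Im p`_0)%:P.
have p'0 : Im p'`_0 = 0 by rewrite coefB coefC /= cImD cImN /= subrr.
have E1 : trig_poly p' = trig_poly p.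
  by apply/funext => x; rewrite /trig_poly hornerD hornerN hornerC cReD cReN /= subr0.
have E2 : (fun x => Im p.[expi x]) = (fun x => Im p'.[expi x]) \+ cst (Im p`_0).
  by apply/funext => x /=; rewrite hornerD hornerN hornerC cImD cImN /= subrK.
have := HC _ p'0; rewrite E1 => H.
rewrite E2; apply: (le_trans (energyD _ _ _ _)) => //.
  exact: measurable_Im_trig_poly.
rewrite EFinM -muleA -/c; apply: lee_wpmul2l; first by rewrite lee_fin.
rewrite energy_cst powR_mulrn// -normrX ger0_norm; last first.
  by rewrite exprn_even_ge0// odd_double.
have e0 := energy_ge0 U k.*2%:R (trig_poly p).
have i0 : (0 <= (Im p`_0 ^+ k.*2)%:E :> \bar R)%E.
  by rewrite lee_fin exprn_even_ge0// odd_double.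
rewrite ge0_muleDr// EFinD; apply: leeD.
  by apply: (le_trans H); apply: lee_wpmul2r => //; rewrite leeDl.
by rewrite -EFinD -EFinM lee_fin mulrDl mul1r lerDr mulr_ge0.
Qed.

Lemma Re_hornerBi (p q : {poly R[i]}) z :
  Re (p - (0 +i* 1) *: q).[z] = Re p.[z] + Im q.[z].
Proof.
rewrite hornerD hornerN hornerZ.
by case: (q.[z]) (p.[z]) => [a b] [c d] /=; ring.
Qed.

Lemma Im_hornerBi (p q : {poly R[i]}) z :
  Im (p - (0 +i* 1) *: q).[z] = Im p.[z] - Re q.[z].
Proof.
rewrite hornerD hornerN hornerZ.
by case: (q.[z]) (p.[z]) => [a b] [c d] /=; ring.
Qed.

Lemma scale_combination (u d t : {poly R[i]}) :
  d = (2^-1)%:C *: (u + d + t) - (0 +i* 1) *: ((2^-1)%:C *: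
    ((0 -i* 1) *: u + (0 +i* 1) *: d + (0 -i* 1) *: t)).
Proof.
set c : R[i] := (2^-1)%:C.
have h1 : (0 +i* 1) * c * (0 -i* 1) = c :> R[i].
  by apply/eqP; rewrite eq_complex /=; apply/andP; split; apply/eqP; ring.
have h2 : (0 +i* 1) * c * (0 +i* 1) = - c :> R[i].
  by apply/eqP; rewrite eq_complex /=; apply/andP; split; apply/eqP; ring.
have h3 : c + c = 1 :> R[i].
  by apply/eqP; rewrite eq_complex /=; apply/andP; split; apply/eqP; [field|ring].
rewrite !scalerDr !scalerA h1 h2 scaleNr.
rewrite [RHS](_ : _ = c *: d + c *: d); last by ring.
by rewrite -scalerDl h3 scale1r.
Qed.

Lemma lee_add2 (a b e : \bar R) : (a <= e -> b <= e -> a + b <= 2%:E * e)%E.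
Proof. by move=> ae be; rewrite mule_natl mule2n leeD. Qed.

Lemma mule_combination (c d C : R) (e a b : \bar R) : 0 <= c -> 0 <= d -> 0 <= C ->
  (0 <= e -> a <= C%:E * e -> b <= C%:E * e ->
   c%:E * (c%:E * (d%:E * e + a) + b) <= (c * (c * (d + C) + C))%:E * e)%E.
Proof.
move=> c0 d0 C0 e0 ae be; rewrite EFinM -muleA; apply: lee_wpmul2l; first by rewrite lee_fin.
rewrite EFinD ge0_muleDl ?lee_fin ?mulr_ge0 ?addr_ge0//; apply: leeD => //.
rewrite EFinM -muleA; apply: lee_wpmul2l; first by rewrite lee_fin.
by rewrite EFinD ge0_muleDl ?lee_fin//; exact: leeD2l.
Qed.

Lemma coef0_energy k (q : {poly R[i]}) : (0 < k)%N ->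
  (((Re q`_0) ^+ k.*2)%:E <= energy U k.*2%:R (trig_poly q))%E.
Proof.
move=> k0; rewrite -Rintegral_trig_poly.
have := @jensen_energy _ _ _ U k.*2%:R (trig_poly q) _ (measurable_trig_poly q).
rewrite powR_mulrn// -normrX ger0_norm; last by rewrite exprn_even_ge0// odd_double.
apply; by rewrite ler1n double_gt0.
Qed.

(** The constant terms that the conjugate bound leaves for A and B are, up to sign, the means of the
    real parts of B and A; by [coef0_energy] they cost one more energy of p each, hence 2 C in place
    of C. *)
Lemma energy_le_of_conjugates (p T A B : {poly R[i]}) k (C : R) :
  (forall x, `|trig_poly T x| <=
    3 * `|trig_poly p x| + `|Im A.[expi x]| + `|Im B.[expi x]|) ->
  (forall x, `|trig_poly A x| <= `|trig_poly p x|) ->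
  (forall x, `|trig_poly B x| <= `|trig_poly p x|) ->
  Im A`_0 = - Re B`_0 -> Im B`_0 = Re A`_0 -> 0 <= C -> (0 < k)%N ->
  (forall q : {poly R[i]},
    (energy U k.*2%:R (fun x => Im q.[expi x]) <=
     C%:E * (energy U k.*2%:R (trig_poly q) + (Im q`_0 ^+ k.*2)%:E))%E) ->
  (energy U k.*2%:R (trig_poly T) <=
   (2 `^ k.*2%:R * (2 `^ k.*2%:R * (3 `^ k.*2%:R + 2 * C) + 2 * C))%:E *
   energy U k.*2%:R (trig_poly p))%E.
Proof.
move=> Re_take_le Re_A_le Re_B_le Im_A0 Im_B0 C0 k0 HC.
set c : R := 2 `^ k.*2%:R; have c0 : 0 <= c by exact: powR_ge0.
set q := k.*2%:R; have q0 : 0 <= q by rewrite /q.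
have eA : (energy U q (trig_poly A) <= energy U q (trig_poly p))%E.
  by apply: le_energy => //; exact: measurable_trig_poly.
have eB : (energy U q (trig_poly B) <= energy U q (trig_poly p))%E.
  by apply: le_energy => //; exact: measurable_trig_poly.
have iA : (energy U q (fun x => Im A.[expi x]) <= (2 * C)%:E * energy U q (trig_poly p))%E.
  apply: (le_trans (HC A)); rewrite Im_A0 exprNn -signr_odd odd_double expr0 mul1r.
  rewrite mulrC EFinM -muleA; apply: lee_wpmul2l; first by rewrite lee_fin.
  rewrite -/q; apply: lee_add2; first exact: eA.
  by apply: le_trans eB; exact: coef0_energy.
have iB : (energy U q (fun x => Im B.[expi x]) <= (2 * C)%:E * energy U q (trig_poly p))%E.
  apply: (le_trans (HC B)); rewrite Im_B0.
  rewrite mulrC EFinM -muleA; apply: lee_wpmul2l; first by rewrite lee_fin.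
  rewrite -/q; apply: lee_add2; first exact: eB.
  by apply: le_trans eA; exact: coef0_energy.
have mp := measurable_trig_poly p.
have mA := measurable_Im_trig_poly A.
have mB := measurable_Im_trig_poly B.
pose f1 (x : measurableTypeR R) := 3 * `|trig_poly p x|.
pose f2 (x : measurableTypeR R) := `|Im A.[expi x]|.
pose f3 (x : measurableTypeR R) := `|Im B.[expi x]|.
have m1 : measurable_fun setT f1.
  by apply: measurable_funM => //; exact: measurableT_comp.
have m2 : measurable_fun setT f2 by exact: measurableT_comp.
have m3 : measurable_fun setT f3 by exact: measurableT_comp.
have e1 : energy U q f1 = ((3 `^ q)%:E * energy U q (trig_poly p))%E.
  rewrite /energy -ge0_integralZl//; last first.
    exact: measurable_EFin_normr_powR.
  by apply: eq_integral => x _; rewrite /f1 normrM normr_id normr_nat powRM// EFinM.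
have e2 : energy U q f2 = energy U q (fun x => Im A.[expi x]).
  by apply: eq_integral => x _; rewrite /f2 normr_id.
have e3 : energy U q f3 = energy U q (fun x => Im B.[expi x]).
  by apply: eq_integral => x _; rewrite /f3 normr_id.
have f123 x : `|trig_poly T x| <= `|f1 x + f2 x + f3 x|.
  by rewrite (le_trans (Re_take_le x))// ler_norm.
apply: (le_trans (energy_le_add3 U q0 (measurable_trig_poly T) m1 m2 m3 f123)).
rewrite e1 e2 e3; apply: mule_combination iA iB.
- exact: c0.
- exact: powR_ge0.
- by rewrite mulr_ge0.
- exact: energy_ge0.
Qed.

(* Write z = e^(2 pi i x), p = T + z^M D with deg T < M, and u = Re p on the circle.
   A and B are the polynomials with real parts Re (z^M) u and Im (z^M) u there, and
   D = A - i B; so D, and then T, is controlled by u and two conjugate functions. *)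
Section truncated_high_part.
Variables (m : nat) (p : {poly R[i]}).
Let M := m.+1.
Let D := drop_poly M p.
Let T := take_poly M p.
(** On the circle this is z^M times the conjugate of T. It is a polynomial without constant term,
    since deg T < M leaves exponents M - j >= 1. *)
Let cT : {poly R[i]} := \sum_(j < M) (p`_j)^*%:P * 'X^(M - j).
Let A : {poly R[i]} := (2^-1)%:C *: ('X^M * p + D + cT).
Let B : {poly R[i]} := (2^-1)%:C *: ((0 -i* 1) *: ('X^M * p) + (0 +i* 1) *: D
  + (0 -i* 1) *: cT).

Lemma horner_conj_take x : cT.[expi x] = expi x ^+ M * (T.[expi x])^*.
Proof.
rewrite /cT /T horner_sum.
have sT : (size (take_poly M p) <= M)%N by exact: size_take_poly.
rewrite (horner_coef_wide _ sT) (rmorph_sum (@conjc R)) mulr_sumr; apply: eq_bigr => j _.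
rewrite hornerM hornerC hornerXn coef_take_poly ltn_ord rmorphM /= mulrCA; congr (_ * _).
have jM : (j <= M)%N by rewrite ltnW.
have -> : expi x ^+ M = expi x ^+ (M - j) * expi x ^+ j by rewrite -exprD subnK.
rewrite -mulrA.
suff -> : expi x ^+ j * (expi x ^+ j)^* = 1 by rewrite mulr1.
have := expi_circle x j; case: (expi x ^+ j) => a b /= ab.
apply/eqP; rewrite eq_complex /= -ab !expr2 mulrN opprK eqxx/=.
by rewrite mulrN [b * a]mulrC addNr eqxx.
Qed.

(** On the circle z^M conj(p) = cT + conj(D), hence z^M Re p = (z^M p + cT + conj(D)) / 2. Replacing
    conj(D) by D keeps the real part and yields A. *)
Lemma Re_A x : Re A.[expi x] = Re (expi x ^+ M) * Re p.[expi x].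
Proof.
have dec : T.[expi x] + D.[expi x] * expi x ^+ M = p.[expi x].
  by rewrite -[in RHS](poly_take_drop M p) hornerD hornerM hornerXn.
rewrite /A hornerZ !hornerD hornerM hornerXn horner_conj_take.
have := expi_circle x M; move: dec.
case: (expi x ^+ M) (T.[_]) (D.[_]) (p.[_]) => [c s] [a b] [u v] [P Q] /= [dP dQ] cs.
have -> : u = c * (P - a) + s * (Q - b).
  rewrite -dP -dQ [RHS](_ : _ = u * (c ^+ 2 + s ^+ 2)); last by ring.
  by rewrite cs mulr1.
by field.
Qed.

(** The imaginary part of the same identity: Im conj(D) = - Im D, and Im w = Re (- i w) gives the
    coefficients -i, i, -i of B. *)
Lemma Re_B x : Re B.[expi x] = Im (expi x ^+ M) * Re p.[expi x].
Proof.
have dec : T.[expi x] + D.[expi x] * expi x ^+ M = p.[expi x].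
  by rewrite -[in RHS](poly_take_drop M p) hornerD hornerM hornerXn.
rewrite /B hornerZ !hornerD !hornerZ hornerM hornerXn horner_conj_take.
have := expi_circle x M; move: dec.
case: (expi x ^+ M) (T.[_]) (D.[_]) (p.[_]) => [c s] [a b] [u v] [P Q] /= [dP dQ] cs.
have -> : v = c * (Q - b) - s * (P - a).
  rewrite -dP -dQ [RHS](_ : _ = v * (c ^+ 2 + s ^+ 2)); last by ring.
  by rewrite cs mulr1.
by field.
Qed.

Lemma D_AB : D = A - (0 +i* 1) *: B.
Proof. exact: scale_combination. Qed.

Lemma coef0_cT : cT`_0 = 0.
Proof.
rewrite /cT coef_sum big1// => j _.
by rewrite coefCM coefXn eq_sym subn_eq0 leqNgt ltn_ord mulr0.
Qed.

Lemma coef0_XM : ('X^M * p)`_0 = 0. Proof. by rewrite coefXnM /M ltn0Sn. Qed.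

(** Only D contributes to the constant coefficients of A and B, so B_0 = i A_0. *)
Lemma Im_A0 : Im A`_0 = - Re B`_0.
Proof.
rewrite /A /B !coefZ !coefD !coefZ coef0_XM coef0_cT !mulr0 !addr0 !add0r.
case: (D`_0) => a b /=; ring.
Qed.

Lemma Im_B0 : Im B`_0 = Re A`_0.
Proof.
rewrite /A /B !coefZ !coefD !coefZ coef0_XM coef0_cT !mulr0 !addr0 !add0r.
case: (D`_0) => a b /=; ring.
Qed.

(** T = p - z^M D with Re D = Re A + Im B and Im D = Im A - Re B. The 3 counts p itself together
    with Re A and Re B, each at most |Re p|. *)
Lemma Re_take_le x :
  `|trig_poly T x| <= 3 * `|trig_poly p x| + `|Im A.[expi x]| + `|Im B.[expi x]|.
Proof.
have dec : T.[expi x] + D.[expi x] * expi x ^+ M = p.[expi x].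
  by rewrite -[in RHS](poly_take_drop M p) hornerD hornerM hornerXn.
have c1 : `|Re (expi x ^+ M)| <= 1 by rewrite expiX /= ler_norml cos_geN1 cos_le1.
have s1 : `|Im (expi x ^+ M)| <= 1 by rewrite expiX /= ler_norml sin_geN1 sin_le1.
have a1 : `|Re A.[expi x]| <= `|trig_poly p x|.
  by rewrite Re_A normrM ler_piMl.
have b1 : `|Re B.[expi x]| <= `|trig_poly p x|.
  by rewrite Re_B normrM ler_piMl.
have cReD : Re D.[expi x] = Re A.[expi x] + Im B.[expi x].
  by rewrite {1}D_AB Re_hornerBi.
have cImD : Im D.[expi x] = Im A.[expi x] - Re B.[expi x].
  by rewrite {1}D_AB Im_hornerBi.
have -> : trig_poly T x = trig_poly p x - (Re (expi x ^+ M) * Re D.[expi x]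
    - Im (expi x ^+ M) * Im D.[expi x]).
  rewrite /trig_poly -dec; case: (T.[_]) (D.[_]) (expi x ^+ M) => [a b] [c d] [e f] /=; ring.
have n1 : `|Re (expi x ^+ M) * Re D.[expi x]| <= `|Re A.[expi x]| + `|Im B.[expi x]|.
  by rewrite cReD normrM (le_trans _ (ler_normD _ _))// ler_piMl.
have n2 : `|Im (expi x ^+ M) * Im D.[expi x]| <= `|Im A.[expi x]| + `|Re B.[expi x]|.
  by rewrite cImD normrM (le_trans _ (ler_normB _ _))// ler_piMl.
apply: (le_trans (ler_normB _ _)).
have := ler_normB (Re (expi x ^+ M) * Re D.[expi x]) (Im (expi x ^+ M) * Im D.[expi x]).
lra.
Qed.

Lemma Re_A_le x : `|trig_poly A x| <= `|trig_poly p x|.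
Proof.
by rewrite {1}/trig_poly Re_A normrM ler_piMl// expiX /= ler_norml cos_geN1 cos_le1.
Qed.

Lemma Re_B_le x : `|trig_poly B x| <= `|trig_poly p x|.
Proof.
by rewrite {1}/trig_poly Re_B normrM ler_piMl// expiX /= ler_norml sin_geN1 sin_le1.
Qed.

End truncated_high_part.

Lemma take_energy_le k : odd k -> exists2 C : R, 0 < C & forall m p,
  (energy U k.*2%:R (trig_poly (take_poly m.+1 p)) <=
   C%:E * energy U k.*2%:R (trig_poly p))%E.
Proof.
move=> ok; have [C C0 HC] := conjugate_energy_le ok.
have k0 : (0 < k)%N by case: k ok {HC}.
exists (2 `^ k.*2%:R * (2 `^ k.*2%:R * (3 `^ k.*2%:R + 2 * C) + 2 * C)).
  rewrite mulr_gt0 ?powR_gt0// ltr_wpDr ?mulr_ge0// mulr_gt0 ?powR_gt0//.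
  by rewrite ltr_wpDr ?mulr_ge0// powR_gt0.
move=> m p; apply: (energy_le_of_conjugates _ _ _ _ _ C0 k0 HC).
- exact: Re_take_le.
- exact: Re_A_le.
- exact: Re_B_le.
- exact: Im_A0.
- exact: Im_B0.
Qed.

End truncation.

(** * The Dirichlet kernel *)

Section dirichlet.
Context (R : realType).
Local Notation Re := (@complex.Re R).
Local Notation Im := (@complex.Im R).
Local Notation U := (@unit_measure R : probability (measurableTypeR R) R).

(** The index l stands for the frequency l - m, which runs from -m to m. *)
Definition dirichlet (m : nat) (t : R) : R :=
  \sum_(l < m.*2.+1) cos (2 * pi * (l%:Z - m%:Z)%:~R * t).

Definition dirichlet_kernel m : measurableTypeR R -> measurableTypeR R -> R :=
  fun x y => dirichlet m (x - y).

Lemma sum_centered (V : nmodType) m (z : int) (F : int -> V) :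
  \sum_(l < m.*2.+1) (if l%:Z - m%:Z == z then F (l%:Z - m%:Z) else 0) =
  if (`|z| <= m)%N then F z else 0.
Proof.
case: ifPn => zm; last first.
  rewrite big1// => l _; case: eqP => // lz; have := ltn_ord l; lia.
have lt : (absz (z + m%:Z)%R < m.*2.+1)%N by lia.
rewrite (bigD1 (Ordinal lt))//= big1 ?addr0.
  have -> : (absz (z + m%:Z))%:Z - m%:Z = z by lia.
  by rewrite eqxx.
move=> l /eqP ll; case: eqP => // lz; exfalso; apply: ll; apply/val_inj => /=; lia.
Qed.

Lemma cosMcos (a b : R) : cos a * cos b = 2^-1 * (cos (a + b) + cos (a - b)).
Proof. by rewrite cosD cosB; field. Qed.

(** After the product formula only the frequencies j and -j have nonzero mean. Each contributes half
    of the value, also for j = 0, where both halves come from the same term. The phase [a] serves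
    cosines and sines at once. *)
Lemma dirichlet_cos m (a x : R) (j : nat) :
  \int[U]_y (dirichlet m (x - y) * cos (a + 2 * pi * j%:R * y)) =
  if (j <= m)%N then cos (a + 2 * pi * j%:R * x) else 0.
Proof.
(* [z] is opaque, so that distributing the integer casts does not break up l - m. *)
have [z zE] : exists z : nat -> int, forall l, z l = l%:Z - m%:Z.
  by exists (fun l => l%:Z - m%:Z).
pose F1 l (y : R) := 2^-1 * cos (a + 2 * pi * (z l)%:~R * x + 2 * pi * (j%:Z - z l)%:~R * y).
pose F2 l (y : R) := 2^-1 * cos (2 * pi * (z l)%:~R * x - a + 2 * pi * (- (j%:Z) - z l)%:~R * y).
have i1 l : U.-integrable setT (EFin \o F1 l).
  exact: (integrableZl measurableT 2^-1 (integrable_cos_affine _ _)).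
have i2 l : U.-integrable setT (EFin \o F2 l).
  exact: (integrableZl measurableT 2^-1 (integrable_cos_affine _ _)).
transitivity (\int[U]_y \sum_(l < m.*2.+1) (F1 l y + F2 l y)).
  apply: eq_Rintegral => y _; rewrite /dirichlet mulr_suml; apply: eq_bigr => l _.
  rewrite -zE /F1 /F2 -mulrDr !intrD !mulrNz.
  set A := 2 * pi * (z l)%:~R * (x - y); set B := a + 2 * pi * j%:R * y.
  have -> : a + 2 * pi * (z l)%:~R * x + 2 * pi * (j%:~R - (z l)%:~R) * y = A + B.
    by rewrite /A /B; ring.
  have -> : 2 * pi * (z l)%:~R * x - a + 2 * pi * (- j%:~R - (z l)%:~R) * y = A - B.
    by rewrite /A /B; ring.
  exact: cosMcos.
rewrite Rintegral_sum; last first.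
  by move=> l; exact: (integrableD measurableT (i1 l) (i2 l)).
transitivity (\sum_(l < m.*2.+1)
  ((if z l == j%:Z then 2^-1 * cos (a + 2 * pi * (z l)%:~R * x) else 0) +
   (if z l == - j%:Z then 2^-1 * cos (2 * pi * (z l)%:~R * x - a) else 0))).
  apply: eq_bigr => l _; rewrite RintegralD//; congr (_ + _).
    rewrite /F1 RintegralZl//; last exact: integrable_cos_affine.
    rewrite Rintegral_cos_affine subr_eq0 eq_sym; case: ifP => _; last by rewrite mulr0.
    by [].
  rewrite /F2 RintegralZl//; last exact: integrable_cos_affine.
  rewrite Rintegral_cos_affine subr_eq0 eq_sym; case: ifP => _; last by rewrite mulr0.
  by [].
rewrite big_split/=; under eq_bigr do rewrite zE; under [X in _ + X]eq_bigr do rewrite zE.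
rewrite (sum_centered m j%:Z (fun l => 2^-1 * cos (a + 2 * pi * l%:~R * x))).
rewrite (sum_centered m (- j%:Z) (fun l => 2^-1 * cos (2 * pi * l%:~R * x - a))).
rewrite abszN absz_nat; case: ifP => _; last by rewrite addr0.
have -> : 2 * pi * (- j%:Z)%:~R * x - a = - (a + 2 * pi * j%:~R * x).
  by rewrite mulrNz; ring.
by rewrite cosN; field.
Qed.

Lemma dirichlet_bound m (t : R) : `|dirichlet m t| <= m.*2.+1%:R.
Proof.
apply: (le_trans (ler_norm_sum _ _ _)).
apply: (@le_trans _ _ (\sum_(l < m.*2.+1) 1)).
  by apply: ler_sum => l _; rewrite ler_norml cos_geN1 cos_le1.
by rewrite sumr_const card_ord.
Qed.

Lemma bounded_dirichlet_kernel m : bounded_kernel (dirichlet_kernel m).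
Proof.
split; last by exists m.*2.+1%:R => x y; exact: dirichlet_bound.
apply: measurable_sum => l; apply: measurable_cos_comp.
by apply: measurable_funM => //; exact: measurable_funB.
Qed.

(** The bridge from convolution to [take_poly]: frequencies up to m are kept, that is degrees below
    m + 1. *)
Lemma dirichlet_trig_poly m (p : {poly R[i]}) :
  kernel_op U (dirichlet_kernel m) (trig_poly p) = trig_poly (take_poly m.+1 p).
Proof.
apply/funext => x; rewrite /kernel_op /dirichlet_kernel.
pose n := (size p + m.+1)%N.
have s1 : (size p <= n)%N by exact: leq_addr.
have s2 : (size (take_poly m.+1 p) <= n)%N.
  by rewrite (leq_trans (size_take_poly _ _))// leq_addl.
rewrite (trig_polyE_wide _ s2).
pose F (i : nat) (y : R) := dirichlet m (x - y) *
  (Re p`_i * cos (2 * pi * i%:R * y) - Im p`_i * sin (2 * pi * i%:R * y)).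
have bK := bounded_dirichlet_kernel m.
pose G1 (i : nat) (y : R) := dirichlet m (x - y) * cos (0 + 2 * pi * i%:R * y).
pose G2 (i : nat) (y : R) := dirichlet m (x - y) * cos (- (pi / 2) + 2 * pi * i%:R * y).
have j1 i : U.-integrable setT (EFin \o G1 i).
  by apply: (integrable_kernel_mul x bK); exact: integrable_cos_affine.
have j2 i : U.-integrable setT (EFin \o G2 i).
  by apply: (integrable_kernel_mul x bK); exact: integrable_cos_affine.
have FE i y : F i y = Re p`_i * G1 i y - Im p`_i * G2 i y.
  rewrite /F /G1 /G2 add0r (addrC (- (pi / 2))) cosBpihalf; ring.
have k1 i : U.-integrable setT (EFin \o (fun y => Re p`_i * G1 i y)).
  exact: (integrableZl measurableT (Re p`_i) (j1 i)).
have k2 i : U.-integrable setT (EFin \o (fun y => Im p`_i * G2 i y)).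
  exact: (integrableZl measurableT (Im p`_i) (j2 i)).
transitivity (\int[U]_y \sum_(i < n) F i y).
  by apply: eq_Rintegral => y _; rewrite (trig_polyE_wide _ s1) mulr_sumr.
rewrite Rintegral_sum; last first.
  move=> i; rewrite (_ : F i = fun y => Re p`_i * G1 i y - Im p`_i * G2 i y).
    exact: (integrableB measurableT (k1 i) (k2 i)).
  by apply/funext => y; exact: FE.
apply: eq_bigr => i _.
transitivity (\int[U]_y (Re p`_i * G1 i y) - \int[U]_y (Im p`_i * G2 i y)).
  by under eq_Rintegral do rewrite FE; exact: RintegralB.
transitivity (Re p`_i * (if (i <= m)%N then cos (0 + 2 * pi * i%:R * x) else 0) -
    Im p`_i * (if (i <= m)%N then cos (- (pi / 2) + 2 * pi * i%:R * x) else 0)).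
  have e1 := etrans (RintegralZl (Re p`_i) measurableT (j1 i))
    (congr1 (fun z => Re p`_i * z) (dirichlet_cos m 0 x i)).
  have e2 := etrans (RintegralZl (Im p`_i) measurableT (j2 i))
    (congr1 (fun z => Im p`_i * z) (dirichlet_cos m (- (pi / 2)) x i)).
  by rewrite e1 e2.
rewrite coef_take_poly ltnS.
case: ifP => _; last by rewrite /= !mulr0 !mul0r.
by rewrite add0r (addrC (- (pi / 2))) cosBpihalf.
Qed.

End dirichlet.

(** * Limits of energies, clipping *)

Section limits.
Context (R : realType).

Lemma cvge0_near_le (I : Type) (F : set_system I) {FF : Filter F} (u : I -> \bar R) (e : R) :
  0 < e -> u @ F --> 0%E -> \forall i \near F, (u i <= e%:E)%E.
Proof.
move=> e0 /fine_cvgP[ufin /cvgrPdist_le/(_ _ e0) ue].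
near=> i; have ui : u i \is a fin_num by near: i.
rewrite -(fineK ui) lee_fin (le_trans (ler_norm _))// -normrN -sub0r.
by near: i.
Unshelve. all: by end_near. Qed.

Lemma near_le_cvge0 (I : Type) (F : set_system I) {FF : Filter F} (u : I -> \bar R) :
  (forall i, 0 <= u i)%E ->
  (forall e : R, 0 < e -> \forall i \near F, (u i <= e%:E)%E) -> u @ F --> 0%E.
Proof.
move=> u0 ue; apply/fine_cvgP; split.
  apply: filterS (ue _ ltr01) => i ui.
  by rewrite ge0_fin_numE// (le_lt_trans ui)// ltry.
apply/cvgrPdist_le => e e0; apply: filterS (ue _ e0) => i ui.
rewrite sub0r normrN /= ger0_norm ?fine_ge0// -lee_fin fineK//.
by rewrite ge0_fin_numE// (le_lt_trans ui)// ltry.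
Qed.

End limits.

Section energy_convergence.
Context d (T : measurableType d) (R : realType).
Variable mu : {measure set T -> \bar R}.

Lemma powR_cvg0_norm (u : R^nat) (q : R) : 0 < q -> u @ \oo --> 0 ->
  `|u j| `^ q @[j --> \oo] --> 0.
Proof.
move=> q0 u0; apply/cvgrPdist_le => e e0.
have e1 : 0 < e `^ q^-1 by exact: powR_gt0.
move/cvgrPdist_le : u0 => /(_ _ e1); apply: filterS => j.
rewrite !sub0r !normrN => uj; rewrite ger0_norm ?powR_ge0//.
apply: (@le_trans _ _ ((e `^ q^-1) `^ q)).
  by apply: ge0_ler_powR => //; rewrite ?nnegrE ?powR_ge0// ltW.
by rewrite -powRrM mulVf ?gt_eqF// powRr1// ltW.
Qed.

Lemma ae_imp (A B : T -> Prop) : (forall x, A x -> B x) ->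
  {ae mu, forall x, A x} -> {ae mu, forall x, B x}.
Proof. by move=> AB; apply: filterS. Qed.

Lemma energy_cvg0 (q : R) (f_ : nat -> T -> R) (g : T -> R) : 0 < q ->
  (forall j, measurable_fun setT (f_ j)) -> measurable_fun setT g ->
  (energy mu q g < +oo)%E ->
  {ae mu, forall x, f_ j x @[j --> \oo] --> 0} ->
  (forall j x, `|f_ j x| <= `|g x|) ->
  energy mu q (f_ j) @[j --> \oo] --> 0%E.
Proof.
move=> q0 mf mg goo f0 fg.
rewrite (_ : 0%E = (\int[mu]_x (cst 0 x))%E); last by rewrite integral0.
have [] // := @dominated_convergence _ _ _ mu setT measurableT
  (fun j x => (`|f_ j x| `^ q)%:E) (cst 0%E) (fun x => (`|g x| `^ q)%:E).
- by move=> j; exact: measurable_EFin_normr_powR.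
- apply: filterS f0 => x fx _; apply/fine_cvgP; split; first exact: nearW.
  exact: powR_cvg0_norm.
- apply/integrableP; split; first exact: measurable_EFin_normr_powR.
  by under eq_integral do rewrite gee0_abs ?lee_fin ?powR_ge0//.
- apply: aeW => x j _; rewrite gee0_abs ?lee_fin ?powR_ge0//.
  by apply: ge0_ler_powR; rewrite ?nnegrE// ltW.
Qed.

End energy_convergence.

Section clip.
Context (R : realType).
Implicit Types (M t : R).

(** The projection of the line onto [-M, M]; being 1-Lipschitz, it preserves continuity and does not
    increase distances. *)
Definition clip M t : R := Num.max (- M) (Num.min M t).

Lemma clip_le M t : 0 <= M -> `|clip M t| <= M.
Proof.
move=> M0; rewrite /clip ler_norml le_max lexx/= ge_max ge_min lexx orTb andbT.
by rewrite (le_trans _ M0)// oppr_le0.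
Qed.

Lemma clip_id M t : `|t| <= M -> clip M t = t.
Proof. by rewrite ler_norml => /andP[a b]; rewrite /clip min_r// max_r. Qed.

Lemma clip_lipschitz M a b : `|clip M a - clip M b| <= `|a - b|.
Proof.
rewrite /clip.
have [h1|h1] := leP M a; have [h2|h2] := leP M b; have [h3|h3] := leP (- M) M;
have [h4|h4] := leP (- M) a; have [h5|h5] := leP (- M) b;
have [h6|h6] := ler0P (a - b); rewrite ?ler_norml;
  first [apply/andP; split; lra | lra].
Qed.

Lemma clip_dist M t : 0 <= M -> `|t - clip M t| <= `|t|.
Proof.
move=> M0; rewrite /clip /Num.max /Num.min.
by case: (ltP M t); case: ifP; rewrite ?ler_norml; have [|] := ler0P t; lra.
Qed.

Lemma measurable_clip d (T : measurableType d) M (f : T -> R) :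
  measurable_fun setT f -> measurable_fun setT (fun x => clip M (f x)).
Proof. by move=> mf; apply: measurable_maxr => //; exact: measurable_minr. Qed.

Lemma continuous_clip M (f : R -> R) : continuous f -> continuous (fun x => clip M (f x)).
Proof.
move=> cf x; apply/cvgrPdist_le => e e0.
have /cvgrPdist_le/(_ _ e0) := cf x; apply: filterS => y.
by apply: le_trans; exact: clip_lipschitz.
Qed.

End clip.

(** * Density of trigonometric polynomials *)

Section fejer.
Context (R : realType).
Local Notation Re := (@complex.Re R).
Local Notation Im := (@complex.Im R).
Local Notation U := (@unit_measure R : probability (measurableTypeR R) R).

Definition sqr_norm (z : R[i]) : R := Re z ^+ 2 + Im z ^+ 2.

Lemma sqr_normM z w : sqr_norm (z * w) = sqr_norm z * sqr_norm w.
Proof. by case: z w => [a b] [c d]; rewrite /sqr_norm /=; ring. Qed.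

Lemma sqr_norm_ge0 z : 0 <= sqr_norm z.
Proof. by rewrite addr_ge0// sqr_ge0. Qed.

(** The squared-modulus form shows positivity at once and, through the geometric sum, the decay away
    from the integers; [fejerE] gives the form used for integration. *)
Definition fejer N (t : R) : R := N.+1%:R^-1 * sqr_norm (\sum_(j < N.+1) expi t ^+ j).

Lemma fejer_ge0 N t : 0 <= fejer N t.
Proof. by rewrite mulr_ge0 ?sqr_norm_ge0// invr_ge0. Qed.

Lemma fejerE N t : fejer N t = N.+1%:R^-1 * \sum_(j < N.+1) \sum_(k < N.+1)
  cos (2 * pi * (j%:Z - k%:Z)%:~R * t).
Proof.
rewrite /fejer /sqr_norm cRe_sum cIm_sum; congr (_ * _).
rewrite !expr2 !mulr_suml -big_split; apply: eq_bigr => j _ /=.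
rewrite !mulr_sumr -big_split; apply: eq_bigr => k _ /=.
rewrite !expiX /= -cosB; congr cos.
by rewrite intrD mulrNz; ring.
Qed.

(** The geometric sum times z - 1 is z^(N+1) - 1, whose squared modulus is at most 4, while |z -
    1|^2 = 2 (1 - cos (2 pi t)). *)
Lemma fejer_le N t : N.+1%:R * (1 - cos (2 * pi * t)) * fejer N t <= 2.
Proof.
have E : sqr_norm (expi t ^+ N.+1 - 1) =
    sqr_norm (expi t - 1) * sqr_norm (\sum_(j < N.+1) expi t ^+ j).
  by rewrite subrX1 sqr_normM.
have E1 : sqr_norm (expi t - 1) = 2 * (1 - cos (2 * pi * t)).
  rewrite /sqr_norm /expi /= oppr0 addr0.
  have := cos2Dsin2 (2 * pi * t); set c := cos _; set s := sin _ => H.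
  rewrite [LHS](_ : _ = (c ^+ 2 + s ^+ 2) + 1 - 2 * c); last by ring.
  by rewrite H; ring.
have E2 : sqr_norm (expi t ^+ N.+1 - 1) <= 4.
  rewrite /sqr_norm expiX /= oppr0 addr0.
  have := cos2Dsin2 (2 * pi * N.+1%:R * t); set c := cos _; set s := sin _ => H.
  rewrite [leLHS](_ : _ = (c ^+ 2 + s ^+ 2) + 1 - 2 * c); last by ring.
  by rewrite H; have := cos_geN1 (2 * pi * N.+1%:R * t); rewrite -/c; lra.
rewrite /fejer mulrACA mulfV ?pnatr_eq0// mul1r.
by move: E2; rewrite E E1; lra.
Qed.

Lemma measurable_fejer N d (T : measurableType d) (f : T -> R) :
  measurable_fun setT f -> measurable_fun setT (fun x => fejer N (f x)).
Proof.
move=> mf; under eq_fun do rewrite fejerE; apply: measurable_funM => //.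
apply: measurable_sum => j; apply: measurable_sum => k.
by apply: measurable_cos_comp; exact: measurable_funM.
Qed.

Lemma fejer_bound N t : fejer N t <= N.+1%:R.
Proof.
rewrite fejerE.
apply: (@le_trans _ _ (N.+1%:R^-1 * \sum_(j < N.+1) \sum_(k < N.+1) 1)).
  rewrite ler_wpM2l ?invr_ge0//; apply: ler_sum => j _; apply: ler_sum => k _.
  exact: cos_le1.
under eq_bigr do rewrite sumr_const card_ord.
rewrite sumr_const card_ord -[X in _ * X]mulr_natl mulrA mulVf ?mul1r//.
Qed.

Definition fejer_kernel N : measurableTypeR R -> measurableTypeR R -> R :=
  fun x y => fejer N (x - y).

Lemma bounded_fejer_kernel N : bounded_kernel (fejer_kernel N).
Proof.
split; first by apply: measurable_fejer; exact: measurable_funB.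
by exists N.+1%:R => x y; rewrite ger0_norm ?fejer_ge0// fejer_bound.
Qed.

Lemma integrable_fejer_kernel N x : U.-integrable setT (EFin \o fejer_kernel N x).
Proof.
apply: (@integrable_bounded_cst _ _ _ U _ N.+1%:R).
  exact: measurable_kernel_section (bounded_fejer_kernel N).
by move=> y; rewrite ger0_norm ?fejer_ge0// fejer_bound.
Qed.

Lemma Rintegral_fejer_kernel N x : \int[U]_y fejer_kernel N x y = 1.
Proof.
pose F (j k : 'I_N.+1) (y : R) :=
  cos (2 * pi * (j%:Z - k%:Z)%:~R * x + 2 * pi * (k%:Z - j%:Z)%:~R * y).
have intF j k : U.-integrable setT (EFin \o F j k) by exact: integrable_cos_affine.
have intFs j : U.-integrable setT (EFin \o (fun y => \sum_(k < N.+1) F j k y)).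
  have -> : (EFin \o (fun y => \sum_(k < N.+1) F j k y)) =
      (fun y => \sum_(k < N.+1) (EFin \o F j k) y)%E.
    by apply/funext => y /=; rewrite sumEFin.
  exact: integrable_sum.
have intFss : U.-integrable setT (EFin \o (fun y => \sum_(j < N.+1) \sum_(k < N.+1) F j k y)).
  have -> : (EFin \o (fun y => \sum_(j < N.+1) \sum_(k < N.+1) F j k y)) =
      (fun y => \sum_(j < N.+1) (EFin \o (fun y => (\sum_(k < N.+1) F j k y)%R)) y)%E.
    by apply/funext => y /=; rewrite sumEFin.
  exact: integrable_sum.
transitivity (\int[U]_y (N.+1%:R^-1 * \sum_(j < N.+1) \sum_(k < N.+1) F j k y)).
  apply: eq_Rintegral => y _; rewrite /fejer_kernel fejerE; congr (_ * _).
  apply: eq_bigr => j _; apply: eq_bigr => k _; rewrite /F; congr cos.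
  by rewrite !intrD !mulrNz; ring.
rewrite RintegralZl// Rintegral_sum//.
rewrite (_ : \sum_(j < N.+1) _ = \sum_(j < N.+1) 1); last first.
  apply: eq_bigr => j _; rewrite Rintegral_sum; last by move=> k; exact: intF.
  rewrite (bigD1 j)//= big1 ?addr0.
    by rewrite /F Rintegral_cos_affine subrr eqxx mulr0 mul0r cos0.
  move=> k kj; rewrite /F Rintegral_cos_affine subr_eq0.
  by case: eqP => // -[kj']; move/eqP: kj; case; exact/val_inj.
by rewrite sumr_const card_ord mulVf// pnatr_eq0.
Qed.

Definition is_trig_poly (f : R -> R) := exists p, f = trig_poly p.

Lemma is_trig_polyD f g : is_trig_poly f -> is_trig_poly g -> is_trig_poly (f \+ g).
Proof.
move=> [p ->] [q ->]; exists (p + q); apply/funext => x.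
by rewrite /trig_poly /= hornerD cReD.
Qed.

Lemma is_trig_polyZ (c : R) f : is_trig_poly f -> is_trig_poly (fun x => c * f x).
Proof.
move=> [p ->]; exists (c%:C *: p); apply/funext => x.
by rewrite /trig_poly hornerZ cReM /= mul0r subr0.
Qed.

Lemma is_trig_poly_sum (I : Type) (s : seq I) (F : I -> R -> R) :
  (forall i, is_trig_poly (F i)) -> is_trig_poly (fun x => \sum_(i <- s) F i x).
Proof.
move=> HF; elim: s => [|i s ih].
  exists 0; apply/funext => x; by rewrite big_nil /trig_poly horner0.
have -> : (fun x => \sum_(j <- i :: s) F j x) = (F i \+ (fun x => \sum_(j <- s) F j x)).
  by apply/funext => x; rewrite big_cons.
exact: is_trig_polyD.
Qed.

Lemma is_trig_poly_cos (l : int) : is_trig_poly (fun x => cos (2 * pi * l%:~R * x)).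
Proof.
case: l => n; first by exists 'X^n; apply/funext => x; rewrite /trig_poly hornerXn expiX.
exists 'X^(n.+1); apply/funext => x; rewrite /trig_poly hornerXn expiX /=.
by rewrite NegzE mulrNz mulrN mulNr cosN.
Qed.

Lemma is_trig_poly_sin (l : int) : is_trig_poly (fun x => sin (2 * pi * l%:~R * x)).
Proof.
have S n : is_trig_poly (fun x => sin (2 * pi * n%:R * x)).
  exists ((0 -i* 1) *: 'X^n); apply/funext => x.
  by rewrite /trig_poly hornerZ hornerXn expiX /= mul0r sub0r mulN1r opprK.
case: l => n; first exact: S.
have -> : (fun x : R => sin (2 * pi * (Negz n)%:~R * x)) =
    (fun x : R => (-1) * sin (2 * pi * n.+1%:R * x)).
  by apply/funext => x; rewrite NegzE mulrNz mulrN mulN1r -sinN mulNr.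
exact: is_trig_polyZ.
Qed.

(** Expanding cos (c (x - y)) separates the variables; the integrals in y become the coefficients
    [a] and [b] of a finite trigonometric sum in x. *)
Lemma fejer_op_trig_poly N (g : measurableTypeR R -> R) :
  U.-integrable setT (EFin \o g) -> is_trig_poly (kernel_op U (fejer_kernel N) g).
Proof.
move=> intg.
pose a (l : int) : R := \int[U]_y (cos (2 * pi * l%:~R * y) * g y).
pose b (l : int) : R := \int[U]_y (sin (2 * pi * l%:~R * y) * g y).
have intc (c : R) : U.-integrable setT (EFin \o (fun y => cos (c * y) * g y)).
  apply: (@integrable_bounded _ _ _ U (fun y => cos (c * y)) g 1) => //.
    by apply: measurable_cos_comp; exact: measurable_funM.
  by move=> y; rewrite ler_norml cos_geN1 cos_le1.
have ints (c : R) : U.-integrable setT (EFin \o (fun y => sin (c * y) * g y)).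
  apply: (@integrable_bounded _ _ _ U (fun y => sin (c * y)) g 1) => //.
    by apply: measurable_sin_comp; exact: measurable_funM.
  by move=> y; rewrite ler_norml sin_geN1 sin_le1.
pose F (j k : 'I_N.+1) (x y : R) :=
  cos (2 * pi * (j%:Z - k%:Z)%:~R * x) * (cos (2 * pi * (j%:Z - k%:Z)%:~R * y) * g y) +
  sin (2 * pi * (j%:Z - k%:Z)%:~R * x) * (sin (2 * pi * (j%:Z - k%:Z)%:~R * y) * g y).
have i1 (u c : R) : U.-integrable setT (EFin \o (fun y => u * (cos (c * y) * g y))).
  exact: (integrableZl measurableT u (intc c)).
have i2 (u c : R) : U.-integrable setT (EFin \o (fun y => u * (sin (c * y) * g y))).
  exact: (integrableZl measurableT u (ints c)).
have intF j k x : U.-integrable setT (EFin \o F j k x).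
  exact: (integrableD measurableT (i1 _ _) (i2 _ _)).
have intFs j x : U.-integrable setT (EFin \o (fun y => \sum_(k < N.+1) F j k x y)).
  have -> : (EFin \o (fun y => \sum_(k < N.+1) F j k x y)) =
      (fun y => \sum_(k < N.+1) (EFin \o F j k x) y)%E.
    by apply/funext => y /=; rewrite sumEFin.
  exact: integrable_sum.
have intFss x : U.-integrable setT
    (EFin \o (fun y => \sum_(j < N.+1) \sum_(k < N.+1) F j k x y)).
  have -> : (EFin \o (fun y => \sum_(j < N.+1) \sum_(k < N.+1) F j k x y)) =
      (fun y => \sum_(j < N.+1) (EFin \o (fun y => (\sum_(k < N.+1) F j k x y)%R)) y)%E.
    by apply/funext => y /=; rewrite sumEFin.
  exact: integrable_sum.
suff -> : kernel_op U (fejer_kernel N) g = (fun x : R => N.+1%:R^-1 *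
    \sum_(j < N.+1) \sum_(k < N.+1)
     (a (j%:Z - k%:Z) * cos (2 * pi * (j%:Z - k%:Z)%:~R * x) +
      b (j%:Z - k%:Z) * sin (2 * pi * (j%:Z - k%:Z)%:~R * x))).
  apply: is_trig_polyZ; apply: is_trig_poly_sum => j; apply: is_trig_poly_sum => k.
  apply: is_trig_polyD; apply: is_trig_polyZ.
    exact: is_trig_poly_cos.
  exact: is_trig_poly_sin.
apply/funext => x.
transitivity (\int[U]_y (N.+1%:R^-1 * \sum_(j < N.+1) \sum_(k < N.+1) F j k x y)).
  apply: eq_Rintegral => y _; rewrite /fejer_kernel fejerE -mulrA; congr (_ * _).
  rewrite mulr_suml; apply: eq_bigr => j _; rewrite mulr_suml; apply: eq_bigr => k _.
  by rewrite /F mulrBr cosB; ring.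
rewrite RintegralZl//; congr (_ * _); rewrite Rintegral_sum//; apply: eq_bigr => j _.
rewrite Rintegral_sum//; apply: eq_bigr => k _.
rewrite RintegralD// !RintegralZl//; congr (_ + _); exact: mulrC.
Qed.

Lemma ae_unit_measure : {ae U, forall x : R, 0 < x < 1}.
Proof.
pose D : set (measurableTypeR R) := `]0%R, 1%R[%classic.
have mD : measurable (~` D) by apply: measurableC; exact: measurable_itv.
exists (~` D); split => //.
  by rewrite /= /unit_measure /mrestr setICl measure0.
Qed.

Lemma in0pi (t : R) : 0 <= t -> t <= 2^-1 -> 2 * pi * t \in `[0, pi].
Proof.
move=> t0 th; have p0 := pi_gt0 R; have H := ler_wpM2l (ltW p0) th.
by rewrite in_itv/= !mulr_ge0 ?(ltW p0)//=; lra.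
Qed.

Lemma cos2pi_lt1 (d : R) : 0 < d -> d <= 2^-1 -> 0 < 1 - cos (2 * pi * d).
Proof.
move=> d0 dh; have p0 := pi_gt0 R.
rewrite subr_gt0 -[ltRHS](@cos0 R) ltr_cos ?mulr_gt0// ?in0pi ?(ltW d0)//.
by rewrite in_itv/= lexx ltW.
Qed.

(** Evenness reduces to t >= 0 and the reflection t -> 1 - t to t <= 1/2, where cos (2 pi t) is
    decreasing. *)
Lemma cos2pi_le (d t : R) : 0 < d -> d <= `|t| <= 1 - d ->
  cos (2 * pi * t) <= cos (2 * pi * d).
Proof.
move=> d0 /andP[dt td].
wlog t0 : t dt td / 0 <= t.
  move=> H; have [/H|/ltW t0] := leP 0 t; first exact.
  by rewrite -cosN -mulrN; apply: H; rewrite ?normrN// oppr_ge0.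
rewrite (ger0_norm t0) in dt td.
wlog th : t dt td t0 / t <= 2^-1.
  move=> H; have [/H|/ltW th] := leP t (2^-1); first exact.
  have -> : cos (2 * pi * t) = cos (2 * pi * (1 - t)).
    rewrite -cosN -(cosD2piz (- _) 1); congr cos; ring.
  by apply: H; lra.
have p0 := pi_gt0 R.
rewrite leNgt ltr_cos ?in0pi//; last 2 first.
- exact: ltW.
- exact: le_trans th.
by rewrite -leNgt ler_pM2l// mulr_gt0.
Qed.

(** Points within [d] of x contribute at most [e], the kernel having mass one. Elsewhere [fejer_le]
    bounds the kernel and the oscillation of g is at most 2 M, whence 4 M. The conditions on [d]
    keep |x - y| <= 1 - d for y in (0,1), so the other peaks of the periodic kernel, at distance 1,
    are avoided. *)
Lemma fejer_op_dist N (g : R -> R) (M x d e : R) : 0 < x < 1 ->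
  measurable_fun [set: measurableTypeR R] g ->
  (forall y, `|g y| <= M) -> 0 < d -> d <= x -> d <= 1 - x -> 0 <= e ->
  (forall y, `|x - y| < d -> `|g y - g x| <= e) ->
  `|g x - kernel_op U (fejer_kernel N) g x| <=
    e + 4 * M / (N.+1%:R * (1 - cos (2 * pi * d))).
Proof.
move=> /andP[x0 x1] mg gM d0 dx dx1 e0 ge.
have M0 : 0 <= M by rewrite (le_trans _ (gM 0)).
have c0 : 0 < 1 - cos (2 * pi * d) by apply: cos2pi_lt1 => //; lra.
set c := 4 * M / _.
have cc0 : 0 <= c by rewrite /c divr_ge0 ?mulr_ge0// ltW// mulr_gt0.
have intg : U.-integrable setT (EFin \o g) by exact: (integrable_bounded_cst _ mg gM).
have bK := bounded_fejer_kernel N.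
have intKg := @integrable_kernel_mul _ (measurableTypeR R) _ U _ g x bK intg.
have intK := integrable_fejer_kernel N x.
have intKgx : U.-integrable setT (EFin \o (fun y => g x * fejer_kernel N x y)).
  exact: (integrableZl measurableT (g x) intK).
have -> : g x - kernel_op U (fejer_kernel N) g x =
    \int[U]_y (g x * fejer_kernel N x y - fejer_kernel N x y * g y).
  by rewrite RintegralB// RintegralZl// Rintegral_fejer_kernel mulr1.
have intB : U.-integrable setT
    (EFin \o (fun y => g x * fejer_kernel N x y - fejer_kernel N x y * g y)).
  exact: (integrableB measurableT intKgx intKg).
apply: (le_trans (le_normr_Rintegral _ _)) => //.
have intc : U.-integrable setT (EFin \o (fun y : measurableTypeR R => c)).
  exact: finite_measure_integrable_cst.
have intR : U.-integrable setT (EFin \o (fun y => e * fejer_kernel N x y + c)).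
  exact: (integrableD measurableT (integrableZl measurableT e intK) intc).
have -> : e + c = \int[U]_y (e * fejer_kernel N x y + c).
  rewrite RintegralD//; last exact: (integrableZl measurableT e intK).
  rewrite RintegralZl// Rintegral_fejer_kernel mulr1 Rintegral_cst//.
  by rewrite (_ : _ setT = 1%E) ?mulr1//; exact: probability_setT.
rewrite /Rintegral fine_le//.
- by apply: integrable_fin_num => //; exact: integrable_norm intB.
- exact: integrable_fin_num intR.
apply: ae_ge0_le_integral => //.
- apply/measurable_EFinP; apply: measurableT_comp => //.
  by apply/measurable_EFinP; case/integrableP: intB.
- by move=> y _; rewrite lee_fin addr_ge0// mulr_ge0// fejer_ge0.
- by case/integrableP: intR.
apply: (ae_imp _ ae_unit_measure) => y /andP[y0 y1] _; rewrite lee_fin.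
rewrite [X in `|g x * X - _|]/fejer_kernel.
rewrite mulrC -mulrBr normrM ger0_norm ?fejer_ge0//.
have [xyd|xyd] := ltP `|x - y| d.
  by rewrite mulrC ler_wpDr// ler_wpM2r ?fejer_ge0// distrC ge.
apply: ler_wpDl; first by apply: mulr_ge0 => //; exact: fejer_ge0.
have xy1 : `|x - y| <= 1 - d by rewrite ler_norml; lra.
have gg : `|g x - g y| <= 2 * M.
  by rewrite (le_trans (ler_normB _ _))// mulr2n mulrDl mul1r lerD.
have := fejer_le N (x - y).
have cle : cos (2 * pi * (x - y)) <= cos (2 * pi * d) by apply: cos2pi_le => //; rewrite xyd.
move=> Fle.
have {}Fle : N.+1%:R * (1 - cos (2 * pi * d)) * fejer N (x - y) <= 2.
  apply: le_trans Fle; rewrite ler_wpM2r ?fejer_ge0// ler_wpM2l//; lra.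
rewrite /c ler_pdivlMr ?mulr_gt0// [leLHS]mulrC mulrA.
apply: (@le_trans _ _ (2 * (2 * M))); last by rewrite mulrA -natrM.
by rewrite ler_pM// mulr_ge0 ?fejer_ge0// ltW// mulr_gt0.
Qed.

Lemma fejer_op_cvg (g : R -> R) (M x : R) : 0 < x < 1 ->
  measurable_fun [set: measurableTypeR R] g ->
  (forall y, `|g y| <= M) -> continuous g ->
  (g x - kernel_op U (fejer_kernel j) g x) @[j --> \oo] --> 0.
Proof.
move=> x01 mg gM cg; apply/cvgrPdist_le => e e0.
have e2 : 0 < e / 2 by rewrite divr_gt0.
have /cvgrPdist_le/(_ _ e2)/nbhs_ballP[d1 /= d10 Hd1] := cg x.
pose d := Num.min d1 (Num.min x (1 - x)).
have d0 : 0 < d by case/andP: x01 => ? ?; rewrite /d !lt_min d10; lra.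
have dx : d <= x by rewrite /d !ge_min lexx orbT.
have dx1 : d <= 1 - x by rewrite /d !ge_min lexx !orbT.
have dd1 : d <= d1 by rewrite /d !ge_min lexx.
have c0 : 0 < 1 - cos (2 * pi * d) by apply: cos2pi_lt1 => //; lra.
have M0 : 0 <= M by rewrite (le_trans _ (gM 0)).
pose B := 4 * M / (1 - cos (2 * pi * d)) / (e / 2).
near=> j; rewrite sub0r normrN.
apply: (le_trans (fejer_op_dist j x01 mg gM d0 dx dx1 (ltW e2) _)).
  by move=> y xy; rewrite distrC; apply: Hd1; rewrite /ball/= (lt_le_trans xy).
rewrite [leRHS](splitr e) lerD2l invfM mulrCA mulrC -ler_pdivlMr//.
rewrite invrK -ler_pdivrMl// mulrC.
apply: (@le_trans _ _ j%:R); last by rewrite ler_nat.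
by near: j; exact: nbhs_infty_ger.
Unshelve. all: by end_near. Qed.

End fejer.

Section density.
Context (R : realType).
Local Notation U := (@unit_measure R : probability (measurableTypeR R) R).

Lemma fejer_op_bounded N (g : R -> R) (M x : R) :
  measurable_fun [set: measurableTypeR R] g -> (forall y, `|g y| <= M) ->
  `|kernel_op U (fejer_kernel N) g x| <= M.
Proof.
move=> mg gM.
have intg : U.-integrable setT (EFin \o g) by exact: (integrable_bounded_cst _ mg gM).
have intK := @integrable_fejer_kernel R N x.
have intKg := @integrable_kernel_mul _ (measurableTypeR R) _ U _ g x
  (@bounded_fejer_kernel R N) intg.
apply: (le_trans (le_normr_Rintegral _ _)) => //.
have -> : M = \int[U]_y (M * fejer_kernel N x y).
  by rewrite RintegralZl// Rintegral_fejer_kernel mulr1.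
apply: le_Rintegral => //.
- exact: (integrable_norm intKg).
- exact: (integrableZl measurableT M intK).
- by move=> y _; rewrite normrM ger0_norm ?fejer_ge0// mulrC ler_wpM2r ?fejer_ge0.
Qed.

(** Fejér means converge at every point of (0,1), and positivity with mass one keeps them within M,
    so the errors are dominated by the constant 2 M. *)
Lemma continuous_dense (g : R -> R) (M q e : R) : 0 < q -> 0 < e -> continuous g ->
  (forall y, `|g y| <= M) ->
  exists p, (energy U q (g \- trig_poly p)%R <= e%:E)%E.
Proof.
move=> q0 e0 cg gM.
have mg : measurable_fun [set: measurableTypeR R] g by exact: continuous_measurable_fun.
have M0 : 0 <= M by rewrite (le_trans _ (gM 0)).
have intg : U.-integrable setT (EFin \o g) by exact: (integrable_bounded_cst _ mg gM).
have mop j : measurable_fun [set: measurableTypeR R] (kernel_op U (fejer_kernel j) g).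
  exact: (@measurable_kernel_op _ (measurableTypeR R) _ U _ g (@bounded_fejer_kernel R j) mg).
have C : energy U q (g \- kernel_op U (fejer_kernel j) g)%R @[j --> \oo] --> 0%E.
  apply: (@energy_cvg0 _ _ _ U q (fun j => g \- kernel_op U (fejer_kernel j) g)
    (cst (2 * M))) => //.
  - by move=> j; exact: measurable_funB.
  - by rewrite energy_cst ltry.
  - apply: (ae_imp _ (@ae_unit_measure R)) => x x01; exact: (fejer_op_cvg x01 mg gM cg).
  - move=> j x /=; rewrite [leRHS]ger0_norm ?mulr_ge0//.
    rewrite (le_trans (ler_normB _ _))// mulr2n mulrDl mul1r lerD//.
    exact: fejer_op_bounded.
have /fine_cvgP[Cfin /cvgrPdist_le/(_ _ e0) C'] := C.
have [j [jfin je]] : exists j, energy U q (g \- kernel_op U (fejer_kernel j) g)%R \is a fin_num /\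
    `|0 - fine (energy U q (g \- kernel_op U (fejer_kernel j) g)%R)| <= e.
  have [n _ H] : \forall j \near \oo,
      energy U q (g \- kernel_op U (fejer_kernel j) g)%R \is a fin_num /\
      `|0 - fine (energy U q (g \- kernel_op U (fejer_kernel j) g)%R)| <= e.
    by near=> j; split; near: j.
  by exists n; apply: H => /=.
have [p pE] := fejer_op_trig_poly j intg.
exists p; rewrite -pE -(fineK jfin) lee_fin (le_trans _ je)//.
by rewrite sub0r normrN ler_norm.
Unshelve. all: by end_near. Qed.

Lemma energy_approx_trans q (f g h : measurableTypeR R -> R) (a b : R) : 0 <= q ->
  measurable_fun setT f -> measurable_fun setT g -> measurable_fun setT h ->
  (energy U q (f \- g)%R <= a%:E)%E -> (energy U q (g \- h)%R <= b%:E)%E ->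
  (energy U q (f \- h)%R <= (2 `^ q * (a + b))%:E)%E.
Proof.
move=> q0 mf mg mh fg gh.
have -> : (f \- h)%R = ((f \- g) \+ (g \- h))%R by apply/funext => x /=; rewrite addrA subrK.
apply: (le_trans (energyD _ q0 _ _)); [exact: measurable_funB..|].
by rewrite EFinM EFinD; apply: lee_wpmul2l; rewrite ?lee_fin ?powR_ge0//; exact: leeD.
Qed.

(** Continuous functions approximate f in L_1. Clipping them at M brings them no farther from f, and
    |f - g|^q <= (2 M)^(q-1) |f - g| then passes from L_1 to L_q. *)
Lemma bounded_dense (f : measurableTypeR R -> R) (M q e : R) : 1 <= q -> 0 < e ->
  measurable_fun setT f -> (forall y, `|f y| <= M) ->
  exists p, (energy U q (f \- trig_poly p)%R <= e%:E)%E.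
Proof.
move=> q1 e0 mf fM; have q0 : 0 < q by exact: lt_le_trans q1.
have M0 : 0 <= M by rewrite (le_trans _ (fM 0)).
pose D : set (measurableTypeR R) := `]0%R, 1%R[%classic.
have mD : measurable D by exact: measurable_itv.
have muD : (@lebesgue_measure R D < +oo)%E.
  by rewrite lebesgue_measure_itv/= lte_fin ltr01 -EFinD ltry.
have intf : lebesgue_measure.-integrable D (EFin \o f).
  apply: (@measurable_bounded_integrable _ _ _ _ _ D) => //.
    exact: measurable_funTS.
  by exists M; split; first exact: num_real; move=> x Mx y _; exact: (le_trans (fM y) (ltW Mx)).
have [g_ [cg intg gf]] := approximation_continuous_integrable mD muD intf.
pose c := 2 `^ q * 2; have c0 : 0 < c by rewrite mulr_gt0// powR_gt0.
pose e' := e / c; have e'0 : 0 < e' by rewrite divr_gt0.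
(* The summand 1 makes [K] positive even if M = 0. *)
pose K := (2 * M) `^ (q - 1) + 1; have K0 : 0 < K by rewrite ltr_wpDl// powR_ge0.
have e'K : 0 < e' / K by rewrite divr_gt0.
have [j gj] := filter_ex (cvge0_near_le e'K gf).
pose g x := clip M (g_ j x).
have ccg : continuous g by exact: continuous_clip.
have mg : measurable_fun [set: measurableTypeR R] g by exact: continuous_measurable_fun.
have gM y : `|g y| <= M by exact: clip_le.
have fg : (energy U q (f \- g)%R <= e'%:E)%E.
  rewrite /energy integral_unit_measure//; last first.
    apply: (@measurable_EFin_normr_powR _ (measurableTypeR R) R (f \- g)).
    exact: measurable_funB.
  apply: (@le_trans _ _ (\int[lebesgue_measure]_(x in D) (K%:E * `|(f x - g_ j x)%:E|))%E).
    have mfg : measurable_fun D (fun x => f x - g_ j x).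
      apply: measurable_funB; first exact: measurable_funTS.
      by apply/measurable_EFinP; case/integrableP: (intg j).
    apply: ge0_le_integral => //.
    - apply: measurable_funTS.
      apply: (@measurable_EFin_normr_powR _ (measurableTypeR R) R (f \- g)).
      exact: measurable_funB.
    - apply: emeasurable_funM => //; apply/measurable_EFinP; exact: measurableT_comp.
    move=> x _; rewrite -EFinM lee_fin /=.
    have le1 : `|f x - g x| <= `|f x - g_ j x|.
      by rewrite -{1}(clip_id (fM x)); exact: clip_lipschitz.
    have le2 : `|f x - g x| <= 2 * M.
      by rewrite (le_trans (ler_normB _ _))// mulr2n mulrDl mul1r lerD.
    rewrite -(mulr_powRB1 (normr_ge0 _) q0) mulrC ler_pM ?powR_ge0//.
    apply: (@le_trans _ _ ((2 * M) `^ (q - 1))); last by rewrite /K lerDl.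
    by apply: ge0_ler_powR => //; rewrite ?nnegrE ?mulr_ge0// subr_ge0.
  rewrite ge0_integralZl//; last 2 first.
  - apply/measurable_EFinP; apply: measurableT_comp => //.
    apply: measurable_funB; first exact: measurable_funTS.
    by apply/measurable_EFinP; case/integrableP: (intg j).
  - by rewrite lee_fin ltW.
  apply: (@le_trans _ _ (K%:E * (e' / K)%:E)%E).
    by apply: lee_wpmul2l => //; rewrite lee_fin ltW.
  by rewrite -EFinM lee_fin mulrC divfK// gt_eqF.
have [p pE] := continuous_dense q0 e'0 ccg gM.
exists p; apply: (le_trans (energy_approx_trans (ltW q0) mf mg _ fg pE)).
  exact: measurable_trig_poly.
rewrite lee_fin (_ : e' + e' = 2 * e'); last by rewrite mulr2n mulrDl mul1r.
by rewrite mulrA -/c /e' mulrC divfK// gt_eqF.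
Qed.

Lemma trig_poly_dense (f : measurableTypeR R -> R) (q e : R) : 1 <= q -> 0 < e ->
  measurable_fun setT f -> (energy U q f < +oo)%E ->
  exists p, (energy U q (f \- trig_poly p)%R <= e%:E)%E.
Proof.
move=> q1 e0 mf foo; have q0 : 0 < q by exact: lt_le_trans q1.
pose f_ (n : nat) (x : measurableTypeR R) := clip n%:R (f x).
have mf_ n : measurable_fun setT (f_ n) by exact: measurable_clip.
pose c := 2 `^ q * 2; have c0 : 0 < c by rewrite mulr_gt0// powR_gt0.
pose e' := e / c; have e'0 : 0 < e' by rewrite divr_gt0.
have C : energy U q (f \- f_ n)%R @[n --> \oo] --> 0%E.
  apply: (energy_cvg0 (g := f)) => //.
  - by move=> n; exact: measurable_funB.
  - apply: aeW => x; apply/cvgrPdist_le => d d0; near=> n.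
    rewrite /= /f_ clip_id ?subrr ?subr0 ?normr0 ?ltW//.
    by near: n; exact: nbhs_infty_gtr.
  - by move=> n x; exact: clip_dist.
have [n fn] := filter_ex (cvge0_near_le e'0 C).
have [p pE] := bounded_dense q1 e'0 (mf_ n) (fun y => clip_le (f y) (ler0n _ n)).
exists p; apply: (le_trans (energy_approx_trans (ltW q0) mf (mf_ n) _ fn pE)).
  exact: measurable_trig_poly.
rewrite lee_fin (_ : e' + e' = 2 * e'); last by rewrite mulr2n mulrDl mul1r.
by rewrite mulrA -/c /e' mulrC divfK// gt_eqF.
Unshelve. all: by end_near. Qed.

End density.

(** * Kernel operator bounds from a dense class *)

Section kernel_bounds.
Context d (T : measurableType d) (R : realType).
Variable P : probability T R.
Implicit Types (K : T -> T -> R) (f g : T -> R).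

Lemma kernel_op_le K M f x : bounded_kernel K -> (forall x y, `|K x y| <= M) ->
  P.-integrable setT (EFin \o f) ->
  `|kernel_op P K f x| <= M * \int[P]_y `|f y|.
Proof.
move=> bK KM intf; have intKf := integrable_kernel_mul x bK intf.
apply: (le_trans (le_normr_Rintegral _ _)) => //.
rewrite -RintegralZl//; last exact: (integrable_norm intf).
apply: le_Rintegral => //.
- exact: (integrable_norm intKf).
- exact: (integrableZl measurableT M (integrable_norm intf)).
- by move=> y _; rewrite normrM ler_wpM2r.
Qed.

Lemma kernel_opZ K f (c : R) : bounded_kernel K ->
  P.-integrable setT (EFin \o f) ->
  kernel_op P K (fun y => c * f y) = (fun x => c * kernel_op P K f x).
Proof.
move=> bK intf; apply/funext => x; rewrite /kernel_op -RintegralZl//.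
  by apply: eq_Rintegral => y _; rewrite mulrCA.
exact: integrable_kernel_mul.
Qed.

Lemma energyZ q (c : R) f : measurable_fun setT f ->
  energy P q (fun x => c * f x) = ((`|c| `^ q)%:E * energy P q f)%E.
Proof.
move=> mf; rewrite /energy -ge0_integralZl//; last exact: measurable_EFin_normr_powR.
by apply: eq_integral => x _; rewrite normrM powRM// EFinM.
Qed.

Lemma op_bounded_crude q K M : 1 <= q -> 0 < M -> bounded_kernel K ->
  (forall x y, `|K x y| <= M) -> op_bounded P q (M `^ q) K.
Proof.
move=> q1 M0 bK KM f mf; have q0 : 0 < q by exact: lt_le_trans q1.
have [foo|] := ltP (energy P q f) +oo%E; last first.
  by rewrite leye_eq => /eqP ->; rewrite gt0_muley ?leey// lte_fin powR_gt0.
have intf := energy_integrable q1 mf foo.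
pose I := \int[P]_y `|f y|.
have I0 : 0 <= I by exact: Rintegral_ge0.
apply: (@le_trans _ _ (energy P q (fun=> M * I))).
  apply: le_energy => //; [exact: measurable_kernel_op|exact: ltW|].
  move=> x /=; rewrite [leRHS]ger0_norm ?mulr_ge0 ?(ltW M0)//.
  exact: kernel_op_le.
rewrite energy_cst ger0_norm ?mulr_ge0 ?(ltW M0)// powRM ?(ltW M0)// EFinM.
apply: lee_wpmul2l; first by rewrite lee_fin powR_ge0.
have nE : energy P q (fun x => `|f x|) = energy P q f.
  by apply: eq_integral => x _ /=; rewrite normr_id.
have := @jensen_energy _ _ _ P q _ q1 (measurableT_comp (@normr_measurable R setT) mf).
by rewrite nE [X in X `^ q](_ : _ = I)// ger0_norm.
Qed.

(* The bound M absorbs the approximation error and does not enter the constant. *)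
Lemma op_bounded_dense q K M C (D : (T -> R) -> Prop) : 1 <= q -> 0 < C -> 0 < M ->
  bounded_kernel K -> (forall x y, `|K x y| <= M) ->
  (forall p, D p -> measurable_fun setT p) ->
  (forall p, D p -> energy P q (kernel_op P K p) <= C%:E * energy P q p)%E ->
  (forall f e, 0 < e -> measurable_fun setT f -> (energy P q f < +oo)%E ->
     exists2 p, D p & (energy P q (f \- p)%R <= e%:E)%E) ->
  op_bounded P q (2 `^ q * C * 2 `^ q) K.
Proof.
move=> q1 C0 M0 bK KM mD DC dense f mf; have q0 : 0 < q by exact: lt_le_trans q1.
have c0 : 0 < 2 `^ q :> R by exact: powR_gt0.
have [foo|] := ltP (energy P q f) +oo%E; last first.
  by rewrite leye_eq => /eqP ->; rewrite gt0_muley ?leey// lte_fin !mulr_gt0.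
have intf := energy_integrable q1 mf foo.
apply/lee_addgt0Pr => e e0.
(* The total factor of the approximation error in the bound for K f = K p + K (f - p); an error e /
   L therefore adds exactly e. *)
pose L := 2 `^ q * (C * 2 `^ q + M `^ q).
have L0 : 0 < L by rewrite mulr_gt0// addr_gt0 ?powR_gt0// mulr_gt0.
have eL : 0 < e / L by rewrite divr_gt0.
have [p Dp fp] := dense f _ eL mf foo.
have mp := mD _ Dp.
have foo' : (energy P q (f \- p)%R < +oo)%E by rewrite (le_lt_trans fp)// ltry.
have mfp : measurable_fun setT (f \- p)%R by exact: measurable_funB.
have intfp := energy_integrable q1 mfp foo'.
have poo : (energy P q p <= (2 `^ q)%:E * (energy P q f + (e / L)%:E))%E.
  rewrite (_ : p = f \- (f \- p)); last by apply/funext => x /=; rewrite opprB addrC subrK.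
  apply: (le_trans (energyB _ (ltW q0) mf mfp)).
  by apply: lee_wpmul2l; [rewrite lee_fin ltW|exact: leeD2l].
have intp : P.-integrable setT (EFin \o p).
  apply: (energy_integrable q1 mp); apply: (le_lt_trans poo).
  apply: lte_mul_pinfty; [by rewrite lee_fin ltW|by []|].
  by apply: lte_add_pinfty; [exact: foo|exact: ltry].
have dec : kernel_op P K f = kernel_op P K p \+ kernel_op P K (f \- p).
  apply/funext => x /=; rewrite kernel_opB//; ring.
have F0 := energy_ge0 P q f.
rewrite dec; apply: (le_trans (energyD _ (ltW q0) _ _)).
- exact: measurable_kernel_op.
- exact: measurable_kernel_op.
apply: (@le_trans _ _ ((2 `^ q)%:E * (C%:E * ((2 `^ q)%:E * (energy P q f + (e / L)%:E))
    + (M `^ q)%:E * (e / L)%:E))%E).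
  apply: lee_wpmul2l; first by rewrite lee_fin ltW.
  apply: leeD.
    by apply: (le_trans (DC _ Dp)); apply: lee_wpmul2l; rewrite ?lee_fin ?(ltW C0).
  apply: (le_trans (op_bounded_crude q1 M0 bK KM mfp)).
  by apply: lee_wpmul2l; rewrite // lee_fin powR_ge0.
have Ff : energy P q f \is a fin_num by rewrite (ge0_fin_numE F0); exact: foo.
rewrite -(fineK Ff) -!(EFinM, EFinD) lee_fin.
set F := fine _.
rewrite [leLHS](_ : _ = 2 `^ q * C * 2 `^ q * F + L * (e / L)); last by rewrite /L; ring.
by rewrite lerD2l mulrC divfK// gt_eqF.
Qed.

End kernel_bounds.

(** * Marcinkiewicz interpolation *)

Section geometric.
Context (R : realType).

Lemma powR_expn (a x : R) j : 0 <= a -> (a ^+ j) `^ x = (a `^ x) ^+ j.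
Proof.
move=> a0; elim: j => [|j ih]; first by rewrite !expr0 powR1.
by rewrite !exprS powRM ?exprn_ge0// ih.
Qed.

Lemma powR2_gt1 (x : R) : 0 < x -> 1 < 2 `^ x.
Proof. by move=> x0; rewrite /powR pnatr_eq0/= expR_gt1 mulr_gt0// ln_gt0// ltr1n. Qed.

(** If 2^J is the largest power below s, the sum is comparable to its last term (2^J)^x, which is
    below s^x. *)
Lemma geometric_below (x s : R) J : 0 < x -> 0 <= s ->
  \sum_(j < J) (2 `^ x) ^+ j * (2 ^+ j < s)%R%:R <= 2 `^ x / (2 `^ x - 1) * s `^ x.
Proof.
move=> x0 s0; set a := 2 `^ x.
have a1 : 1 < a.
  exact: powR2_gt1.
have c0 : 0 <= a / (a - 1) by rewrite divr_ge0 ?subr_ge0 ?ltW// (lt_trans _ a1).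
elim: J => [|J ih]; first by rewrite big_ord0 mulr_ge0// powR_ge0.
have [Js|] := ltP (2 ^+ J) s; last first.
  by move=> h; rewrite big_ord_recr/= ltNge h mulr0 addr0.
apply: (@le_trans _ _ (\sum_(j < J.+1) a ^+ j)).
  apply: ler_sum => j _; rewrite ler_piMr ?exprn_ge0//; last by case: (_ < _).
  by rewrite ltW// (lt_trans _ a1).
have -> : \sum_(j < J.+1) a ^+ j = (a ^+ J.+1 - 1) / (a - 1).
  by rewrite subrX1 mulrAC divff ?mul1r// subr_eq0 gt_eqF.
apply: (@le_trans _ _ (a ^+ J.+1 / (a - 1))).
  by rewrite ler_wpM2r ?invr_ge0 ?subr_ge0 ?(ltW a1)// gerBl.
rewrite exprS mulrAC ler_wpM2l// -powR_expn//.
by apply: ge0_ler_powR => //; rewrite ?nnegrE ?exprn_ge0// ltW.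
Qed.

Lemma geometric_above (x s : R) J : 0 < x -> 0 <= s ->
  \sum_(j < J) (2 `^ (- x)) ^+ j * (s <= 2 ^+ j)%R%:R * s `^ x <= (1 - 2 `^ (- x))^-1.
Proof.
move=> x0; set b := 2 `^ (- x).
have b0 : 0 < b by exact: powR_gt0.
have b1 : b < 1.
  rewrite /b powRN invf_lt1 ?powR_gt0//.
  exact: powR2_gt1.
have c0 : 0 <= (1 - b)^-1 by rewrite invr_ge0 subr_ge0 ltW.
elim: J s => [|J ih] s s0; first by rewrite big_ord0.
have [s1|s1] := leP s 1.
  apply: (@le_trans _ _ (\sum_(j < J.+1) b ^+ j)).
    apply: ler_sum => j _; rewrite -mulrA ler_piMr ?exprn_ge0 ?(ltW b0)//.
    case: (s <= 2 ^+ j); rewrite ?mul0r ?mul1r//.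
    rewrite [leRHS](_ : 1 = 1 `^ x); last by rewrite powR1.
    by apply: ge0_ler_powR => //; rewrite ?nnegrE// ltW.
  have -> : \sum_(j < J.+1) b ^+ j = (1 - b ^+ J.+1) / (1 - b).
    rewrite -opprB subrX1 -mulNr opprB mulrAC divff ?mul1r//.
    by rewrite subr_eq0 eq_sym lt_eqF.
  by rewrite ler_piMl// gerBl exprn_ge0// ltW.
(* As s > 1, the term j = 0 vanishes; shifting the index amounts to replacing s by s / 2, and 2^(-x)
   s^x = (s / 2)^x. *)
rewrite big_ord_recl/= !expr0 (leNgt s) s1/= mulr0 mul0r add0r.
apply: le_trans (ih (s / 2) _); last by rewrite divr_ge0.
apply: ler_sum => j _.
rewrite /bump/= add1n !exprS ler_pdivrMr// [2 * _]mulrC.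
rewrite {1}(_ : s = 2 * (s / 2)); last by rewrite mulrC divfK.
rewrite (_ : (2 * (s / 2)) = s); last by rewrite mulrC divfK.
have -> : s `^ x = 2 `^ x * (s / 2) `^ x.
  by rewrite -powRM ?divr_ge0// mulrC divfK.
have bx : b * 2 `^ x = 1 by rewrite /b powRN mulVf// gt_eqF// powR_gt0.
rewrite [leLHS](_ : _ = (b * 2 `^ x) * (b ^+ j * (s <= 2 ^+ j * 2)%R%:R * (s / 2) `^ x)).
  by rewrite bx mul1r.
ring.
Qed.

End geometric.

Section marcinkiewicz.
Context d (T : measurableType d) (R : realType).
Variable P : probability T R.
Implicit Types (K : T -> T -> R) (f g : T -> R).
Variables (p r C2 Cr : R).
Hypotheses (p2 : 2 < p) (pr : p < r) (C20 : 0 < C2) (Cr0 : 0 < Cr).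

(** For energy of f at most 1: 2^p accounts for the values of |Kf| up to 2, and the two geometric
    series sum the dyadic levels, with exponent 2 for the large values of f and r for the small
    ones. *)
Definition marcinkiewicz_constant : R :=
  2 `^ p + 4 `^ p * (C2 * (2 `^ (p - 2) / (2 `^ (p - 2) - 1)) +
    Cr * (1 - 2 `^ (- (r - p)))^-1).

Let p0 : 0 < p. Proof. exact: lt_trans p2. Qed.
Let r0 : 0 < r. Proof. exact: lt_trans pr. Qed.

Lemma marcinkiewicz_tail_ge0 : 0 <= 4 `^ p * (C2 * (2 `^ (p - 2) / (2 `^ (p - 2) - 1)) +
    Cr * (1 - 2 `^ (- (r - p)))^-1).
Proof.
rewrite mulr_ge0 ?powR_ge0// addr_ge0// mulr_ge0 ?(ltW C20) ?(ltW Cr0)//.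
  by rewrite divr_ge0 ?powR_ge0// subr_ge0 ltW// powR2_gt1// subr_gt0.
rewrite invr_ge0 subr_ge0 powRN invf_le1 ?powR_gt0// ltW// powR2_gt1//.
by rewrite subr_gt0.
Qed.

Lemma marcinkiewicz_constant_gt0 : 0 < marcinkiewicz_constant.
Proof. by rewrite ltr_wpDr ?powR_gt0// marcinkiewicz_tail_ge0. Qed.

Definition high_part (t : R) f x := f x * (t < `|f x|)%R%:R.
Definition low_part (t : R) f x := f x * (`|f x| <= t)%R%:R.

Lemma measurable_lt_indicator (t : R) f : measurable_fun setT f ->
  measurable_fun setT (fun x => (t < `|f x|)%R%:R : R).
Proof.
move=> mf.
rewrite (_ : (fun x => _) = \1_((fun x => `|f x|) @^-1` `]t, +oo[%classic)); last first.
  apply/funext => x; rewrite indicE; congr ((nat_of_bool _)%:R).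
  by apply/idP/idP => [h|/set_mem]; [apply/mem_set|]; rewrite /= in_itv/= andbT.
apply: measurable_indic; rewrite -[X in measurable X]setTI.
by apply: measurableT_comp => //; exact: measurable_itv.
Qed.

Lemma measurable_high_part (t : R) f : measurable_fun setT f ->
  measurable_fun setT (high_part t f).
Proof.
by move=> mf; apply: measurable_funM => //; exact: measurable_lt_indicator.
Qed.

Lemma low_partE t f : low_part t f = f \- high_part t f.
Proof.
apply/funext => x; rewrite /low_part /high_part /= leNgt.
by case: (t < _); rewrite ?mulr0 ?mulr1 ?subrr ?subr0.
Qed.

Lemma measurable_low_part (t : R) f : measurable_fun setT f ->
  measurable_fun setT (low_part t f).
Proof.
by move=> mf; rewrite low_partE; apply: measurable_funB => //; exact: measurable_high_part.
Qed.

Lemma high_part_le t f x : `|high_part t f x| <= `|f x|.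
Proof. by rewrite normrM ler_piMr//; case: (t < _); rewrite ?normr1 ?normr0. Qed.

Lemma low_part_le t f x : `|low_part t f x| <= `|f x|.
Proof. by rewrite normrM ler_piMr//; case: (_ <= t); rewrite ?normr1 ?normr0. Qed.

(* Discrete layer-cake formula; finitely many levels suffice below as the operators
   have bounded kernels. *)
Lemma dyadic_le (s : R) J : 0 <= s -> s <= 2 * 2 ^+ J ->
  s `^ p <= 2 `^ p + \sum_(j < J) 4 `^ p * (2 `^ p) ^+ j * (2 * 2 ^+ j < s)%R%:R.
Proof.
move=> s0; elim: J => [|J ih] sJ.
  rewrite big_ord0 addr0; apply: ge0_ler_powR => //; rewrite ?nnegrE ?(ltW p0)//.
  by rewrite expr0 mulr1 in sJ.
rewrite big_ord_recr/=; have [Js|] := ltP (2 * 2 ^+ J) s; last first.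
  by move=> h; rewrite mulr0 addr0 ih.
(* Here s <= 2 * 2^(J+1) = 4 * 2^J, so the last level alone dominates s^p. *)
rewrite mulr1; apply: (@le_trans _ _ (4 `^ p * (2 `^ p) ^+ J)); last first.
  by rewrite addrA lerDr addr_ge0 ?powR_ge0// sumr_ge0.
rewrite -powR_expn// -powRM ?exprn_ge0//.
apply: ge0_ler_powR => //; rewrite ?nnegrE ?(ltW p0) ?mulr_ge0 ?exprn_ge0//.
by rewrite (le_trans sJ)// exprS mulrA ler_wpM2r ?exprn_ge0// -natrM.
Qed.

(** A pointwise Chebyshev inequality: |u + v| > 2 t forces |u| >= t or |v| >= t, and each summand is
    measured with its own exponent. *)
Lemma indicator_split (t u v : R) : 0 < t ->
  (2 * t < `|u + v|)%R%:R <= `|u| `^ 2 / t `^ 2 + `|v| `^ r / t `^ r.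
Proof.
move=> t0; case: ltP => [H|_]; last first.
  by rewrite addr_ge0// divr_ge0 ?powR_ge0.
have [tu|ut] := leP t `|u|.
  rewrite ler_wpDr ?divr_ge0 ?powR_ge0// ler_pdivlMr ?powR_gt0// mul1r.
  by apply: ge0_ler_powR => //; rewrite ?nnegrE// ltW.
have tv : t <= `|v|.
  by have := ler_normD u v; lra.
rewrite ler_wpDl ?divr_ge0 ?powR_ge0// ler_pdivlMr ?powR_gt0// mul1r.
by apply: ge0_ler_powR => //; rewrite ?nnegrE// ltW.
Qed.

Lemma energy_combination (q1 q2 c u v : R) f g : 0 <= c -> 0 <= u -> 0 <= v ->
  measurable_fun setT f -> measurable_fun setT g ->
  (\int[P]_x (c * (u * `|f x| `^ q1 + v * `|g x| `^ q2))%:E =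
   c%:E * (u%:E * energy P q1 f + v%:E * energy P q2 g))%E.
Proof.
move=> c0 u0 v0 mf mg.
have mf' := measurable_EFin_normr_powR q1 mf.
have mg' := measurable_EFin_normr_powR q2 mg.
rewrite /energy -!ge0_integralZl// -ge0_integralD//; last 4 first.
- by move=> x _; rewrite -EFinM lee_fin mulr_ge0 ?powR_ge0.
- exact: emeasurable_funM.
- by move=> x _; rewrite -EFinM lee_fin mulr_ge0 ?powR_ge0.
- exact: emeasurable_funM.
rewrite -ge0_integralZl//.
- by apply: emeasurable_funD; exact: emeasurable_funM.
- by move=> x _; rewrite -!EFinM -EFinD lee_fin addr_ge0// mulr_ge0 ?powR_ge0.
Qed.

(** At level 2 * 2^j of |Kf|, f is cut at height 2^j; the high part is estimated by the bound for 2
    and the low part by the bound for r. Summed over j at fixed x, the weights restore |f x|^p,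
    since p > 2 makes the high sum geometric and p < r the low one. *)
Lemma marcinkiewicz_normalized K M f : bounded_kernel K -> 0 < M ->
  (forall x y, `|K x y| <= M) ->
  op_bounded P 2 C2 K -> op_bounded P r Cr K ->
  measurable_fun setT f -> (energy P p f <= 1)%E ->
  (energy P p (kernel_op P K f) <= marcinkiewicz_constant%:E)%E.
Proof.
move=> bK M0 KM B2 Br mf f1.
have p1 : 1 <= p by rewrite (le_trans _ (ltW p2))// ler1n.
have foo : (energy P p f < +oo)%E by rewrite (le_lt_trans f1)// ltry.
have intf := energy_integrable p1 mf foo.
have mg : measurable_fun setT (kernel_op P K f) by exact: measurable_kernel_op.
pose B := M * \int[P]_y `|f y|.
have [J JB] : exists J, B <= 2 * 2 ^+ J.
  have [n Bn] : exists n, B <= n%:R.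
    by exists (Num.bound `|B|); rewrite (le_trans (ler_norm _))// ltW// archi_boundP.
  exists n; apply: (le_trans Bn); rewrite -exprS -natrX ler_nat.
  by rewrite (leq_trans (ltnW (ltn_expl n (ltnSn 1))))// leq_exp2l.
have gB x : `|kernel_op P K f x| <= 2 * 2 ^+ J.
  by apply: le_trans JB; exact: kernel_op_le.
pose a := 2 `^ (p - 2) : R; pose b := 2 `^ (- (r - p)) : R.
pose hi j := high_part (2 ^+ j) f; pose lo j := low_part (2 ^+ j) f.
have mhi j : measurable_fun setT (hi j) by exact: measurable_high_part.
have mlo j : measurable_fun setT (lo j) by exact: measurable_low_part.
have inthi j : P.-integrable setT (EFin \o hi j).
  apply: (le_integrable _ _ _ intf) => //; first exact/measurable_EFinP.
  by move=> x _; rewrite lee_fin high_part_le.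
have intlo j : P.-integrable setT (EFin \o lo j).
  apply: (le_integrable _ _ _ intf) => //; first exact/measurable_EFinP.
  by move=> x _; rewrite lee_fin low_part_le.
have split_op j x : kernel_op P K f x = kernel_op P K (hi j) x + kernel_op P K (lo j) x.
  rewrite /lo low_partE kernel_opB//; last exact: inthi.
  by rewrite addrC subrK.
(* The layer-cake weight 2^(pj) divided by the Chebyshev denominator 2^(2j); likewise with 2^(rj) in
   [wb]. *)
have wa j : (2 `^ p) ^+ j / (2 ^+ j) `^ 2 = a ^+ j :> R.
  rewrite powR_expn// -expr_div_n; congr (_ ^+ _).
  by rewrite /a powRB// pnatr_eq0 implybT.
have wb j : (2 `^ p) ^+ j / (2 ^+ j) `^ r = b ^+ j :> R.
  rewrite powR_expn// -expr_div_n; congr (_ ^+ _).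
  by rewrite /b opprB powRB// pnatr_eq0 implybT.
have a0 : 0 <= a by exact: powR_ge0.
have b0 : 0 <= b by exact: powR_ge0.
have e40 : 0 <= 4 `^ p :> R by exact: powR_ge0.
have powhi j x : `|hi j x| `^ 2 = (2 ^+ j < `|f x|)%R%:R * `|f x| `^ 2.
  rewrite /hi /high_part; case: (_ < _); rewrite ?mulr1 ?mulr0 ?mul1r ?mul0r ?normr0//.
  by rewrite powR0// pnatr_eq0.
have powlo j x : `|lo j x| `^ r = (`|f x| <= 2 ^+ j)%R%:R * `|f x| `^ r.
  rewrite /lo /low_part; case: (_ <= _); rewrite ?mulr1 ?mulr0 ?mul1r ?mul0r ?normr0//.
  by rewrite powR0// gt_eqF.
pose G j x := 4 `^ p * (a ^+ j * `|kernel_op P K (hi j) x| `^ 2 +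
    b ^+ j * `|kernel_op P K (lo j) x| `^ r).
have G0 j x : 0 <= G j x.
  by rewrite mulr_ge0// addr_ge0// mulr_ge0 ?exprn_ge0 ?powR_ge0.
have ptw x : `|kernel_op P K f x| `^ p <= 2 `^ p + \sum_(j < J) G j x.
  apply: (le_trans (dyadic_le (normr_ge0 _) (gB x))); rewrite lerD2l.
  apply: ler_sum => j _; rewrite /G -mulrA ler_wpM2l//.
  rewrite (split_op j) -wa -wb -!mulrA -mulrDr ler_wpM2l ?exprn_ge0 ?powR_ge0//.
  rewrite ![_^-1 * _]mulrC; apply: indicator_split.
  by rewrite exprn_gt0.
have mG j : measurable_fun setT (G j).
  apply: measurable_funM => //; apply: measurable_funD; apply: measurable_funM => //.
    by apply: measurable_normr_powR; exact: measurable_kernel_op.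
  by apply: measurable_normr_powR; exact: measurable_kernel_op.
pose H j x := 4 `^ p * (C2 * a ^+ j * `|hi j x| `^ 2 + Cr * b ^+ j * `|lo j x| `^ r).
have H0 j x : 0 <= H j x.
  rewrite mulr_ge0// addr_ge0// mulr_ge0 ?powR_ge0//.
    by rewrite mulr_ge0 ?exprn_ge0// ltW.
  by rewrite mulr_ge0 ?exprn_ge0// ltW.
have mH j : measurable_fun setT (H j).
  apply: measurable_funM => //; apply: measurable_funD; apply: measurable_funM => //.
    exact: measurable_normr_powR.
  exact: measurable_normr_powR.
(* The operator bounds enter here, level by level. *)
have IG j : (\int[P]_x (G j x)%:E <= \int[P]_x (H j x)%:E)%E.
  have aj0 : 0 <= a ^+ j by rewrite exprn_ge0.
  have bj0 : 0 <= b ^+ j by rewrite exprn_ge0.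
  rewrite !energy_combination ?mulr_ge0 ?(ltW C20) ?(ltW Cr0)//; last 2 first.
  - exact: measurable_kernel_op.
  - exact: measurable_kernel_op.
  apply: lee_wpmul2l; first by rewrite lee_fin.
  rewrite ![in leRHS]EFinM -!muleA ![in leRHS](muleCA C2%:E) ![in leRHS](muleCA Cr%:E).
  apply: leeD; apply: lee_wpmul2l; rewrite ?lee_fin//.
    exact: B2.
  exact: Br.
have sumH x : \sum_(j < J) H j x <=
    4 `^ p * (C2 * (2 `^ (p - 2) / (2 `^ (p - 2) - 1)) +
    Cr * (1 - 2 `^ (- (r - p)))^-1) * `|f x| `^ p.
  rewrite -mulr_sumr -mulrA ler_wpM2l// big_split/= mulrDl; apply: lerD.
    rewrite (_ : \sum_(j < J) _ =
      C2 * ((\sum_(j < J) a ^+ j * (2 ^+ j < `|f x|)%R%:R) * `|f x| `^ 2)); last first.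
      by rewrite mulr_suml mulr_sumr; apply: eq_bigr => j _; rewrite powhi; ring.
    rewrite -mulrA ler_wpM2l ?(ltW C20)//.
    have -> : `|f x| `^ p = `|f x| `^ (p - 2) * `|f x| `^ 2.
      by rewrite -powRD ?subrK// gt_eqF.
    rewrite mulrA ler_wpM2r ?powR_ge0//.
    by apply: geometric_below; rewrite ?subr_gt0.
  have fr : `|f x| `^ r = `|f x| `^ (r - p) * `|f x| `^ p.
    by rewrite -powRD ?subrK// gt_eqF.
  rewrite (_ : \sum_(j < J) _ =
    Cr * ((\sum_(j < J) b ^+ j * (`|f x| <= 2 ^+ j)%R%:R * `|f x| `^ (r - p)) *
      `|f x| `^ p)); last first.
    by rewrite mulr_suml mulr_sumr; apply: eq_bigr => j _; rewrite powlo fr; ring.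
  rewrite -mulrA ler_wpM2l ?(ltW Cr0)// ler_wpM2r ?powR_ge0//.
  by apply: geometric_above; rewrite ?subr_gt0.
apply: (@le_trans _ _ (\int[P]_x ((2 `^ p)%:E + \sum_(j < J) (G j x)%:E))%E).
  apply: ge0_le_integral => //.
  - exact: measurable_EFin_normr_powR.
  - apply: emeasurable_funD => //; apply: emeasurable_sum => j; exact/measurable_EFinP.
  - by move=> x _; rewrite sumEFin -EFinD lee_fin; exact: ptw.
rewrite ge0_integralD//; last 2 first.
- by move=> x _; apply: sume_ge0 => j _; rewrite lee_fin.
- by apply: emeasurable_sum => j; exact/measurable_EFinP.
rewrite integral_cst// (_ : _ setT = 1%E) ?mule1; last exact: probability_setT.
rewrite /marcinkiewicz_constant EFinD; apply: leeD => //.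
rewrite ge0_integral_sum//; last 2 first.
- by move=> j; exact/measurable_EFinP.
- by move=> j x _; rewrite lee_fin.
apply: (@le_trans _ _ (\sum_(j < J) \int[P]_x (H j x)%:E)%E).
  by apply: lee_sum => j _.
rewrite -ge0_integral_sum//; last 2 first.
- by move=> j; exact/measurable_EFinP.
- by move=> j x _; rewrite lee_fin.
set c := 4 `^ p * _ in sumH *.
have c0 : 0 <= c. exact: marcinkiewicz_tail_ge0.
apply: (@le_trans _ _ (\int[P]_x (c%:E * (`|f x| `^ p)%:E))%E).
  apply: ge0_le_integral => //.
  - by move=> x _; apply: sume_ge0 => j _; rewrite lee_fin.
  - by apply: emeasurable_sum => j; exact/measurable_EFinP.
  - by apply: emeasurable_funM => //; exact: measurable_EFin_normr_powR.
  - by move=> x _; rewrite sumEFin -EFinM lee_fin.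
rewrite ge0_integralZl//; last exact: measurable_EFin_normr_powR.
by rewrite -[leRHS]mule1; apply: lee_wpmul2l; rewrite ?lee_fin.
Qed.

End marcinkiewicz.

(** * Interpolation by homogeneity, and duality *)

Section interpolation_duality.
Context d (T : measurableType d) (R : realType).
Variable P : probability T R.
Implicit Types (K : T -> T -> R) (f g : T -> R).

Lemma marcinkiewicz (p r C2 Cr : R) K M : 2 < p -> p < r -> 0 < C2 -> 0 < Cr ->
  bounded_kernel K -> 0 < M -> (forall x y, `|K x y| <= M) ->
  op_bounded P 2 C2 K -> op_bounded P r Cr K ->
  op_bounded P p (marcinkiewicz_constant p r C2 Cr) K.
Proof.
move=> p2 pr C20 Cr0 bK M0 KM B2 Br f mf.
have p1 : 1 <= p by rewrite (le_trans _ (ltW p2))// ler1n.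
have p0 : 0 < p by exact: lt_le_trans p1.
have c0 : 0 < marcinkiewicz_constant p r C2 Cr. exact: marcinkiewicz_constant_gt0.
have [foo|] := ltP (energy P p f) +oo%E; last first.
  by rewrite leye_eq => /eqP ->; rewrite gt0_muley ?leey// lte_fin.
have intf := energy_integrable p1 mf foo.
have F0 := energy_ge0 P p f.
have Ff : energy P p f \is a fin_num by rewrite ge0_fin_numE.
(* Zero energy cannot be scaled to 1; the crude bound then gives 0 directly. Otherwise f is
   multiplied by the inverse of its L_p norm. *)
have [E0|E0] := eqVneq (energy P p f) 0%E.
  by have := op_bounded_crude P p1 M0 bK KM mf; rewrite E0 !mule0.
pose F := fine (energy P p f).
have Fgt0 : 0 < F by rewrite fine_gt0// foo andbT lt_neqAle eq_sym E0.
pose c := F `^ (- p^-1).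
have cp : c `^ p = F^-1.
  by rewrite /c -powRrM mulNr mulVf ?gt_eqF// powR_inv1// ltW.
have cgt0 : 0 < c by exact: powR_gt0.
have e1 : energy P p (fun x => c * f x) = 1%E.
  rewrite energyZ// ger0_norm ?(ltW cgt0)// cp -(fineK Ff) -EFinM mulVf//.
  by rewrite gt_eqF.
have mcf : measurable_fun setT (fun x => c * f x) by exact: measurable_funM.
have := marcinkiewicz_normalized p2 pr C20 Cr0 bK M0 KM B2 Br mcf.
rewrite e1 => /(_ (lexx _)).
rewrite kernel_opZ// energyZ; last exact: measurable_kernel_op.
rewrite ger0_norm ?(ltW cgt0)// cp => H.
rewrite -(fineK Ff) -/F muleC -lee_pdivrMl//.
Qed.

Lemma kernel_op_symm K (f h : T -> R) (M N : R) : bounded_kernel K -> (forall x y, K x y = K y x) ->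
  (forall x y, `|K x y| <= M) -> measurable_fun setT h -> (forall x, `|h x| <= N) ->
  P.-integrable setT (EFin \o f) ->
  \int[P]_x (kernel_op P K f x * h x) = \int[P]_y (f y * kernel_op P K h y).
Proof.
move=> bK sK KM mh hN intf.
have mf : measurable_fun setT f by apply/measurable_EFinP; case/integrableP : intf.
have inth : P.-integrable setT (EFin \o h) by exact: integrable_bounded_cst mh hN.
pose F (z : T * T) : R := (h z.1 * K z.1 z.2) * f z.2.
have intF : (P \x P)%E.-integrable setT (EFin \o F).
  apply: (@integrable_bounded _ _ _ _ (fun z : T * T => h z.1 * K z.1 z.2)
      (fun z => f z.2) (N * M)).
  - apply: measurable_funM; last by case: bK.
    exact: measurableT_comp.
  - by move=> z; rewrite normrM ler_pM.
  - apply/integrable12ltyP; first by apply/measurable_EFinP; exact: measurableT_comp.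
    rewrite /= integral_cst// (_ : _ setT = 1%E) ?mule1; last exact: probability_setT.
    by case/integrableP: intf.
have E1 := integral12_prod_meas1 intF.
have E2 := integral21_prod_meas1 intF.
rewrite /Rintegral; congr fine.
transitivity (\int[P]_x fubini_F P (EFin \o F) x)%E.
  apply: eq_integral => x _; rewrite /fubini_F /= /F /=.
  under [RHS]eq_integral do rewrite -mulrA EFinM.
  rewrite integralZl//; last exact: integrable_kernel_mul.
  rewrite mulrC EFinM; congr (_ * _)%E.
  by rewrite /kernel_op /Rintegral fineK// integrable_fin_num//; exact: integrable_kernel_mul.
rewrite E1 -E2; apply: eq_integral => y _; rewrite /fubini_G /= /F /=.
transitivity (\int[P]_x ((f y)%:E * (K y x * h x)%:E))%E.
  by apply: eq_integral => x _; rewrite -EFinM sK; congr EFin; ring.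
rewrite integralZl//; last exact: integrable_kernel_mul.
rewrite EFinM; congr (_ * _)%E.
by rewrite /kernel_op /Rintegral fineK// integrable_fin_num//; exact: integrable_kernel_mul.
Qed.

(** Young's inequality for e^-1 a and e b, with the factors 1/p and 1/p' bounded by 1. *)
Lemma young_scaled (p p' e a b : R) : 0 < p -> 0 < p' -> p^-1 + p'^-1 = 1 ->
  0 < e -> 0 <= a -> 0 <= b -> a * b <= e `^ (- p) * a `^ p + e `^ p' * b `^ p'.
Proof.
move=> p0 p'0 pp e0 a0 b0.
have -> : a * b = (e^-1 * a) * (e * b) by rewrite mulrACA mulVf ?mul1r// gt_eqF.
have i0 : 0 <= e^-1 by rewrite invr_ge0 ltW.
apply: (le_trans (conjugate_powR _ _ p0 p'0 pp)); rewrite ?mulr_ge0// ?(ltW e0)//.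
have i1 : 0 < p^-1 by rewrite invr_gt0.
have i2 : 0 < p'^-1 by rewrite invr_gt0.
have p1 : p^-1 <= 1 by lra.
have p'1 : p'^-1 <= 1 by lra.
rewrite !powRM ?(ltW e0)//; apply: lerD.
  rewrite -powR_inv1 ?(ltW e0)// -powRrM mulN1r ler_piMr// mulr_ge0 ?powR_ge0//.
by rewrite ler_piMr// mulr_ge0 ?powR_ge0.
Qed.

Lemma young_energy (p p' e : R) f g : 0 < p -> 0 < p' -> p^-1 + p'^-1 = 1 -> 0 < e ->
  measurable_fun setT f -> measurable_fun setT g ->
  (\int[P]_x `|(f x * g x)%:E| <=
    (e `^ (- p))%:E * energy P p f + (e `^ p')%:E * energy P p' g)%E.
Proof.
move=> p0 p'0 pp e0 mf mg.
have mf' := measurable_EFin_normr_powR p mf.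
have mg' := measurable_EFin_normr_powR p' mg.
rewrite /energy -!ge0_integralZl// ?lee_fin ?powR_ge0// -ge0_integralD//; last 4 first.
- by move=> x _; rewrite -EFinM lee_fin mulr_ge0 ?powR_ge0.
- exact: emeasurable_funM.
- by move=> x _; rewrite -EFinM lee_fin mulr_ge0 ?powR_ge0.
- exact: emeasurable_funM.
apply: ge0_le_integral => //.
- apply: measurableT_comp => //; apply/measurable_EFinP; exact: measurable_funM.
- by apply: emeasurable_funD; exact: emeasurable_funM.
- move=> x _; rewrite -!EFinM -EFinD lee_fin /= normrM.
  exact: young_scaled.
Qed.

(* K is symmetric: its bound for the exponent p comes from testing Kf against
   h = |Kf|^(p-2) Kf and absorbing part of the energy of Kf in the left-hand side. *)
Lemma op_bounded_dual (p p' C : R) : 1 < p -> p^-1 + p'^-1 = 1 -> 0 < p' -> 0 < C ->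
  exists2 C' : R, 0 < C' & forall K M, bounded_kernel K -> 0 < M ->
    (forall x y, K x y = K y x) -> (forall x y, `|K x y| <= M) ->
    op_bounded P p' C K -> op_bounded P p C' K.
Proof.
move=> p1 pp p'0 C0; have p0 : 0 < p by exact: lt_trans p1.
(* Chosen so that e^p' C = 1/2: exactly half of the energy of Kf is absorbed. *)
pose e := (2 * C) `^ (- p'^-1).
have e0 : 0 < e by rewrite powR_gt0// mulr_gt0.
have ep' : e `^ p' = (2 * C)^-1.
  by rewrite /e -powRrM mulNr mulVf ?gt_eqF// powR_inv1// mulr_ge0// ltW.
exists (2 * e `^ (- p)); first by rewrite mulr_gt0// powR_gt0.
move=> K M bK M0 sK KM BC f mf.
have [foo|] := ltP (energy P p f) +oo%E; last first.
  by rewrite leye_eq => /eqP ->; rewrite gt0_muley ?leey// lte_fin mulr_gt0// powR_gt0.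
have intf := energy_integrable (ltW p1) mf foo.
have Ff : energy P p f \is a fin_num by rewrite ge0_fin_numE// energy_ge0.
pose g := kernel_op P K f.
have mg : measurable_fun setT g by exact: measurable_kernel_op.
pose B := M * \int[P]_y `|f y|.
have gB x : `|g x| <= B by exact: kernel_op_le.
have B0 : 0 <= B by rewrite mulr_ge0 ?(ltW M0)// Rintegral_ge0.
pose h x := g x * `|g x| `^ (p - 1 - 1).
have p10 : 0 < p - 1 by rewrite subr_gt0.
have hE x : `|h x| = `|g x| `^ (p - 1).
  by rewrite normrM [X in _ * X]ger0_norm ?powR_ge0// mulr_powRB1.
have ghE x : g x * h x = `|g x| `^ p.
  rewrite /h mulrA -expr2 -real_normK ?num_real// expr2 -mulrA mulr_powRB1//.
  by rewrite mulr_powRB1.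
have mh : measurable_fun setT h.
  by apply: measurable_funM => //; exact: measurable_normr_powR.
have hB x : `|h x| <= B `^ (p - 1).
  by rewrite hE; apply: ge0_ler_powR; rewrite ?nnegrE ?(ltW p10).
have p'E : (p - 1) * p' = p.
  have pn : p != 0 by rewrite gt_eqF.
  have pn' : p' != 0 by rewrite gt_eqF.
  have := congr1 (fun z => z * (p * p')) pp; rewrite mulrDl mul1r mulrA mulVf// mul1r.
  by rewrite mulrCA mulVf// mulr1 => H; lra.
have eh : energy P p' h = energy P p g.
  by apply: eq_integral => x _; rewrite hE -powRrM p'E.
(* Absorption requires finite energy of Kf, and the sup bound on the kernel provides it. *)
have gfin : (energy P p g < +oo)%E.
  apply: (@le_lt_trans _ _ (energy P p (fun=> B))).
    apply: (le_energy P mg) => //; first exact: ltW.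
    by move=> x /=; rewrite [leRHS]ger0_norm.
  by rewrite energy_cst ltry.
have Gf : energy P p g \is a fin_num by rewrite ge0_fin_numE// energy_ge0.
have := BC h mh; rewrite eh => Bh.
have mKh : measurable_fun setT (kernel_op P K h) by exact: measurable_kernel_op.
have khf : (energy P p' (kernel_op P K h) < +oo)%E.
  apply: (le_lt_trans Bh); apply: lte_mul_pinfty gfin; last by [].
  by rewrite lee_fin ltW.
have key : (energy P p g <= (e `^ (- p))%:E * energy P p f +
    (e `^ p')%:E * energy P p' (kernel_op P K h))%E.
  have inth : P.-integrable setT (EFin \o h) by exact: integrable_bounded_cst mh hB.
  have -> : energy P p g = (\int[P]_x (f x * kernel_op P K h x)%:E)%E.
    have bd x : `|kernel_op P K h x| <= M * \int[P]_y `|h y| by exact: kernel_op_le.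
    have intfk : P.-integrable setT (EFin \o (fun y => f y * kernel_op P K h y)).
      have := integrable_bounded mKh bd intf.
      by under eq_fun do rewrite mulrC.
    rewrite -[RHS]fineK; last exact: (integrable_fin_num measurableT intfk).
    rewrite -(fineK Gf); congr EFin.
    have := kernel_op_symm bK sK KM mh hB intf.
    rewrite /Rintegral => <-; congr fine.
    by apply: eq_integral => x _; rewrite -ghE.
  apply: (@le_trans _ _ (\int[P]_x `|(f x * kernel_op P K h x)%:E|)%E).
    apply: le_trans (lee_abs _) _.
    by apply: le_abse_integral; [|apply/measurable_EFinP; exact: measurable_funM].
  exact: young_energy.
have key2 : (energy P p g <= (e `^ (- p))%:E * energy P p f +
    (2^-1)%:E * energy P p g)%E.
  apply: (le_trans key); apply: leeD2l.
  apply: (@le_trans _ _ ((e `^ p')%:E * (C%:E * energy P p g))%E).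
    by apply: lee_wpmul2l; rewrite ?lee_fin ?powR_ge0.
  rewrite muleA -EFinM ep' invfM -mulrA mulVf ?mulr1//.
  by rewrite gt_eqF.
move: key2; rewrite -/g -(fineK Gf) -(fineK Ff) -!(EFinM, EFinD) !lee_fin.
move: (fine _) (fine _) => a b; lra.
Qed.

End interpolation_duality.

(** * Convergence in dimension one *)

Section dirichlet_convergence.
Context (R : realType).
Local Notation U := (@unit_measure R : probability (measurableTypeR R) R).

Lemma dirichletN m (t : R) : dirichlet m (- t) = dirichlet m t.
Proof.
rewrite /dirichlet (reindex_inj rev_ord_inj)/=; apply: eq_bigr => l _.
have -> : (m.*2.+1 - l.+1)%N%:Z - m%:Z = - (l%:Z - m%:Z) by have := ltn_ord l; lia.
by rewrite mulrNz mulrN mulrN mulNr opprK.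
Qed.

Lemma dirichlet_kernelC m x y : dirichlet_kernel m x y = dirichlet_kernel m y x :> R.
Proof. by rewrite /dirichlet_kernel -dirichletN opprB. Qed.

Lemma op_bounded_dirichlet_even k : odd k -> exists2 C : R, 0 < C &
  forall m, op_bounded U k.*2%:R C (@dirichlet_kernel R m).
Proof.
move=> ok; have [C C0 HC] := take_energy_le R ok.
have k1 : (1 : R) <= k.*2%:R by rewrite ler1n double_gt0; case: k ok {HC}.
exists (2 `^ k.*2%:R * C * 2 `^ k.*2%:R); first by rewrite !mulr_gt0 ?powR_gt0.
move=> m; apply: (@op_bounded_dense _ _ _ U _ _ m.*2.+1%:R _
  (fun f => exists p, f = trig_poly p)) => //.
- exact: bounded_dirichlet_kernel.
- by move=> x y; exact: dirichlet_bound.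
- by move=> _ [p ->]; exact: measurable_trig_poly.
- by move=> _ [p ->]; rewrite dirichlet_trig_poly; exact: HC.
- move=> f e e0 mf foo; have [p pE] := trig_poly_dense k1 e0 mf foo.
  by exists (trig_poly p) => //; exists p.
Qed.

(** Exponent 2 is the case k = 1; beyond 2, interpolation runs between 2 and some 2k > q with k odd;
    below 2, duality applies to q / (q - 1) > 2. *)
Lemma op_bounded_dirichlet (q : R) : 1 < q -> exists2 C : R, 0 < C &
  forall m, op_bounded U q C (@dirichlet_kernel R m).
Proof.
have [C2 C20 B2] := @op_bounded_dirichlet_even 1 isT.
have big q' : 2 < q' -> exists2 C : R, 0 < C &
    forall m, op_bounded U q' C (@dirichlet_kernel R m).
  move=> q2.
  pose k := (Num.bound q').*2.+1.
  have ok : odd k by rewrite /k /= odd_double.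
  have qk : q' < k.*2%:R.
    have q0 : 0 <= q' by rewrite (le_trans _ (ltW q2)).
    apply: (lt_trans (archi_boundP q0)); rewrite ltr_nat /k; lia.
  have [C C0 B] := op_bounded_dirichlet_even ok.
  exists (marcinkiewicz_constant q' k.*2%:R C2 C). exact: marcinkiewicz_constant_gt0.
  move=> m; apply: (@marcinkiewicz _ _ _ U _ _ _ _ _ m.*2.+1%:R) => //.
  - exact: bounded_dirichlet_kernel.
  - by move=> x y; exact: dirichlet_bound.
move=> q1; have [q2|q2|->] := ltgtP q 2; last first.
- by exists C2.
- exact: big.
pose q' := q / (q - 1).
have q0 : 0 < q by exact: lt_trans q1.
have q10 : 0 < q - 1 by rewrite subr_gt0.
have q'2 : 2 < q' by rewrite /q' ltr_pdivlMr//; lra.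
have q'0 : 0 < q' by exact: lt_trans q'2.
have qq : q^-1 + q'^-1 = 1 by rewrite /q' invf_div; field; rewrite gt_eqF.
have [C C0 B] := big _ q'2.
have [C' C'0 B'] := op_bounded_dual U q1 qq q'0 C0.
exists C' => // m; apply: (B' _ m.*2.+1%:R) => //.
- exact: bounded_dirichlet_kernel.
- exact: dirichlet_kernelC.
- by move=> x y; exact: dirichlet_bound.
Qed.

(** The Banach-Steinhaus scheme: f - Kf = (f - p) - K (f - p) as soon as K fixes the trigonometric
    polynomial p, that is once m j reaches its degree, and the bound on K is uniform in j. *)
Lemma op_cvg_dirichlet (q : R) (m : nat -> nat) : 1 < q ->
  (forall N, \forall j \near \oo, (N <= m j)%N) ->
  op_cvg U q (fun j => @dirichlet_kernel R (m j)).
Proof.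
move=> q1 moo f mf foo.
have [C C0 B] := op_bounded_dirichlet q1.
have q0 : 0 < q by exact: lt_trans q1.
have intf := energy_integrable (ltW q1) mf foo.
have mop j : measurable_fun setT (kernel_op U (dirichlet_kernel (m j)) f).
  by apply: measurable_kernel_op => //; exact: bounded_dirichlet_kernel.
have Efin j : energy U q (f \- kernel_op U (dirichlet_kernel (m j)) f)%R \is a fin_num.
  rewrite ge0_fin_numE; last exact: energy_ge0.
  apply: (le_lt_trans (energyB _ (ltW q0) mf (mop j))).
  apply: lte_mul_pinfty; rewrite ?lee_fin ?powR_ge0//.
  apply: lte_add_pinfty; first exact: foo.
  by apply: (le_lt_trans (B _ _ mf)); rewrite lte_mul_pinfty ?lee_fin ?(ltW C0).
apply/fine_cvgP; split; first by apply: nearW => j; exact: Efin.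
apply/cvgrPdist_le => e e0.
pose c := 2 `^ q * (1 + C); have c0 : 0 < c by rewrite mulr_gt0 ?powR_gt0// addr_gt0.
have ec : 0 < e / c by rewrite divr_gt0.
have [p pE] := trig_poly_dense (ltW q1) ec mf foo.
have mp := measurable_trig_poly p.
have intp := integrable_trig_poly p.
near=> j; rewrite sub0r normrN ger0_norm ?fine_ge0 ?energy_ge0//.
rewrite -lee_fin fineK; last exact: Efin.
have bK := @bounded_dirichlet_kernel R (m j).
have sp : kernel_op U (dirichlet_kernel (m j)) (trig_poly p) = trig_poly p.
  rewrite dirichlet_trig_poly take_poly_id// leqW//.
  by near: j; exact: moo.
have -> : f \- kernel_op U (dirichlet_kernel (m j)) f =
    (f \- trig_poly p) \- kernel_op U (dirichlet_kernel (m j)) (f \- trig_poly p).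
  by apply/funext => x /=; rewrite kernel_opB// sp; ring.
have mfp : measurable_fun setT (f \- trig_poly p) by exact: measurable_funB.
apply: (le_trans (energyB _ (ltW q0) mfp _)); first exact: measurable_kernel_op.
apply: (@le_trans _ _ ((2 `^ q)%:E * ((e / c)%:E + C%:E * (e / c)%:E))%E).
  apply: lee_wpmul2l; first by rewrite lee_fin powR_ge0.
  apply: leeD => //; apply: (le_trans (B _ _ mfp)).
  by apply: lee_wpmul2l; rewrite // lee_fin ltW.
rewrite -!(EFinM, EFinD) lee_fin (_ : _ * _ = c * (e / c)); last by rewrite /c; ring.
by rewrite mulrC divfK// gt_eqF.
Unshelve. all: by end_near. Qed.

End dirichlet_convergence.

(** * The cube *)

Section transport.
Context d d' (T : measurableType d) (T' : measurableType d') (R : realType).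
Variables (P : probability T R) (phi : {mfun T >-> T'}).
Local Notation Q := (distribution P phi : probability T' R).
Implicit Types (K : T' -> T' -> R) (f : T' -> R).

(** Tensor products live on pairs and the cube consists of tuples; energies and operators are
    carried from one to the other along [phi], which will be [cons_pair]. *)
Definition pullback_kernel K (z w : T) : R := K (phi z) (phi w).

Lemma energy_distribution q f : measurable_fun setT f ->
  energy Q q f = energy P q (f \o phi).
Proof.
move=> mf; rewrite /energy ge0_integral_distribution//.
exact: measurable_EFin_normr_powR.
Qed.

Lemma Rintegral_distribution f : measurable_fun setT f ->
  P.-integrable setT (EFin \o (f \o phi)) ->
  \int[Q]_y f y = \int[P]_x f (phi x).
Proof.
move=> mf intf; rewrite /Rintegral (integral_distribution (f := EFin \o f))//.
exact/measurable_EFinP.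
Qed.

Lemma kernel_op_distribution K f z : bounded_kernel K -> measurable_fun setT f ->
  P.-integrable setT (EFin \o (f \o phi)) ->
  kernel_op Q K f (phi z) = kernel_op P (pullback_kernel K) (f \o phi) z.
Proof.
move=> bK mf intf; rewrite /kernel_op.
have mK := measurable_kernel_section (phi z) bK.
apply: Rintegral_distribution; first exact: measurable_funM.
have [_ [M KM]] := bK.
apply: (@integrable_bounded _ _ _ P (fun x => K (phi z) (phi x)) (f \o phi) M) => //.
exact: (measurableT_comp mK).
Qed.

Lemma op_bounded_distribution q C K : 1 <= q -> 0 < C -> bounded_kernel K ->
  op_bounded P q C (pullback_kernel K) -> op_bounded Q q C K.
Proof.
move=> q1 C0 bK B f mf; have mfp : measurable_fun setT (f \o phi) by exact: measurableT_comp.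
have mo : measurable_fun setT (kernel_op Q K f) by exact: measurable_kernel_op.
rewrite !energy_distribution//.
have [foo|] := ltP (energy P q (f \o phi)) +oo%E; last first.
  by rewrite leye_eq => /eqP ->; rewrite gt0_muley ?leey// lte_fin.
have intf := energy_integrable q1 mfp foo.
rewrite (_ : kernel_op Q K f \o phi = kernel_op P (pullback_kernel K) (f \o phi)).
  exact: B.
by apply/funext => z; exact: kernel_op_distribution.
Qed.

Lemma op_cvg_distribution q (K : nat -> T' -> T' -> R) : 1 <= q ->
  (forall j, bounded_kernel (K j)) ->
  op_cvg P q (fun j => pullback_kernel (K j)) -> op_cvg Q q K.
Proof.
move=> q1 bK cK f mf foo.
have mfp : measurable_fun setT (f \o phi) by exact: measurableT_comp.
rewrite energy_distribution// in foo.
have intf := energy_integrable q1 mfp foo.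
rewrite (_ : (fun j => _) = fun j =>
    energy P q (f \o phi \- kernel_op P (pullback_kernel (K j)) (f \o phi))%R).
  exact: cK.
apply/funext => j.
rewrite energy_distribution; last first.
  by apply: measurable_funB => //; exact: measurable_kernel_op.
congr (energy P q _); apply/funext => z /=; congr (_ - _).
by rewrite kernel_op_distribution.
Qed.

End transport.

Section cube_probability.
Context (R : realType).
Local Notation U := (@unit_measure R : probability (measurableTypeR R) R).

HB.instance Definition _ n :=
  isMeasurableFun.Build _ _ _ _ (@cons_pair R n) (@measurable_cons_pair R n).

(* The measure of the cube presented as an iterated product, so that Fubini applies
   dimension by dimension; see cube_measureE. *)
Fixpoint cube_prob n : probability (Rn R n) R :=
  match n with
  | 0 => \d_[tuple]
  | n'.+1 => distribution (U \x cube_prob n')%E (@cons_pair R n')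
  end.

(** Lebesgue measure is restricted to the cube at the end, whereas [cube_prob] restricts each
    factor. By induction on sections: for x in (0,1) the section is cut by the smaller cube, and for
    other x it is empty. *)
Lemma cube_measureE n (A : set (Rn R n)) : measurable A ->
  cube_measure R n A = cube_prob n A.
Proof.
elim: n A => [A mA|n ih A mA].
  rewrite /cube_measure /= /mrestr (_ : @unit_cube R 0 = setT) ?setIT//.
  by apply/seteqP; split => // x _ [].
have mpre : measurable (@cons_pair R n @^-1` A).
  by rewrite -[X in measurable X]setTI; exact: measurable_cons_pair.
rewrite /cube_measure /= /mrestr /= /lebesgue_cons /distribution /pushforward.
rewrite /product_measure1 integral_unit_measure//; last first.
  exact: measurable_fun_xsection.
rewrite [RHS]integral_mkcond; apply: eq_integral => x _ /=.
rewrite patchE; case: ifPn => [/set_mem|/negP x01].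
  rewrite /= in_itv/= => x01.
  rewrite -ih; last exact: measurable_xsection.
  rewrite /cube_measure /= /mrestr /=; congr (lebesgue_tuple R n _).
  apply/seteqP; split => y; rewrite /xsection /= !inE /preimage /=.
    move=> [Ay cy]; split => // i.
    by have := cy (lift ord0 i); rewrite tnthS.
  move=> [Ay cy]; split => // i; case: (unliftP ord0 i) => [j ->|->//].
  by rewrite tnthS; exact: cy.
rewrite (_ : xsection _ x = set0) ?measure0//.
apply/seteqP; split => // y; rewrite /xsection /= !inE => -[_ /(_ ord0)].
by move=> h; case: x01; rewrite inE /= in_itv.
Qed.

Lemma Lnorm_cube n (q : R) (f : Rn R n -> \bar R) :
  'N[cube_measure R n]_q%:E[f]%E = 'N[cube_prob n]_q%:E[f]%E.
Proof.
rewrite unlock /Lnorm; congr poweR.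
by apply: eq_measure_integral => A mA _; exact: cube_measureE.
Qed.

End cube_probability.

Section box_kernel.
Context (R : realType).
Local Notation U := (@unit_measure R : probability (measurableTypeR R) R).

Definition box_kernel n (m : n.-tuple nat) (x y : Rn R n) : R :=
  \prod_(i < n) dirichlet (tnth m i) ((tnth x i : R) - tnth y i).

Lemma box_kernelS n (l : nat) (m : n.-tuple nat) :
  pullback_kernel (@cons_pair R n) (box_kernel [tuple of l :: m]) =
  tensor_kernel (@dirichlet_kernel R l) (box_kernel m).
Proof.
apply/funext => x; apply/funext => y.
rewrite /pullback_kernel /box_kernel big_ord_recl/= /tensor_kernel; congr (_ * _).
by apply: eq_bigr => i _; rewrite !tnthS.
Qed.

Lemma box_kernel0 (m : 0.-tuple nat) x y : box_kernel m x y = 1.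
Proof. by rewrite /box_kernel big_ord0. Qed.

Lemma bounded_box_kernel n (m : n.-tuple nat) : bounded_kernel (box_kernel m).
Proof.
split.
  apply: measurable_prod => i _; rewrite /dirichlet.
  apply: measurable_sum => l; apply: measurable_cos_comp.
  apply: measurable_funM => //; apply: measurable_funB.
    exact: (measurableT_comp (@measurable_tnth _ _ _ i)).
  exact: (measurableT_comp (@measurable_tnth _ _ _ i)).
exists (\prod_(i < n) (tnth m i).*2.+1%:R) => x y.
by rewrite normr_prod; apply: ler_prod => i _; rewrite normr_ge0 dirichlet_bound.
Qed.

(** In dimension 0 the kernel is 1 and Jensen gives the constant 1; each further coordinate
    multiplies it by the one-dimensional constant. *)
Lemma op_bounded_box (q : R) n : 1 < q -> exists2 C : R, 0 < C &
  forall m : n.-tuple nat, op_bounded (cube_prob R n) q C (box_kernel m).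
Proof.
move=> q1; elim: n => [|n [C C0 B]].
  exists 1 => // m f mf; rewrite mul1e.
  rewrite (_ : kernel_op _ _ f = fun=> \int[cube_prob R 0]_y f y).
    by rewrite energy_cst; exact: jensen_energy (ltW q1) mf.
  apply/funext => x; apply: eq_Rintegral => y _.
  by rewrite box_kernel0 mul1r.
have [C1 C10 B1] := op_bounded_dirichlet q1.
exists (C1 * C); first by rewrite mulr_gt0.
case/tupleP => l m; apply: op_bounded_distribution.
- exact: ltW.
- by rewrite mulr_gt0.
- exact: bounded_box_kernel.
rewrite box_kernelS; apply: tensor_op_bounded => //.
- exact: ltW.
- exact: bounded_dirichlet_kernel.
- exact: bounded_box_kernel.
Qed.

Lemma op_cvg_box (q : R) n (u : nat -> n.-tuple nat) : 1 < q ->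
  (forall i N, \forall j \near \oo, (N <= tnth (u j) i)%N) ->
  op_cvg (cube_prob R n) q (fun j => box_kernel (u j)).
Proof.
move=> q1; elim: n u => [|n ih] u uoo.
  move=> f mf foo; rewrite (_ : (fun j => _) = cst 0%E); first exact: cvg_cst.
  apply/funext => j /=; rewrite (_ : f \- _ = fun=> 0).
    by rewrite energy_cst normr0 powR0// gt_eqF// (lt_trans _ q1).
  apply/funext => x; transitivity (f x - \int[cube_prob R 0]_y f x).
    congr (_ - _); apply: eq_Rintegral => y _.
    by rewrite box_kernel0 mul1r (tuple0 y) (tuple0 x).
  rewrite Rintegral_cst// (_ : _ setT = 1%E) ?mulr1 ?subrr//.
  exact: probability_setT.
pose l j := thead (u j); pose m j : n.-tuple nat := [tuple of behead (u j)].
have uE j : u j = [tuple of l j :: m j] by rewrite [LHS]tuple_eta.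
have [C1 C10 B1] := op_bounded_dirichlet q1.
have [C2 C20 B2] := op_bounded_box n q1.
apply: op_cvg_distribution; first exact: ltW.
  by move=> j; exact: bounded_box_kernel.
rewrite (_ : (fun j => _) =
    fun j => tensor_kernel (@dirichlet_kernel R (l j)) (box_kernel (m j))); last first.
  by apply/funext => j; rewrite uE box_kernelS.
suff : op_cvg (U \x cube_prob R n)%E q
  (fun j => tensor_kernel (@dirichlet_kernel R (l j)) (box_kernel (m j))) by [].
apply: (@tensor_op_cvg _ _ _ _ _ U (cube_prob R n) q (ltW q1) _ _ C1 C2).
- by move=> j; exact: bounded_dirichlet_kernel.
- by move=> j; exact: bounded_box_kernel.
- exact: C10.
- exact: C20.
- by move=> j; exact: B1.
- by move=> j; exact: B2.
- by apply: op_cvg_dirichlet => // N; exact: uoo.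
- apply: ih => i N; have := uoo (lift ord0 i) N; apply: filterS => j.
  by rewrite uE tnthS.
Qed.

End box_kernel.

(** * Enumeration of the frequencies of a box *)

Section frequency_box.
Implicit Types (n : nat).

Definition int_range m : seq int := [seq l%:Z - m%:Z | l <- iota 0 m.*2.+1].

(** All frequencies of the rectangle, of either sign, listed by recursion on the dimension so that
    sums over them factorize; [freq_rect] is the positive half. *)
Fixpoint box n : n.-tuple nat -> seq (n.-tuple int) :=
  match n with
  | 0 => fun=> [:: [tuple]]
  | n'.+1 => fun m : n'.+1.-tuple nat => [seq [tuple of l :: k] |
      l : int <- int_range (thead m),
      k : n'.-tuple int <- box [tuple of behead m]]
  end.

Lemma box_cons n l (m : n.-tuple nat) : box [tuple of l :: m] =
  [seq [tuple of z :: k] | z : int <- int_range l, k : n.-tuple int <- box m].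
Proof. by rewrite /= theadE (_ : [tuple of _] = m)//; exact: val_inj. Qed.

Lemma mem_int_range m (z : int) : (z \in int_range m) = (`|z| <= m)%N.
Proof.
apply/mapP/idP => [[l]|zm]; first by rewrite mem_iota => lm ->; lia.
by exists `|(z + m%:Z)%R|%N; rewrite ?mem_iota; lia.
Qed.

Lemma uniq_int_range m : uniq (int_range m).
Proof. by rewrite map_inj_uniq ?iota_uniq// => a b; lia. Qed.

Lemma mem_box n (m : n.-tuple nat) (k : n.-tuple int) :
  (k \in box m) = [forall i, `|tnth k i| <= tnth m i]%N.
Proof.
elim: n m k => [|n ih] m k.
  apply/idP/forallP => [_ []//|_].
  by rewrite /= mem_seq1; apply/eqP; exact: tuple0.
case/tupleP: m => l m; case/tupleP: k => z k.
apply/allpairsP/forallP => /= [[[z' k']]|H].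
  rewrite mem_int_range theadE ih /= => -[z'l /forallP k'm E] i.
  have [-> kE] : z = z' /\ k = k'.
    by move/(congr1 val): E => /= -[-> kk]; split => //; exact: val_inj.
  case: (unliftP ord0 i) => [j ->|->//].
  by rewrite !tnthS kE; have := k'm j; rewrite (_ : [tuple of _] = m)//; exact: val_inj.
exists (z, k); split => //=.
  by rewrite mem_int_range theadE; exact: (H ord0).
rewrite ih; apply/forallP => i; rewrite (_ : [tuple of _] = m); last exact: val_inj.
by have := H (lift ord0 i); rewrite !tnthS.
Qed.

Lemma uniq_box n (m : n.-tuple nat) : uniq (box m).
Proof.
elim: n m => [//|n ih] m; apply: allpairs_uniq => //; first exact: uniq_int_range.
move=> [a b] [a' b'] _ _ /(congr1 val) /= [-> /val_inj ->] //.
Qed.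

Definition opp_freq n (k : n.-tuple int) : n.-tuple int := [tuple - tnth k i | i < n].

Definition zero_freq n : n.-tuple int := [tuple 0 | i < n].

Lemma opp_freqK n : involutive (@opp_freq n).
Proof. by move=> k; apply: eq_from_tnth => i; rewrite !tnth_mktuple opprK. Qed.

Lemma lex_positive_nz n (k : n.-tuple int) : lex_positive k -> k != zero_freq n.
Proof.
move=> /existsP[i /andP[ki _]]; apply/eqP => kE.
by rewrite kE tnth_mktuple ltxx in ki.
Qed.

Lemma lex_positive_asym n (k : n.-tuple int) : lex_positive k -> ~~ lex_positive (opp_freq k).
Proof.
move=> /existsP[i /andP[ki /forallP Hi]]; apply/negP => /existsP[j /andP[kj /forallP Hj]].
move: kj; rewrite tnth_mktuple => kj.
have := Hi j; have := Hj i; rewrite tnth_mktuple.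
case: (ltngtP i j) => [ij|ij|/val_inj ij]; rewrite ?implyTb.
- by move=> /eqP; lia.
- by move=> _ /eqP; lia.
- by rewrite ij in ki; lia.
Qed.

Lemma lex_positive_total n (k : n.-tuple int) : k != zero_freq n ->
  ~~ lex_positive k -> lex_positive (opp_freq k).
Proof.
move=> k0; have [i0 ki0] : exists i, tnth k i != 0.
  apply/existsP; apply: contraR k0; rewrite negb_exists => /forallP H.
  by apply/eqP/eq_from_tnth => i; rewrite tnth_mktuple; exact/eqP/negPn/H.
case: (@arg_minnP _ i0 (fun i => tnth k i != 0) (fun i => nat_of_ord i) ki0) => i ki mini.
have Hi (j : 'I_n) : (j < i)%N -> tnth k j = 0.
  by move=> ji; apply/eqP; apply: contraTT ji => /mini; rewrite -leqNgt.
move=> kN; apply/existsP; exists i; rewrite tnth_mktuple; apply/andP; split.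
  rewrite oppr_gt0 ltNge le_eqVlt eq_sym (negbTE ki)/=; apply: contra kN => ki'.
  apply/existsP; exists i; rewrite ki'/=; apply/forallP => j; apply/implyP => /Hi ->//.
by apply/forallP => j; apply/implyP => /Hi; rewrite tnth_mktuple => ->; rewrite oppr0.
Qed.

Lemma mem_box_opp n (m : n.-tuple nat) k : (opp_freq k \in box m) = (k \in box m).
Proof.
by rewrite !mem_box; apply: eq_forallb => i; rewrite tnth_mktuple abszN.
Qed.

Lemma mem_box0 n (m : n.-tuple nat) : zero_freq n \in box m.
Proof. by rewrite mem_box; apply/forallP => i; rewrite tnth_mktuple. Qed.

(** The map k -> -k permutes the box and exchanges the positive frequencies with the remaining
    nonzero ones. *)
Lemma sum_box_even (V : zmodType) n (m : n.-tuple nat) (g : n.-tuple int -> V) :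
  (forall k, g (opp_freq k) = g k) ->
  \sum_(k <- box m) g k = g (zero_freq n) + (\sum_(k <- box m | lex_positive k) g k) *+ 2.
Proof.
move=> gE; rewrite (bigD1_seq _ (mem_box0 m) (uniq_box m))/=; congr (_ + _).
rewrite (bigID (@lex_positive n))/= mulr2n; congr (_ + _).
  apply: eq_bigl => k; apply/andP/idP => [[]//|kp].
  by split => //; exact: lex_positive_nz.
have pm : perm_eq (box m) (map (@opp_freq n) (box m)).
  apply: uniq_perm; first exact: uniq_box.
    by rewrite map_inj_uniq ?uniq_box//; exact: (inv_inj (@opp_freqK n)).
  move=> k; apply/idP/mapP => [kb|[k' k'b ->]]; last by rewrite mem_box_opp.
  by exists (opp_freq k); rewrite ?mem_box_opp ?opp_freqK.
rewrite (perm_big _ pm) big_map/=; apply: eq_big => [k|k _]; last exact: gE.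
apply/andP/idP => [[k0 kN]|kp].
  rewrite -[k]opp_freqK; apply: lex_positive_total => //.
split; last exact: lex_positive_asym.
apply: contra (lex_positive_nz kp) => /eqP k0.
apply/eqP; rewrite -[k]opp_freqK k0.
by apply: eq_from_tnth => i; rewrite !tnth_mktuple oppr0.
Qed.

Lemma sum_freq_rect (V : nmodType) n (m : n.-tuple nat) (g : n.-tuple int -> V) :
  \sum_(k \in freq_rect m) g (val k) = \sum_(k <- box m | lex_positive k) g k.
Proof.
rewrite fsbig_finite; last exact: finite_freq_rect.
rewrite -(big_map val predT g) -[RHS]big_filter; apply: perm_big.
apply: uniq_perm.
- by rewrite map_inj_uniq ?fset_uniq//; exact: val_inj.
- by rewrite filter_uniq// uniq_box.
move=> k; rewrite mem_filter mem_box; apply/mapP/andP => [[k']|[kp /forallP km]].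
  rewrite in_fset_set; last exact: finite_freq_rect.
  by rewrite inE => k'm ->; split; [exact: (valP k')|exact/forallP].
exists (exist _ k kp) => //.
by rewrite in_fset_set ?inE//; exact: finite_freq_rect.
Qed.

End frequency_box.

(** * Product formula for the box kernel *)

Section box_cos.
Context (R : realType).

(* The phase makes the product formula sum_cos_box inductive in the dimension. *)
Lemma sum_cos_phase m (b t : R) :
  \sum_(z <- int_range m) cos (b + 2 * pi * z%:~R * t) = cos b * dirichlet m t.
Proof.
rewrite big_map /dirichlet (_ : iota 0 _ = index_iota 0 m.*2.+1); last by rewrite /index_iota subn0.
rewrite big_mkord mulr_sumr.
under eq_bigr do rewrite cosD; rewrite big_split/= -[RHS]addr0; congr (_ + _).
rewrite sumrN -mulr_sumr (_ : \sum_(l < _) _ = 0) ?mulr0 ?oppr0//.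
(* Reversing the index changes the sign of every sine, so the sum equals its opposite. *)
set S := LHS; have SN : S = - S.
  rewrite {1}/S (reindex_inj rev_ord_inj)/= -sumrN; apply: eq_bigr => l _.
  have -> : (m.*2.+1 - l.+1)%N%:Z - m%:Z = - (l%:Z - m%:Z) by have := ltn_ord l; lia.
  by rewrite mulrNz mulrN mulNr sinN.
have : S *+ 2 == 0 by rewrite mulr2n {1}SN addNr.
by rewrite mulrn_eq0 => /eqP.
Qed.

Lemma dot_cons n (z : int) (k : n.-tuple int) (x : R) (y : Rn R n) :
  dot [tuple of z :: k] (cons_pair (x, y)) = z%:~R * x + dot k y.
Proof.
rewrite /dot big_ord_recl/=; congr (_ + _).
by apply: eq_bigr => i _; rewrite !tnthS.
Qed.

Lemma sum_cos_box n (m : n.-tuple nat) (a : R) (x : Rn R n) :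
  \sum_(k <- box m) cos (a + 2 * pi * dot k x) =
  cos a * \prod_(i < n) dirichlet (tnth m i) (tnth x i).
Proof.
elim: n m a x => [|n ih] m a x.
  by rewrite big_seq1 /dot !big_ord0 mulr0 addr0 mulr1.
rewrite -[x]uncons_pairK; case: (uncons_pair x) => t y.
case/tupleP: m => l m; rewrite box_cons big_allpairs_dep.
rewrite big_ord_recl/=.
under [X in _ * (_ * X)]eq_bigr do rewrite !tnthS.
rewrite mulrA -sum_cos_phase mulr_suml; apply: eq_bigr => z _.
rewrite -ih; apply: eq_bigr => k _; rewrite dot_cons; congr cos.
by rewrite mulrDr !mulrA addrA.
Qed.

(** The full sum over the box is even in k; pairing k with -k leaves the factor 2, which is the
    square of the normalization sqrt 2 of the system. *)
Lemma box_kernel_cos n (m : n.-tuple nat) (x y : Rn R n) :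
  box_kernel m x y = 1 + \sum_(k \in freq_rect m)
    2 * cos (2 * pi * dot (val k) x - 2 * pi * dot (val k) y).
Proof.
pose g k := cos (2 * pi * dot k x - 2 * pi * dot k y : R).
rewrite (sum_freq_rect m (fun k => 2 * g k)) -mulr_sumr mulr_natl.
have dotN k (z : Rn R n) : dot (opp_freq k) z = - dot k z :> R.
  by rewrite /dot -sumrN; apply: eq_bigr => i _; rewrite tnth_mktuple mulrNz mulNr.
have dot0 (z : Rn R n) : dot (zero_freq n) z = 0 :> R.
  by rewrite /dot big1// => i _; rewrite tnth_mktuple mul0r.
transitivity (\sum_(k <- box m) g k); last first.
  rewrite sum_box_even; first by rewrite /g !dot0 !mulr0 subr0 cos0.
  by move=> k; rewrite /g !dotN !mulrN -opprD cosN.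
pose w : Rn R n := [tuple (tnth x i : R) - tnth y i | i < n].
transitivity (\sum_(k <- box m) cos (0 + 2 * pi * dot k w)).
  rewrite sum_cos_box cos0 mul1r; apply: eq_bigr => i _.
  by rewrite tnth_mktuple.
apply: eq_bigr => k _; rewrite /g add0r -mulrBr /dot -sumrB; congr (cos (_ * _)).
by apply: eq_bigr => i _; rewrite tnth_mktuple mulrBr.
Qed.

End box_cos.

(** If convergence failed, each N would give a bad index with all entries at least N, and these form
    a sequence contradicting the hypothesis. Dominated convergence is thereby used along sequences
    only. *)
Lemma pringsheim_sequence (T : topologicalType) n (F : n.-tuple nat -> T) (l : T) :
  (forall u : nat -> n.-tuple nat, (forall i N, \forall j \near \oo, (N <= tnth (u j) i)%N) ->
    F (u j) @[j --> \oo] --> l) ->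
  F m @[m --> @pringsheim n] --> l.
Proof.
move=> H V Vl; apply: contrapT => nV.
have ex N : exists m : n.-tuple nat, (forall i, (N <= tnth m i)%N) /\ ~ V (F m).
  apply: contrapT => nex; apply: nV; exists N => // m mN /=.
  by apply: contrapT => nVm; apply: nex; exists m.
have [u uP] := choice ex.
have [|N _ /(_ N (leqnn N))] := H u _ V Vl; last by case: (uP N).
move=> i N; exists N => // j /= Nj.
by apply: leq_trans Nj _; exact: (uP j).1.
Qed.

Section weak_limit.
Context d (T : measurableType d) (R : realType).
Variable P : probability T R.

(** As g is bounded, the integral of (f - S i) g is at most a constant times the L_1 norm of f - S
    i, hence times its L_q norm, which becomes arbitrarily small. *)
Lemma Rintegral_limit (I : Type) (F : set_system I) {FF : ProperFilter F}
    (q B L : R) (f g : T -> R) (S : I -> T -> R) : 1 <= q ->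
  measurable_fun setT f -> (energy P q f < +oo)%E ->
  measurable_fun setT g -> (forall x, `|g x| <= B) ->
  (forall i, measurable_fun setT (S i)) ->
  (forall i, exists M, forall x, `|S i x| <= M) ->
  ('N[P]_q%:E[EFin \o (f \- S i)%R] @[i --> F] --> 0)%E ->
  (\forall i \near F, \int[P]_x (S i x * g x) = L) ->
  \int[P]_x (f x * g x) = L.
Proof.
move=> q1 mf foo mg gB mS bS cS SL; have q0 : 0 < q by exact: lt_le_trans q1.
have intf := energy_integrable q1 mf foo.
have intg (h : T -> R) : P.-integrable setT (EFin \o h) ->
    P.-integrable setT (EFin \o (fun x => h x * g x)).
  move=> inth; rewrite (_ : _ \o _ = fun x => (g x * h x)%:E); last first.
    by apply/funext => x /=; rewrite mulrC.
  exact: integrable_bounded gB inth.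
have intS i : P.-integrable setT (EFin \o S i).
  by have [M SM] := bS i; exact: integrable_bounded_cst (mS i) SM.
apply/eqP; rewrite -subr_eq0 -normr_le0; apply/ler_addgt0Pr => e e0; rewrite add0r.
pose c := `|B| + 1; have c0 : 0 < c by rewrite ltr_wpDl.
have ec : 0 < e / c by rewrite divr_gt0.
have [i [iL ile]] : exists i, \int[P]_x (S i x * g x) = L /\
    ('N[P]_q%:E[EFin \o (f \- S i)%R] <= (e / c)%:E)%E.
  apply: (@filter_ex _ F); apply: filterI => //.
  exact: cvge0_near_le.
have mfS : measurable_fun setT (f \- S i) by exact: measurable_funB.
have intfS : P.-integrable setT (EFin \o (f \- S i)).
  exact: (integrableB _ intf (intS i)).
rewrite -iL -RintegralB//; [|exact: intg|exact: intg].
apply: (le_trans (le_normr_Rintegral _ _)) => //.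
  rewrite (_ : _ \o _ = EFin \o (fun x => (f \- S i) x * g x)); first exact: intg.
  by apply/funext => x /=; rewrite mulrBl.
apply: (@le_trans _ _ (\int[P]_x (c * `|(f \- S i) x|))).
  apply: le_Rintegral => //.
  - have := integrable_norm (intg _ intfS).
    by under eq_fun do rewrite /= mulrBl.
  - exact: (integrableZl _ c (integrable_norm intfS)).
  - move=> x _; rewrite -mulrBl normrM mulrC ler_wpM2r// (le_trans (gB x))//.
    by rewrite /c (le_trans (ler_norm _))// lerDl.
rewrite RintegralZl//; last exact: (integrable_norm intfS).
rewrite -ler_pdivlMl// mulrC -lee_fin.
apply: le_trans ile; apply: le_trans (LnormS1 _ q1 mfS); rewrite Lnorm1.
rewrite /Rintegral fineK//.
exact: integrable_fin_num (integrable_norm intfS).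
Qed.

End weak_limit.

Section freq_seq.
Variable n : nat.

Definition freq_seq (m : n.-tuple nat) : seq (pos_freq n) :=
  finmap.enum_fset (fset_set (freq_rect m)).

Lemma freq_seq_sum (V : nmodType) (m : n.-tuple nat) (F : pos_freq n -> V) :
  \sum_(k \in freq_rect m) F k = \sum_(k <- freq_seq m) F k.
Proof. by rewrite fsbig_finite//; exact: finite_freq_rect. Qed.

Lemma mem_freq_seq m k : (k \in freq_seq m) = (k \in freq_rect m).
Proof. by rewrite in_fset_set//; exact: finite_freq_rect. Qed.

Lemma uniq_freq_seq m : uniq (freq_seq m).
Proof. exact: finmap.fset_uniq. Qed.

End freq_seq.

(** * Orthogonality and Fourier coefficients *)

Section orthogonality.
Context (R : realType) (n : nat).

Lemma measurable_dot n' (k : n'.-tuple int) : measurable_fun setT (@dot R n' k).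
Proof.
apply: measurable_sum => i; apply: measurable_funM => //; exact: measurable_tnth.
Qed.

Lemma measurable_cos_dot n' (a : R) (k : n'.-tuple int) :
  measurable_fun setT (fun x : Rn R n' => cos (a + 2 * pi * dot k x)).
Proof.
apply: measurable_cos_comp; apply: measurable_funD => //.
by apply: measurable_funM => //; exact: measurable_dot.
Qed.

(** By Fubini, the phase takes up the first coordinate and the induction hypothesis integrates the
    others. *)
Lemma Rintegral_cos_cube n' (a : R) (k : n'.-tuple int) :
  \int[cube_prob R n']_x cos (a + 2 * pi * dot k x) =
  if k == zero_freq n' then cos a else 0.
Proof.
elim: n' a k => [|n' ih] a k.
  have -> : k == zero_freq 0 by apply/eqP; rewrite (tuple0 k); exact/esym/tuple0.
  transitivity (\int[cube_prob R 0]_x cos a).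
    by apply: eq_Rintegral => x _; rewrite /dot big_ord0 mulr0 addr0.
  rewrite Rintegral_cst// (_ : _ setT = 1%E) ?mulr1//; exact: probability_setT.
case/tupleP: k => z k.
have -> : ([tuple of z :: k] == zero_freq n'.+1) = (z == 0) && (k == zero_freq n').
  apply/eqP/andP => [E|[/eqP-> /eqP->]].
    split; apply/eqP; last apply: eq_from_tnth => i.
      by have := congr1 (fun t => tnth t ord0) E; rewrite tnth_mktuple.
    by have := congr1 (fun t => tnth t (lift ord0 i)) E; rewrite !tnth_mktuple tnthS.
  apply: eq_from_tnth => i; rewrite tnth_mktuple.
  by case: (unliftP ord0 i) => [j ->|->//]; rewrite tnthS tnth_mktuple.
pose h (w : measurableTypeR R * Rn R n') : R :=
  cos ((a + 2 * pi * z%:~R * w.1) + 2 * pi * dot k w.2).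
have hE w : cos (a + 2 * pi * dot [tuple of z :: k] (cons_pair w)) = h w.
  by case: w => x y; rewrite dot_cons /h/=; congr cos; ring.
have mh : measurable_fun setT h.
  apply: measurable_cos_comp; apply: measurable_funD.
    by apply: measurable_funD => //; exact: measurable_funM.
  apply: measurable_funM => //.
  exact: (measurableT_comp (measurable_dot k)).
have inth : (@unit_measure R \x cube_prob R n')%E.-integrable setT (EFin \o h).
  apply: (@integrable_bounded_cst _ _ _ (@unit_measure R \x cube_prob R n')%E h 1 mh).
  by move=> w; rewrite ler_norml cos_geN1 cos_le1.
rewrite (Rintegral_distribution (f := fun x => cos (a + 2 * pi * dot [tuple of z :: k] x))).
- under eq_Rintegral do rewrite hE.
  rewrite /Rintegral -(integral12_prod_meas1 inth).
  transitivity (\int[@unit_measure R]_x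
      (if k == zero_freq n' then cos (a + 2 * pi * z%:~R * x) else 0)).
    rewrite /Rintegral; congr fine; apply: eq_integral => x _.
    rewrite -ih /fubini_F /Rintegral fineK//.
    apply: (integrable_fin_num measurableT).
    apply: (@integrable_bounded_cst _ _ _ _ _ 1); first exact: measurable_cos_dot.
    by move=> w; rewrite ler_norml cos_geN1 cos_le1.
  case: (k == _); first by rewrite Rintegral_cos_affine andbT.
  by rewrite andbF /Rintegral integral0.
- exact: measurable_cos_dot.
- by rewrite (_ : _ \o _ = EFin \o h)//; apply/funext => w; rewrite /= hE.
Qed.

Local Notation Q := (cube_prob R n).

(** Cosine for a = 0 and sine for a = - pi / 2, so that one orthogonality relation serves both
    families. *)
Definition wave (k : pos_freq n) (a : R) (x : Rn R n) : R :=
  Num.sqrt 2 * cos (a + 2 * pi * dot (val k) x).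

Lemma trig_cosE k : @trig_cos R n k = wave k 0.
Proof. by apply/funext => x; rewrite /wave add0r. Qed.

Lemma trig_sinE k : @trig_sin R n k = wave k (- (pi / 2)).
Proof. by apply/funext => x; rewrite /wave addrC cosBpihalf. Qed.

Lemma measurable_wave k a : measurable_fun setT (wave k a).
Proof. by apply: measurable_funM => //; exact: measurable_cos_dot. Qed.

Lemma wave_bound k a x : `|wave k a x| <= Num.sqrt 2.
Proof.
rewrite normrM ger0_norm ?sqrtr_ge0// ler_piMr ?sqrtr_ge0//.
by rewrite ler_norml cos_geN1 cos_le1.
Qed.

Lemma integrable_wave k a : Q.-integrable setT (EFin \o wave k a).
Proof. exact: integrable_bounded_cst (measurable_wave k a) (wave_bound k a). Qed.

Lemma Rintegral_wave k a : \int[Q]_x wave k a x = 0.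
Proof.
rewrite /wave RintegralZl//; last first.
  apply: (@integrable_bounded_cst _ _ _ _ _ 1); first exact: measurable_cos_dot.
  by move=> w; rewrite ler_norml cos_geN1 cos_le1.
by rewrite Rintegral_cos_cube (negbTE (lex_positive_nz (valP k))) mulr0.
Qed.

(** The product splits into cosines of frequencies k - l and k + l. The latter is never zero, since
    the opposite of a positive frequency is not positive; the former vanishes exactly for k = l. *)
Lemma Rintegral_waveM k l a b :
  \int[Q]_x (wave k a x * wave l b x) = if k == l then cos (a - b) else 0.
Proof.
pose dl (s : int) := [tuple tnth (val k) i + s * tnth (val l) i | i < n].
have dE s x : dot (dl s) x = dot (val k) x + s%:~R * dot (val l) x :> R.
  rewrite /dot mulr_sumr -big_split; apply: eq_bigr => i _.
  by rewrite tnth_mktuple intrD intrM /=; ring.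
have intc c s : Q.-integrable setT (EFin \o (fun x => cos (c + 2 * pi * dot (dl s) x))).
  apply: (@integrable_bounded_cst _ _ _ _ _ 1); first exact: measurable_cos_dot.
  by move=> w; rewrite ler_norml cos_geN1 cos_le1.
transitivity (\int[Q]_x (cos ((a - b) + 2 * pi * dot (dl (-1)) x) +
    cos ((a + b) + 2 * pi * dot (dl 1) x))).
  apply: eq_Rintegral => x _; rewrite !dE /wave mulrACA -expr2 sqr_sqrtr//.
  set A := a + 2 * pi * dot (val k) x; set B := b + 2 * pi * dot (val l) x.
  have -> : a - b + 2 * pi * (dot (val k) x + (-1)%:~R * dot (val l) x) = A - B.
    by rewrite /A /B; ring.
  have -> : a + b + 2 * pi * (dot (val k) x + 1%:~R * dot (val l) x) = A + B.
    by rewrite /A /B; ring.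
  by rewrite cosB cosD; ring.
rewrite RintegralD//.
rewrite !Rintegral_cos_cube.
have -> : (dl 1 == zero_freq n) = false.
  apply/negP => /eqP E; have := lex_positive_asym (valP k).
  rewrite (_ : opp_freq _ = val l) ?(valP l)//.
  apply: eq_from_tnth => i; rewrite tnth_mktuple.
  have := congr1 (fun t => tnth t i) E; rewrite !tnth_mktuple mul1r => /eqP.
  by rewrite addr_eq0 => /eqP ->; rewrite opprK.
rewrite addr0 (_ : (dl (-1) == zero_freq n) = (k == l))//.
apply/eqP/eqP => [E|kl].
  apply: val_inj; apply: eq_from_tnth => i.
  have := congr1 (fun t => tnth t i) E; rewrite !tnth_mktuple mulN1r => /eqP.
  by rewrite subr_eq0 => /eqP.
by apply: eq_from_tnth => i; rewrite !tnth_mktuple kl mulN1r subrr.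
Qed.

Local Notation S := (rect_sum (@trig_cos R n) (@trig_sin R n)).

Lemma rect_sumE a0 a b m x : S a0 a b m x = a0 +
  \sum_(k <- freq_seq m) (a k * wave k 0 x + b k * wave k (- (pi / 2)) x).
Proof.
rewrite /rect_sum freq_seq_sum.
by congr (_ + _); apply: eq_bigr => k _; rewrite trig_cosE trig_sinE.
Qed.

Lemma measurable_rect_sum a0 a b m : measurable_fun setT (S a0 a b m).
Proof.
rewrite (_ : S a0 a b m = fun x => a0 + \sum_(k <- freq_seq m)
    (a k * wave k 0 x + b k * wave k (- (pi / 2)) x)); last first.
  by apply/funext => x; exact: rect_sumE.
apply: measurable_funD => //; apply: measurable_sum => k.
by apply: measurable_funD; apply: measurable_funM => //; exact: measurable_wave.
Qed.

Lemma rect_sum_bound a0 a b m : exists M, forall x, `|S a0 a b m x| <= M.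
Proof.
exists (`|a0| + \sum_(k <- freq_seq m)
  (`|a k| * Num.sqrt 2 + `|b k| * Num.sqrt 2)) => x.
rewrite rect_sumE (le_trans (ler_normD _ _))// lerD2l (le_trans (ler_norm_sum _ _ _))//.
apply: ler_sum => k _; rewrite (le_trans (ler_normD _ _))//.
by apply: lerD; rewrite normrM ler_wpM2l// wave_bound.
Qed.

Lemma Rintegral_rect_sum a0 a b m : \int[Q]_x S a0 a b m x = a0.
Proof.
have intw (c : R) k t : Q.-integrable setT (EFin \o (fun x => c * wave k t x)).
  exact: (integrableZl _ c (integrable_wave k t)).
have intF k : Q.-integrable setT
    (EFin \o (fun x => a k * wave k 0 x + b k * wave k (- (pi / 2)) x)).
  exact: (integrableD _ (intw _ _ _) (intw _ _ _)).
under eq_Rintegral do rewrite rect_sumE.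
rewrite RintegralD//.
- rewrite Rintegral_cst// (_ : _ setT = 1%E) ?mulr1; last exact: probability_setT.
  rewrite Rintegral_sum// big1 ?addr0// => k _.
  rewrite RintegralD//.
  have wave0 (c t : R) : \int[Q]_x (c * wave k t x) = 0.
    by rewrite RintegralZl ?Rintegral_wave ?mulr0//; exact: integrable_wave.
  by rewrite !wave0 addr0.
- exact: finite_measure_integrable_cst.
- exact: integrable_sumr.
Qed.

(** The phase t = 0 reads off [a l], and t = - pi / 2 reads off [b l]. *)
Lemma Rintegral_rect_sum_wave a0 a b m l t : l \in freq_rect m ->
  \int[Q]_x (S a0 a b m x * wave l t x) = a l * cos t - b l * sin t.
Proof.
move=> lm.
have intw (c : R) k s : Q.-integrable setT (EFin \o (fun x => c * (wave k s x * wave l t x))).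
  have H : Q.-integrable setT (EFin \o (fun x => wave k s x * wave l t x)).
    exact: integrable_bounded (measurable_wave _ _) (wave_bound _ _) (integrable_wave _ _).
  exact: (integrableZl _ c H).
have intF k : Q.-integrable setT (EFin \o (fun x => a k * (wave k 0 x * wave l t x) +
    b k * (wave k (- (pi / 2)) x * wave l t x))).
  exact: (integrableD _ (intw _ _ _) (intw _ _ _)).
transitivity (\int[Q]_x (a0 * wave l t x + \sum_(k <- freq_seq m)
   (a k * (wave k 0 x * wave l t x) + b k * (wave k (- (pi / 2)) x * wave l t x)))).
  apply: eq_Rintegral => x _; rewrite rect_sumE mulrDl mulr_suml; congr (_ + _).
  by apply: eq_bigr => k _; rewrite mulrDl !mulrA.
rewrite RintegralD//; last 2 first.
- exact: (integrableZl _ a0 (integrable_wave _ _)).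
- exact: integrable_sumr.
rewrite RintegralZl//; last exact: integrable_wave.
rewrite Rintegral_wave mulr0 add0r Rintegral_sum//.
have E k : \int[Q]_x (a k * (wave k 0 x * wave l t x) +
    b k * (wave k (- (pi / 2)) x * wave l t x)) =
    if k == l then a l * cos t - b l * sin t else 0.
  rewrite RintegralD//.
  have int1 s : Q.-integrable setT (EFin \o (fun x => wave k s x * wave l t x)).
    exact: integrable_bounded (measurable_wave _ _) (wave_bound _ _) (integrable_wave _ _).
  rewrite !RintegralZl//.
  rewrite !Rintegral_waveM; case: eqP => [->|_]; last by rewrite !mulr0 addr0.
  have -> : - (pi / 2) - t = - (t + pi / 2) by ring.
  by rewrite sub0r !cosN cosDpihalf mulrN.
under eq_bigr do rewrite E.
rewrite (bigD1_seq l)/= ?uniq_freq_seq ?mem_freq_seq//.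
rewrite eqxx big1 ?addr0// => k /negbTE ->//.
Qed.

Lemma rect_sum_kernel_op (f : Rn R n -> R) m : Q.-integrable setT (EFin \o f) ->
  S (\int[Q]_y f y) (fun k => \int[Q]_y (f y * trig_cos k y))
    (fun k => \int[Q]_y (f y * trig_sin k y)) m = kernel_op Q (box_kernel m) f.
Proof.
move=> intf; apply/funext => x; rewrite rect_sumE.
have intw k s : Q.-integrable setT (EFin \o (fun y => f y * wave k s y)).
  rewrite (_ : _ \o _ = fun y => (wave k s y * f y)%:E); last first.
    by apply/funext => y /=; rewrite mulrC.
  exact: integrable_bounded (measurable_wave _ _) (wave_bound _ _) intf.
pose h := - (pi / 2) : R.
pose G k y := wave k 0 x * (f y * wave k 0 y) + wave k h x * (f y * wave k h y).
have intc (c : R) k s : Q.-integrable setT (EFin \o (fun y => c * (f y * wave k s y))).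
  exact: (integrableZl _ c (intw _ _)).
have intG k : Q.-integrable setT (EFin \o G k).
  exact: (integrableD _ (intc _ _ _) (intc _ _ _)).
transitivity (\int[Q]_y (f y + \sum_(k <- freq_seq m) G k y)).
  rewrite RintegralD//; last exact: integrable_sumr.
  rewrite Rintegral_sum//; congr (_ + _); apply: eq_bigr => k _.
  rewrite /G RintegralD//.
  rewrite !RintegralZl//.
  by rewrite trig_cosE trig_sinE -/h; congr (_ + _); rewrite mulrC.
apply: eq_Rintegral => y _; rewrite box_kernel_cos freq_seq_sum.
rewrite mulrDl mul1r mulr_suml; congr (_ + _); apply: eq_bigr => k _.
rewrite /G cosB -trig_cosE -trig_sinE /trig_cos /trig_sin.
set s := Num.sqrt 2; have s2 : s * s = 2 by rewrite -expr2 sqr_sqrtr.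
set cx := cos _; set sx := sin _; set cy := cos _; set sy := sin _.
transitivity (s * s * (cx * cy + sx * sy) * f y); last by rewrite s2.
ring.
Qed.

End orthogonality.

(** * Existence and uniqueness of the expansion *)

Section trigonometric_expansion.
Context (R : realType) (n : nat).
Local Notation Q := (cube_prob R n).
Local Notation S := (rect_sum (@trig_cos R n) (@trig_sin R n)).

Lemma mem_Lfun_cube (q : R) (f : Rn R n -> R) : 0 < q ->
  f \in Lfun (cube_measure R n) q%:E <->
  measurable_fun setT f /\ (energy Q q f < +oo)%E.
Proof.
move=> q0; have E : finite_norm (cube_measure R n) q%:E f <-> (energy Q q f < +oo)%E.
  rewrite /finite_norm Lnorm_cube; split => [H|H].
    by rewrite energyE ?gt_eqF// poweR_lty.
  by rewrite LnormE_energy ?gt_eqF// poweR_lty.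
split => [/andP[/set_mem mf /set_mem/E foo]//|[mf /E foo]].
by apply/andP; split; rewrite inE.
Qed.

Lemma mem_Lfun_cube_bounded (q M : R) (f : Rn R n -> R) : 0 < q ->
  measurable_fun setT f -> (forall x, `|f x| <= M) ->
  f \in Lfun (cube_measure R n) q%:E.
Proof.
move=> q0 mf fM; apply/mem_Lfun_cube => //; split => //.
apply: (@le_lt_trans _ _ (energy Q q (fun=> M))).
  apply: le_energy => //; first exact: ltW.
  by move=> x; rewrite (le_trans (fM x))// ler_norm.
by rewrite energy_cst ltry.
Qed.

Lemma pringsheim_expansion_cube (q : R) (f : Rn R n -> R) : 1 < q ->
  measurable_fun setT f -> (energy Q q f < +oo)%E ->
  pringsheim_expansion (cube_measure R n) q%:E (@trig_cos R n) (@trig_sin R n) f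
    (\int[Q]_x f x) (fun k => \int[Q]_x (f x * trig_cos k x))
    (fun k => \int[Q]_x (f x * trig_sin k x)).
Proof.
move=> q1 mf foo; have q0 : 0 < q by exact: lt_trans q1.
have intf := energy_integrable (ltW q1) mf foo.
apply: pringsheim_sequence => u uoo.
have := op_cvg_box q1 uoo mf foo; move=> E0.
apply: near_le_cvge0 => [j|e e0]; first exact: Lnorm_ge0.
have eq0 : 0 < e `^ q by exact: powR_gt0.
apply: filterS (cvge0_near_le eq0 E0) => j Ej.
rewrite Lnorm_cube rect_sum_kernel_op// LnormE_energy ?gt_eqF//.
have -> : e%:E = (((e `^ q)%:E) `^ q^-1)%E.
  by rewrite poweR_EFin -powRrM mulfV ?gt_eqF// powRr1// ltW.
apply: gt0_ler_poweR; rewrite ?in_itv/= ?leey ?andbT ?lee_fin ?powR_ge0//.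
- by rewrite invr_ge0 ltW.
- exact: energy_ge0.
Qed.

Lemma pringsheim_mem (k : pos_freq n) : \forall m \near @pringsheim n, k \in freq_rect m.
Proof.
exists (\max_(i < n) `|tnth (val k) i|)%N => // m mk /=; rewrite inE => i.
by apply: leq_trans (mk i); exact: leq_bigmax.
Qed.

(** Each k eventually lies in the rectangle, after which testing the partial sum against its cosine
    or sine gives exactly the coefficient; [Rintegral_limit] transfers that value to f. *)
Lemma pringsheim_expansion_unique (q : R) (f : Rn R n -> R) a0 a b : 1 < q ->
  measurable_fun setT f -> (energy Q q f < +oo)%E ->
  pringsheim_expansion (cube_measure R n) q%:E (@trig_cos R n) (@trig_sin R n) f a0 a b ->
  (\int[Q]_x f x, fun k => \int[Q]_x (f x * trig_cos k x),
    fun k => \int[Q]_x (f x * trig_sin k x)) = (a0, a, b).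
Proof.
move=> q1 mf foo Ef.
have C : ('N[Q]_q%:E[EFin \o (f \- S a0 a b m)%R] @[m --> @pringsheim n] --> 0)%E.
  by under eq_fun do rewrite -Lnorm_cube.
have lim (g : Rn R n -> R) (B L : R) : measurable_fun setT g -> (forall x, `|g x| <= B) ->
    (\forall m \near @pringsheim n, \int[Q]_x (S a0 a b m x * g x) = L) ->
    \int[Q]_x (f x * g x) = L.
  move=> mg gB; apply: (Rintegral_limit (ltW q1) mf foo mg gB _ _ C).
    by move=> m; exact: measurable_rect_sum.
  by move=> m; exact: rect_sum_bound.
congr (_, _, _).
- transitivity (\int[Q]_x (f x * 1)); first by apply: eq_Rintegral => x _; rewrite mulr1.
  apply: (lim (cst 1) 1) => //; first by move=> x; rewrite normr1.
  apply: nearW => m; rewrite -[RHS](Rintegral_rect_sum a0 a b m).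
  by apply: eq_Rintegral => x _; rewrite mulr1.
- apply/funext => k; rewrite trig_cosE.
  apply: (lim _ _ _ (measurable_wave k 0) (wave_bound k 0)).
  apply: filterS (pringsheim_mem k) => m km.
  by rewrite Rintegral_rect_sum_wave// cos0 sin0 mulr0 mulr1 subr0.
- apply/funext => k; rewrite trig_sinE.
  apply: (lim _ _ _ (measurable_wave k _) (wave_bound k _)).
  apply: filterS (pringsheim_mem k) => m km.
  by rewrite Rintegral_rect_sum_wave// cosN sinN cos_pihalf sin_pihalf mulr0 mulrN1 opprK add0r.
Qed.

End trigonometric_expansion.

Theorem proposition3p8 (R : realType) (n : nat) (hn : (1 <= n)%N)
    (q : R) (hq : 1 < q) :
  pringsheim_basis (cube_measure R n) q%:E (@trig_cos R n) (@trig_sin R n).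
Proof.
have q0 : 0 < q by exact: lt_trans hq.
split.
- by apply: (@mem_Lfun_cube_bounded _ _ _ 1) => // x; rewrite normr1.
- move=> k; rewrite trig_cosE.
  by apply: mem_Lfun_cube_bounded => //; [exact: measurable_wave|exact: wave_bound].
- move=> k; rewrite trig_sinE.
  by apply: mem_Lfun_cube_bounded => //; [exact: measurable_wave|exact: wave_bound].
move=> f /(mem_Lfun_cube _ q0)[mf foo].
eexists (_, _, _); split; first exact: pringsheim_expansion_cube.
by move=> [[a0 a] b] /= H; exact: pringsheim_expansion_unique H.
Qed.
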